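(* Let $n\ge 1$ and $T>0$. Let $a^{ij},b:\mathbb{R}^n\times[0,T]\to\mathbb{R}$ ($1\le i,j\le n$) be continuous functions such that for every $(p,t)$ the matrix $A(p,t)=(a^{ij}(p,t))$ is symmetric and positive semi-definite. Suppose there is a continuous function $\alpha:[0,\infty)\times[0,T]\to\mathbb{R}$ with $\alpha>0$ everywhere and $$\alpha(R,t)\le R^2\inf\Big\{\frac{v^{T}A(p,t)v}{(v\cdot p)^2}\;:\; p,v\in\mathbb{R}^n,\ |p|=R,\ v\cdot p\neq 0\Big\}\quad\text{for all } R>0,\ t\in[0,T].$$ Let $u:\mathbb{R}^n\times[0,T]\to\mathbb{R}$ be a continuous viscosity solution of $$u_t=a^{ij}(Du,t)D_iD_ju+b(Du,t)$$ (summation over $i,j$) on $\mathbb{R}^n\times(0,T)$, which is spatially periodic: there is a lattice $\Lambda\subset\mathbb{R}^n$ of rank $n$ with $u(x+\gamma,t)=u(x,t)$ for all $\gamma\in\Lambda$, $x\in\mathbb{R}^n$, $t\in[0,T]$. Define $$\omega(s,t)=\sup\Big\{\tfrac{u(y,t)-u(x,t)}{2}\;:\;x,y\in\mathbb{R}^n,\ \tfrac{|y-x|}{2}=s\Big\}.$$ Then $\omega$ is a viscosity subsolution of the one-dimensional equation $\phi_t=\alpha(|\phi'|,t)\phi''$ on $(0,\infty)\times(0,T)$; that is, whenever $\phi$ is a smooth function near $(s_0,t_0)$ with $s_0>0$, $0<t_0<T$, such that $\omega-\phi$ has a local maximum at $(s_0,t_0)$, then at $(s_0,t_0)$ $$\phi_t\le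 \alpha(|\phi'|,t_0)\,\phi'' ,$$ where $'$ denotes differentiation in $s$.
   Context: Viscosity solutions of $u_t+F(x,t,u,Du,D^2u)=0$ (here $F(x,t,r,p,X)=-\operatorname{tr}(A(p,t)X)-b(p,t)$, continuous and degenerate elliptic): a continuous $u$ is a viscosity subsolution if for every smooth $\varphi$ such that $u-\varphi$ has a local maximum at $z_0=(x_0,t_0)$ in the open domain, $\varphi_t(z_0)+F(z_0,u(z_0),D\varphi(z_0),D^2\varphi(z_0))\le 0$; a viscosity supersolution if for every smooth $\varphi$ such that $u-\varphi$ has a local minimum at $z_0$, $\varphi_t(z_0)+F(z_0,u(z_0),D\varphi(z_0),D^2\varphi(z_0))\ge 0$; a viscosity solution is a continuous function that is both. The function $\omega$ is called the (optimal) modulus of continuity of $u(\cdot,t)$. *)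

(* Defs.v *)
From Stdlib Require Import Reals List ClassicalEpsilon.
From Stdlib Require Vectors.Fin.
Open Scope R_scope.

Definition vec (n : nat) := Fin.t n -> R.

Fixpoint fsum (n : nat) : (Fin.t n -> R) -> R :=
  match n return (Fin.t n -> R) -> R with
  | O => fun _ => 0
  | S m => fun f => f Fin.F1 + fsum m (fun i => f (Fin.FS i))
  end.

Definition vadd {n} (x y : vec n) : vec n := fun i => x i + y i.
Definition vsub {n} (x y : vec n) : vec n := fun i => x i - y i.
Definition vscal {n} (c : R) (x : vec n) : vec n := fun i => c * x i.
Definition dot {n} (x y : vec n) : R := fsum n (fun i => x i * y i).
Definition vnorm {n} (x : vec n) : R := sqrt (dot x x).
Definition unitv {n} (i : Fin.t n) : vec n :=
  fun j => if Fin.eq_dec i j then 1 else 0.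

Definition quadform {n} (a : Fin.t n -> Fin.t n -> R) (v : vec n) : R :=
  fsum n (fun i => fsum n (fun j => a i j * v i * v j)).

Definition dist_nt {n} (x : vec n) (t : R) (y : vec n) (s : R) : R :=
  vnorm (vsub y x) + Rabs (s - t).
Definition dist2 (x t y s : R) : R := Rabs (y - x) + Rabs (s - t).

Definition cont_on_nt {n} (D : vec n -> R -> Prop) (f : vec n -> R -> R) : Prop :=
  forall x t, D x t -> forall eps, 0 < eps -> exists delta, 0 < delta /\
    forall y s, D y s -> dist_nt x t y s < delta -> Rabs (f y s - f x t) < eps.

Definition cont_on_2 (D : R -> R -> Prop) (f : R -> R -> R) : Prop :=
  forall x t, D x t -> forall eps, 0 < eps -> exists delta, 0 < delta /\
    forall y s, D y s -> dist2 x t y s < delta -> Rabs (f y s - f x t) < eps.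

(* C^infinity on the open set U of R^n x R: Dphi l is the iterated partial
   derivative of phi := Dphi nil along the list l of directions
   (Some i = d/dx_i, None = d/dt); Dphi (k :: l) = d_k (Dphi l). *)
Definition smooth_family_nt {n} (U : vec n -> R -> Prop)
    (Dphi : list (option (Fin.t n)) -> vec n -> R -> R) : Prop :=
  forall l,
    cont_on_nt U (Dphi l) /\
    forall x t, U x t ->
      (forall i, derivable_pt_lim (fun h => Dphi l (vadd x (vscal h (unitv i))) t) 0
                   (Dphi (Some i :: l) x t)) /\
      derivable_pt_lim (fun h => Dphi l x (t + h)) 0 (Dphi (None :: l) x t).

Definition smooth_family_2 (U : R -> R -> Prop)
    (Dphi : list bool -> R -> R -> R) : Prop :=
  forall l,
    cont_on_2 U (Dphi l) /\
    forall s t, U s t ->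
      derivable_pt_lim (fun h => Dphi l (s + h) t) 0 (Dphi (true :: l) s t) /\
      derivable_pt_lim (fun h => Dphi l s (t + h)) 0 (Dphi (false :: l) s t).

(* viscosity sub/supersolution of u_t = a^{ij}(Du,t) D_iD_j u + b(Du,t)
   on R^n x (0,T), i.e. u_t + F(Du,D^2u) = 0 with F = -tr(A X) - b *)
Definition F_op {n} (a : Fin.t n -> Fin.t n -> vec n -> R -> R) (b : vec n -> R -> R)
    (t : R) (p : vec n) (X : Fin.t n -> Fin.t n -> R) : R :=
  - fsum n (fun i => fsum n (fun j => a i j p t * X i j)) - b p t.

Definition par_domain {n} (T : R) : vec n -> R -> Prop := fun _ t => 0 < t < T.

Definition visc_sub {n} (T : R) (a : Fin.t n -> Fin.t n -> vec n -> R -> R)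
    (b : vec n -> R -> R) (u : vec n -> R -> R) : Prop :=
  forall Dphi, smooth_family_nt (par_domain T) Dphi ->
  forall x0 t0, 0 < t0 < T ->
  (exists r, 0 < r /\ forall y s, dist_nt x0 t0 y s < r ->
      u y s - Dphi nil y s <= u x0 t0 - Dphi nil x0 t0) ->
  Dphi (None :: nil) x0 t0
    + F_op a b t0 (fun i => Dphi (Some i :: nil) x0 t0)
        (fun i j => Dphi (Some i :: Some j :: nil) x0 t0) <= 0.

Definition visc_super {n} (T : R) (a : Fin.t n -> Fin.t n -> vec n -> R -> R)
    (b : vec n -> R -> R) (u : vec n -> R -> R) : Prop :=
  forall Dphi, smooth_family_nt (par_domain T) Dphi ->
  forall x0 t0, 0 < t0 < T ->
  (exists r, 0 < r /\ forall y s, dist_nt x0 t0 y s < r ->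
      u y s - Dphi nil y s >= u x0 t0 - Dphi nil x0 t0) ->
  Dphi (None :: nil) x0 t0
    + F_op a b t0 (fun i => Dphi (Some i :: nil) x0 t0)
        (fun i j => Dphi (Some i :: Some j :: nil) x0 t0) >= 0.

Definition visc_sol {n} (T : R) a b (u : vec n -> R -> R) : Prop :=
  cont_on_nt (fun _ t => 0 <= t <= T) u /\ visc_sub T a b u /\ visc_super T a b u.

(* u(.,t) is periodic w.r.t. a lattice of rank n: the Z-span of n linearly
   independent vectors B 1, ..., B n *)
Definition lin_indep {n} (B : Fin.t n -> vec n) : Prop :=
  forall c : vec n, (forall k, fsum n (fun i => c i * B i k) = 0) -> forall i, c i = 0.

Definition lattice_vec {n} (B : Fin.t n -> vec n) (k : Fin.t n -> Z) : vec n :=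
  fun j => fsum n (fun i => IZR (k i) * B i j).

(* supremum (least upper bound) of a set of reals, when it exists *)
Definition supR (E : R -> Prop) : R := epsilon (inhabits 0) (fun l => is_lub E l).

Definition omega {n} (u : vec n -> R -> R) (s t : R) : R :=
  supR (fun z => exists x y : vec n, vnorm (vsub y x) / 2 = s /\ z = (u y t - u x t) / 2).

(* Main.v *)
(** Let [U] and [V] be the sup- and inf-convolution of [u] in space. The function
    [U(y,t) - V(x,t) - 2 phi(|y-x|/2,t)] has a maximum at which both arguments
    carry the same gradient [p = phi' e]. Near it, semiconvexity of [U] and [-V] allows
    one to freeze the coefficients at the price of an arbitrarily small multiple
    of the identity, so that [U] is a subsolution and [V] a supersolution of one
    linear equation with constant coefficients [A(p,t) + nu I]. For such an equation
    no theorem on sums is needed: the values of [U] and [V] at the maximum are compared with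
    explicit heat flows of trigonometric sums that approximate [U] and [V] a
    short time [h] earlier, and the difference of the two flows is controlled by
    the classical maximum principle in the variables [(x,y)], with the two points coupled by
    reflection along [e] (with weight [alpha]) and by translation in the
    remaining directions. Dividing by [h] gives the inequality for [phi] at the maximum,
    which converges to [(s0,t0)] as the convolution parameter tends to infinity. *)
Require Import Defs.
From Stdlib Require Import Reals List Psatz ClassicalEpsilon FunctionalExtensionality.
From Stdlib Require Vectors.Fin.
Open Scope R_scope.

(** The error terms depend on these sums only through the common bound [M], so the sums may be
    chosen after [h], and their accuracy sent to zero before dividing by [h]. The limits are taken
    in a fixed order: accuracy of the sums, then [h], then [nu], then the slack [del] in the Hessian
    of the test function, and last the convolution parameter. Freezing costs a multiple of
    [kap * nu], which vanishes because [kap] is fixed while [nu] tends to zero. The hypothesis on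
    [alpha] is used as the matrix inequality [A(p, t) >= alpha e e^T], the part of the diffusion
    that reflection can exploit. Reflection changes [y - x] by twice the displacement of each point;
    since [2 phi(|y - x| / 2)] has quadratic coefficient [phi'' / 4] along [e], this yields
    [8 * (phi'' / 4) * alpha = 2 alpha phi''], to be compared with [2 phi_t]. The two terms in [b]
    cancel because both gradients equal [p]. *)

Local Notation mat n := (Fin.t n -> Fin.t n -> R).

Local Notation cont_strip T := (cont_on_nt (fun _ t => 0 <= t <= T)).

Definition vopp {n} (x : vec n) : vec n := fun i => - x i.

Ltac vec_ring :=
  let i := fresh "i" in extensionality i; unfold vadd, vsub, vscal, vopp; ring.

(** Radii are chosen as nested minima throughout; this hands both bounds of each minimum to [lra].
    The guard in [note] keeps the loop from adding the same pair twice. *)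
Ltac Rmin_bounds :=
  let note a b :=
    lazymatch goal with
    | _ : Rmin a b <= a |- _ => fail
    | _ => pose proof (Rmin_l a b); pose proof (Rmin_r a b)
    end in
  repeat match goal with
  | |- context [Rmin ?a ?b] => note a b
  | _ : context [Rmin ?a ?b] |- _ => note a b
  end.

(** * Finite sums, inner product and Euclidean norm *)

Lemma fsum_ext n (f g : Fin.t n -> R) : (forall i, f i = g i) -> fsum n f = fsum n g.
Proof. intros H; f_equal; extensionality i; apply H. Qed.

Lemma fsum_zero n (f : Fin.t n -> R) : (forall i, f i = 0) -> fsum n f = 0.
Proof. induction n; intros H; simpl; [easy | rewrite H, IHn by auto; lra]. Qed.

Lemma Rabs_le_both x y : Rabs x <= y -> - y <= x <= y.
Proof. intros H. pose proof (Rle_abs x). pose proof (Rle_abs (- x)). rewrite Rabs_Ropp in *; lra. Qed.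

Lemma fsum_0 n : fsum n (fun _ => 0) = 0.
Proof. now apply fsum_zero. Qed.

Lemma fsum_plus n (f g : Fin.t n -> R) : fsum n (fun i => f i + g i) = fsum n f + fsum n g.
Proof. induction n; simpl; [lra | rewrite IHn; lra]. Qed.

Lemma fsum_scal n c (f : Fin.t n -> R) : fsum n (fun i => c * f i) = c * fsum n f.
Proof. induction n; simpl; [lra | rewrite IHn; lra]. Qed.

Lemma fsum_le n (f g : Fin.t n -> R) : (forall i, f i <= g i) -> fsum n f <= fsum n g.
Proof.
  induction n; simpl; intros H; [lra|].
  apply Rplus_le_compat; [apply H | apply IHn; intros; apply H].
Qed.

Lemma fsum_nonneg n (f : Fin.t n -> R) : (forall i, 0 <= f i) -> 0 <= fsum n f.
Proof. intros H; rewrite <- (fsum_0 n); now apply fsum_le. Qed.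

Lemma fsum_const n c : fsum n (fun _ => c) = INR n * c.
Proof. induction n; [simpl; lra | rewrite S_INR; simpl; rewrite IHn; lra]. Qed.

Lemma fsum_swap m n (f : Fin.t m -> Fin.t n -> R) :
  fsum m (fun i => fsum n (fun j => f i j)) = fsum n (fun j => fsum m (fun i => f i j)).
Proof.
  induction m; simpl; [now rewrite fsum_0|].
  now rewrite IHm, fsum_plus.
Qed.

Lemma fsum_ge_term n (f : Fin.t n -> R) : (forall i, 0 <= f i) -> forall i, f i <= fsum n f.
Proof.
  intros H i; induction i; simpl.
  - assert (0 <= fsum n (fun i => f (Fin.FS i))) by (apply fsum_nonneg; auto); lra.
  - specialize (IHi (fun i => f (Fin.FS i)) (fun i => H _)); simpl in IHi.
    pose proof (H Fin.F1); lra.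
Qed.

Lemma fsum_unitv n (i : Fin.t n) (f : Fin.t n -> R) : fsum n (fun j => unitv i j * f j) = f i.
Proof.
  unfold unitv; induction i; simpl.
  - rewrite (fsum_ext _ _ (fun _ => 0)), fsum_0.
    { destruct (Fin.eq_dec Fin.F1 Fin.F1); [lra | congruence]. }
    intros j; destruct (Fin.eq_dec Fin.F1 (Fin.FS j)); [discriminate | lra].
  - destruct (Fin.eq_dec (Fin.FS i) Fin.F1); [discriminate|].
    rewrite <- (IHi (fun j => f (Fin.FS j))), Rmult_0_l, Rplus_0_l.
    apply fsum_ext; intros j.
    destruct (Fin.eq_dec i j) as [e|e], (Fin.eq_dec (Fin.FS i) (Fin.FS j)) as [e'|e']; try reflexivity.
    + now rewrite e in e'.
    + now apply Fin.FS_inj in e'.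
Qed.

Lemma dot_sym n (x y : vec n) : dot x y = dot y x.
Proof. apply fsum_ext; intros; ring. Qed.

Lemma dot_add_l n (x y z : vec n) : dot (vadd x y) z = dot x z + dot y z.
Proof. unfold dot, vadd; rewrite <- fsum_plus; apply fsum_ext; intros; ring. Qed.

Lemma dot_scal_l n c (x z : vec n) : dot (vscal c x) z = c * dot x z.
Proof. unfold dot, vscal; rewrite <- fsum_scal; apply fsum_ext; intros; ring. Qed.

Lemma dot_sub_l n (x y z : vec n) : dot (vsub x y) z = dot x z - dot y z.
Proof.
  replace (vsub x y) with (vadd x (vscal (-1) y)) by vec_ring.
  rewrite dot_add_l, dot_scal_l; ring.
Qed.

Lemma dot_add_r n (x y z : vec n) : dot z (vadd x y) = dot z x + dot z y.
Proof. now rewrite dot_sym, dot_add_l, (dot_sym _ x), (dot_sym _ y). Qed.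

Lemma dot_scal_r n c (x z : vec n) : dot z (vscal c x) = c * dot z x.
Proof. now rewrite dot_sym, dot_scal_l, (dot_sym _ x). Qed.

Lemma dot_sub_r n (x y z : vec n) : dot z (vsub x y) = dot z x - dot z y.
Proof. now rewrite dot_sym, dot_sub_l, (dot_sym _ x), (dot_sym _ y). Qed.

Lemma dot_0_l n (v : vec n) : dot (fun _ => 0) v = 0.
Proof. apply fsum_zero; intros; ring. Qed.

Lemma dot_0_r n (v : vec n) : dot v (fun _ => 0) = 0.
Proof. rewrite dot_sym; apply dot_0_l. Qed.

Lemma dot_unitv_l n (i : Fin.t n) (x : vec n) : dot (unitv i) x = x i.
Proof. apply fsum_unitv. Qed.

Lemma dot_ge0 n (x : vec n) : 0 <= dot x x.
Proof. apply fsum_nonneg; intros; nra. Qed.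

Lemma vnorm_sq n (x : vec n) : vnorm x * vnorm x = dot x x.
Proof. apply sqrt_sqrt, dot_ge0. Qed.

Lemma vnorm_ge0 n (x : vec n) : 0 <= vnorm x.
Proof. apply sqrt_pos. Qed.

Lemma dot_self_eq0 n (x : vec n) : dot x x = 0 -> forall i, x i = 0.
Proof.
  intros H i.
  assert (x i * x i <= dot x x)
    by (apply (fsum_ge_term n (fun i => x i * x i)); intros; nra).
  nra.
Qed.

Lemma cauchy_sq n (x y : vec n) : dot x y * dot x y <= dot x x * dot y y.
Proof.
  pose proof (dot_ge0 _ x) as Hx; pose proof (dot_ge0 _ y) as Hy.
  destruct (Req_dec (dot y y) 0) as [E|E].
  - assert (dot x y = 0) as ->; [|nra].
    apply fsum_zero; intros i; rewrite (dot_self_eq0 _ y E i); ring.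
  - pose proof (dot_ge0 _ (vsub (vscal (dot y y) x) (vscal (dot x y) y))) as H.
    rewrite dot_sub_l, !dot_sub_r, !dot_scal_l, !dot_scal_r, (dot_sym _ y x) in H.
    assert (0 <= dot y y * (dot x x * dot y y - dot x y * dot x y)) by nra.
    apply Rmult_le_reg_l with (dot y y); lra.
Qed.

Lemma cauchy n (x y : vec n) : Rabs (dot x y) <= vnorm x * vnorm y.
Proof.
  apply Rsqr_incr_0_var; [|apply Rmult_le_pos; apply vnorm_ge0].
  rewrite <- Rsqr_abs; unfold Rsqr.
  replace (vnorm x * vnorm y * (vnorm x * vnorm y))
    with ((vnorm x * vnorm x) * (vnorm y * vnorm y)) by ring.
  rewrite !vnorm_sq; apply cauchy_sq.
Qed.

Lemma vnorm_le n (x : vec n) c : 0 <= c -> dot x x <= c * c -> vnorm x <= c.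
Proof. intros Hc H; apply Rsqr_incr_0_var; auto; unfold Rsqr; now rewrite vnorm_sq. Qed.

Lemma vnorm_triang n (x y : vec n) : vnorm (vadd x y) <= vnorm x + vnorm y.
Proof.
  pose proof (vnorm_ge0 _ x); pose proof (vnorm_ge0 _ y).
  apply vnorm_le; [lra|].
  rewrite dot_add_l, !dot_add_r, (dot_sym _ y x).
  pose proof (cauchy _ x y); pose proof (Rle_abs (dot x y)).
  pose proof (vnorm_sq _ x); pose proof (vnorm_sq _ y); nra.
Qed.

Lemma vnorm_scal n c (x : vec n) : vnorm (vscal c x) = Rabs c * vnorm x.
Proof.
  unfold vnorm; rewrite dot_scal_l, dot_scal_r, <- Rmult_assoc.
  rewrite sqrt_mult_alt by nra. now rewrite <- (sqrt_Rsqr_abs c).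
Qed.

Lemma vnorm_0 n : vnorm (fun _ : Fin.t n => 0) = 0.
Proof. unfold vnorm; rewrite dot_0_l; apply sqrt_0. Qed.

Lemma vnorm_comp n (x : vec n) i : Rabs (x i) <= vnorm x.
Proof.
  apply Rsqr_incr_0_var; [|apply vnorm_ge0]. rewrite <- Rsqr_abs; unfold Rsqr; rewrite vnorm_sq.
  apply (fsum_ge_term n (fun i => x i * x i)); intros; nra.
Qed.

Lemma vnorm_sub_sym n (x y : vec n) : vnorm (vsub x y) = vnorm (vsub y x).
Proof.
  replace (vsub x y) with (vscal (-1) (vsub y x)) by vec_ring.
  rewrite vnorm_scal, Rabs_left; lra.
Qed.

Lemma vnorm_sub_triang n (x y z : vec n) : vnorm (vsub x z) <= vnorm (vsub x y) + vnorm (vsub y z).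
Proof.
  replace (vsub x z) with (vadd (vsub x y) (vsub y z)) by vec_ring.
  apply vnorm_triang.
Qed.

Lemma vnorm_sub_le n (x y : vec n) : vnorm (vsub x y) <= vnorm x + vnorm y.
Proof.
  replace (vsub x y) with (vadd x (vscal (-1) y)) by vec_ring.
  eapply Rle_trans; [apply vnorm_triang|]. rewrite vnorm_scal, Rabs_left by lra; lra.
Qed.

Lemma vnorm_le_sub n (x y : vec n) : vnorm x <= vnorm y + vnorm (vsub x y).
Proof.
  replace x with (vadd y (vsub x y)) at 1 by vec_ring.
  apply vnorm_triang.
Qed.

Lemma vnorm_diff_le n (x y : vec n) : Rabs (vnorm x - vnorm y) <= vnorm (vsub x y).
Proof.
  pose proof (vnorm_le_sub _ x y). pose proof (vnorm_le_sub _ y x) as H'. rewrite vnorm_sub_sym in H'.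
  apply Rabs_le; lra.
Qed.

Lemma vadd_0 n (x : vec n) : vadd x (fun _ => 0) = x.
Proof. vec_ring. Qed.

Lemma vadd_vsub n (x y : vec n) : vadd x (vsub y x) = y.
Proof. vec_ring. Qed.

Lemma vsub_vadd n (x y : vec n) : vsub (vadd x y) x = y.
Proof. vec_ring. Qed.

Lemma vsub_self n (x : vec n) : vsub x x = fun _ => 0.
Proof. vec_ring. Qed.

(** * Matrices, traces and quadratic forms *)

Definition idm {n} (i j : Fin.t n) : R := unitv i j.
Definition symm {n} (X : mat n) := forall i j, X i j = X j i.
Definition frob {n} (a X : mat n) : R :=
  fsum n (fun i => fsum n (fun j => a i j * X i j)).
Lemma idm_sym n (i j : Fin.t n) : idm i j = idm j i.
Proof.
  unfold idm, unitv.
  destruct (Fin.eq_dec i j), (Fin.eq_dec j i); congruence.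
Qed.

Lemma frob_plus_r n (a X Y : mat n) c :
  frob a (fun i j => X i j + c * Y i j) = frob a X + c * frob a Y.
Proof.
  unfold frob; rewrite <- fsum_scal, <- fsum_plus; apply fsum_ext; intros i.
  rewrite <- fsum_scal, <- fsum_plus; apply fsum_ext; intros; ring.
Qed.

Lemma frob_sym n (a X : mat n) : frob a X = frob X a.
Proof. unfold frob; apply fsum_ext; intros; apply fsum_ext; intros; ring. Qed.

Lemma frob_plus_l n (a b X : mat n) c :
  frob (fun i j => a i j + c * b i j) X = frob a X + c * frob b X.
Proof. now rewrite frob_sym, frob_plus_r, (frob_sym _ X), (frob_sym _ X). Qed.

Lemma quadform_frob n (X : mat n) v : quadform X v = frob (fun i j => v i * v j) X.
Proof. unfold quadform, frob; apply fsum_ext; intros; apply fsum_ext; intros; ring. Qed.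

Lemma quadform_plus n (X Y : mat n) c v :
  quadform (fun i j => X i j + c * Y i j) v = quadform X v + c * quadform Y v.
Proof. rewrite !quadform_frob; apply frob_plus_r. Qed.

Lemma quadform_rank1 n (l v : vec n) : quadform (fun i j => l i * l j) v = dot l v * dot l v.
Proof.
  unfold quadform, dot at 1; rewrite Rmult_comm, <- fsum_scal; apply fsum_ext; intros i.
  unfold dot. rewrite Rmult_comm, <- fsum_scal. apply fsum_ext; intros j; ring.
Qed.

Lemma quadform_idm n (v : vec n) : quadform idm v = dot v v.
Proof.
  unfold quadform, dot; apply fsum_ext; intros i.
  rewrite <- (fsum_unitv n i (fun j => v i * v j)).
  apply fsum_ext; intros; unfold idm; ring.
Qed.

Lemma frob_idm n (X : mat n) : frob idm X = fsum n (fun i => X i i).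
Proof. apply fsum_ext; intros i; apply (fsum_unitv n i (fun j => X i j)). Qed.

Lemma quadform_scal n (X : mat n) c v : quadform X (vscal c v) = c * c * quadform X v.
Proof.
  unfold quadform; rewrite <- fsum_scal; apply fsum_ext; intros.
  rewrite <- fsum_scal; apply fsum_ext; intros; unfold vscal; ring.
Qed.

Lemma quadform_0 n (v : vec n) : quadform (fun _ _ => 0) v = 0.
Proof. apply fsum_zero; intros; apply fsum_zero; intros; ring. Qed.

Lemma quadform_0_r n (X : mat n) : quadform X (fun _ => 0) = 0.
Proof. apply fsum_zero; intros; apply fsum_zero; intros; ring. Qed.

(** This is the trace of [X] against the matrix [rank1_sum dirs] (see [frob_rank1_sum]). The list
    form is kept because the coupling treats the first direction differently from the others. *)
Definition lap {n} (dirs : list (vec n)) (X : mat n) : R :=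
  fold_right (fun s r => quadform X s + r) 0 dirs.

Lemma lap_plus n dirs (X Y : mat n) c :
  lap dirs (fun i j => X i j + c * Y i j) = lap dirs X + c * lap dirs Y.
Proof. induction dirs; simpl; [lra | rewrite IHdirs, quadform_plus; lra]. Qed.

Lemma lap_nonneg n dirs (X : mat n) : (forall v, 0 <= quadform X v) -> 0 <= lap dirs X.
Proof. intros H; induction dirs; simpl; [lra | specialize (H a); lra]. Qed.

(** * Rank-one decomposition of positive semi-definite matrices *)

Lemma fin_case n (P : Fin.t (S n) -> Prop) : P Fin.F1 -> (forall i, P (Fin.FS i)) -> forall i, P i.
Proof. intros H1 H2 i; now apply (Fin.caseS' i). Qed.

Definition vcons {n} (c : R) (v : vec n) : vec (S n) :=
  fun i => Fin.caseS' i (fun _ => R) c v.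
Definition vtl {n} (v : vec (S n)) : vec n := fun i => v (Fin.FS i).

Lemma dot_S n (v w : vec (S n)) : dot v w = v Fin.F1 * w Fin.F1 + dot (vtl v) (vtl w).
Proof. reflexivity. Qed.

Lemma quadform_S n (X : Fin.t (S n) -> Fin.t (S n) -> R) v : symm X ->
  quadform X v = X Fin.F1 Fin.F1 * v Fin.F1 * v Fin.F1
    + 2 * v Fin.F1 * dot (fun i => X Fin.F1 (Fin.FS i)) (vtl v)
    + quadform (fun i j => X (Fin.FS i) (Fin.FS j)) (vtl v).
Proof.
  intros HX. unfold quadform; simpl.
  rewrite fsum_plus.
  assert (fsum n (fun i => X (Fin.FS i) Fin.F1 * v (Fin.FS i) * v Fin.F1)
    = v Fin.F1 * dot (fun i => X Fin.F1 (Fin.FS i)) (vtl v)) as ->.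
  { unfold dot; rewrite <- fsum_scal; apply fsum_ext; intros i.
    rewrite (HX (Fin.FS i)); unfold vtl; ring. }
  assert (fsum n (fun i => X Fin.F1 (Fin.FS i) * v Fin.F1 * v (Fin.FS i))
    = v Fin.F1 * dot (fun i => X Fin.F1 (Fin.FS i)) (vtl v)) as ->.
  { unfold dot; rewrite <- fsum_scal; apply fsum_ext; intros i; unfold vtl; ring. }
  unfold vtl; ring.
Qed.

Definition rank1_sum {n} (dirs : list (vec n)) (i j : Fin.t n) : R :=
  fold_right (fun s r => s i * s j + r) 0 dirs.

Lemma rank1_sum_vcons0 n (d : list (vec n)) i j : rank1_sum (map (vcons 0) d) i j =
  Fin.caseS' i (fun _ => R) 0 (fun i => Fin.caseS' j (fun _ => R) 0 (fun j => rank1_sum d i j)).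
Proof.
  revert i; apply fin_case; [|intros i]; (revert j; apply fin_case; [|intros j]); simpl;
    unfold rank1_sum; induction d as [|s d IH]; simpl; auto; rewrite IH; simpl; ring.
Qed.

(** Symmetric Gaussian elimination, by induction on the size: a zero pivot forces its row to vanish,
    and a positive pivot splits off one rank-one matrix and leaves the Schur complement, again
    positive semi-definite. No spectral theorem is involved. *)
Lemma psd_decomp n (P : mat n) :
  symm P -> (forall v, 0 <= quadform P v) ->
  exists dirs, forall i j, P i j = rank1_sum dirs i j.
Proof.
  induction n as [|n IH]; intros HS HP.
  - exists nil; intros i; inversion i.
  - set (c := P Fin.F1 Fin.F1). set (w := fun i => P Fin.F1 (Fin.FS i)).
    set (P' := fun i j => P (Fin.FS i) (Fin.FS j)).
    assert (HQ : forall x v, 0 <= c * x * x + 2 * x * dot w v + quadform P' v).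
    { intros x v; specialize (HP (vcons x v)); now rewrite quadform_S in HP. }
    assert (Hc : 0 <= c).
    { specialize (HQ 1 (fun _ => 0)).
      rewrite dot_0_r, quadform_0_r in HQ. lra. }
    destruct (Req_dec c 0) as [E|E].
    + assert (Hw : forall i, w i = 0).
      { intros i. destruct (Req_dec (w i) 0) as [|N]; auto. exfalso.
        (* With zero pivot the form is affine in the first coordinate; a nonzero entry [w i] would
           allow this choice, at which the form equals [-1]. *)
        pose proof (HQ (- (quadform P' (unitv i) + 1) / (2 * w i)) (unitv i)) as H.
        rewrite dot_sym, dot_unitv_l, E in H.
        replace (2 * (- (quadform P' (unitv i) + 1) / (2 * w i)) * w i)
          with (- (quadform P' (unitv i) + 1)) in H by (field; auto).
        lra. }
      destruct (IH P') as [d Hd]; [intros i j; apply HS | |].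
      { intros v; specialize (HQ 0 v); lra. }
      exists (map (vcons 0) d). intros i j.
      rewrite rank1_sum_vcons0. revert i; apply fin_case; [|intros i];
        (revert j; apply fin_case; [|intros j]); simpl; rewrite <- ?Hd; auto.
      * apply Hw.
      * rewrite HS; apply Hw.
    + destruct (IH (fun i j => P' i j + (- / c) * (w i * w j))) as [d Hd].
      { intros i j; unfold P'; rewrite (HS (Fin.FS i)); ring. }
      { intros v; rewrite quadform_plus, quadform_rank1.
        (* This first coordinate minimises the form for fixed [v], and the minimum is the Schur
           complement at [v]. *)
        specialize (HQ (- dot w v / c) v).
        replace (c * (- dot w v / c) * (- dot w v / c) + 2 * (- dot w v / c) * dot w v)
          with (- / c * (dot w v * dot w v)) in HQ by (field; auto).
        lra. }
      exists (vcons (sqrt c) (vscal (/ sqrt c) w) :: map (vcons 0) d). intros i j.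
      assert (Hs : sqrt c * sqrt c = c) by (apply sqrt_sqrt; auto).
      assert (sqrt c <> 0) by (intros Z; rewrite Z in Hs; lra).
      simpl.
      rewrite rank1_sum_vcons0. revert i; apply fin_case; [|intros i];
        (revert j; apply fin_case; [|intros j]); simpl; rewrite <- ?Hd; unfold vscal.
      * rewrite Hs; unfold c; ring.
      * unfold w; field; auto.
      * rewrite HS; unfold w; field; auto.
      * assert (/ c = / sqrt c * / sqrt c) as -> by (rewrite <- Rinv_mult, Hs; easy).
        unfold P'; ring.
Qed.

Lemma frob_rank1_sum n dirs (X : mat n) : frob (rank1_sum dirs) X = lap dirs X.
Proof.
  induction dirs as [|s d IH]; simpl.
  - apply fsum_zero; intros; apply fsum_zero; intros; unfold rank1_sum; simpl; ring.
  - rewrite <- IH, quadform_frob.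
    replace (rank1_sum (s :: d)) with (fun i j => s i * s j + 1 * rank1_sum d i j).
    + rewrite frob_plus_l; ring.
    + extensionality i; extensionality j; unfold rank1_sum; simpl; ring.
Qed.

Lemma frob_psd_nonneg n (P X : mat n) :
  symm P -> (forall v, 0 <= quadform P v) -> (forall v, 0 <= quadform X v) -> 0 <= frob P X.
Proof.
  intros HS HP HX; destruct (psd_decomp n P HS HP) as [d Hd].
  replace P with (rank1_sum d) by (extensionality i; extensionality j; now rewrite Hd).
  rewrite frob_rank1_sum; now apply lap_nonneg.
Qed.

Lemma quadform_small n (X : mat n) d v :
  (forall i j, Rabs (X i j) <= d) -> Rabs (quadform X v) <= INR n * d * dot v v.
Proof.
  intros H.
  assert (HB : forall Y : mat n, (forall i j, Rabs (Y i j) <= d) ->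
    quadform Y v <= INR n * d * dot v v).
  { intros Y HY.
    apply Rle_trans with (fsum n (fun i => fsum n (fun j => d / 2 * (v i * v i) + d / 2 * (v j * v j)))).
    - apply fsum_le; intros i; apply fsum_le; intros j.
      specialize (HY i j).
      assert (Y i j * v i * v j <= Rabs (Y i j) * Rabs (v i * v j)).
      { rewrite <- Rabs_mult. rewrite Rmult_assoc; apply Rle_abs. }
      assert (Rabs (Y i j) * Rabs (v i * v j) <= d * Rabs (v i * v j))
        by (apply Rmult_le_compat_r; [apply Rabs_pos | auto]).
      assert (0 <= d) by (pose proof (Rabs_pos (Y i j)); lra).
      assert (Rabs (v i * v j) <= (v i * v i + v j * v j) / 2).
      { pose proof (Rle_0_sqr (v i + v j)); pose proof (Rle_0_sqr (v i - v j)); unfold Rsqr in *.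
        apply Rabs_le; split; lra. }
      nra.
    - apply Req_le. rewrite (fsum_ext _ _ (fun i => INR n * (d / 2) * (v i * v i) + d / 2 * dot v v)).
      + rewrite fsum_plus, fsum_scal, fsum_const. unfold dot. field.
      + intros i; rewrite fsum_plus, fsum_const, fsum_scal. unfold dot; ring. }
  apply Rabs_le; split; [|now apply HB].
  assert (quadform (fun i j => 0 + (-1) * X i j) v <= INR n * d * dot v v) as K.
  { apply HB; intros i j. replace (0 + -1 * X i j) with (- X i j) by ring. now rewrite Rabs_Ropp. }
  rewrite (quadform_plus n (fun _ _ => 0) X), quadform_0 in K.
  lra.
Qed.

(** * Compactness *)

Lemma choice_fun (A B : Type) (P : A -> B -> Prop) :
  (forall x, exists y, P x y) -> exists f, forall x, P x (f x).
Proof.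
  intros H. exists (fun x => proj1_sig (constructive_indefinite_description _ (H x))).
  intros x. apply proj2_sig.
Qed.

Definition vcv {n} (xs : nat -> vec n) (x : vec n) : Prop :=
  forall eta, 0 < eta -> exists N, forall k, (N <= k)%nat -> vnorm (vsub (xs k) x) < eta.

Lemma inv_INR_small eta : 0 < eta -> exists N, forall k, (N <= k)%nat -> / (INR k + 1) < eta.
Proof.
  intros H; destruct (archimed_cor1 eta H) as [N [HN HN0]]; exists N; intros k Hk.
  apply Rle_lt_trans with (/ INR N); auto.
  apply le_INR in Hk. apply lt_0_INR in HN0.
  apply Rinv_le_contravar; lra.
Qed.

(** The index map need only satisfy [k <= phi k], not be increasing: that already transports limits
    ([Un_cv_sub], [vcv_sub]) and is stable under composition. *)
Lemma bolzano_weierstrass_R (un : nat -> R) M : (forall k, Rabs (un k) <= M) ->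
  exists phi, (forall k, (k <= phi k)%nat) /\ exists l, Un_cv (fun k => un (phi k)) l.
Proof.
  intros H.
  destruct (Bolzano_Weierstrass un (fun c => -M <= c <= M) (compact_P3 _ _)) as [l Hl].
  { intros k; specialize (H k); pose proof (Rle_abs (un k)); pose proof (Rle_abs (- un k)); rewrite Rabs_Ropp in *; lra. }
  assert (HE : forall k, exists p, (k <= p)%nat /\ Rabs (un p - l) < / (INR k + 1)).
  { intros k. assert (Hk : 0 < / (INR k + 1)) by (apply Rinv_0_lt_compat; pose proof (pos_INR k); lra).
    destruct (Hl (disc l (mkposreal _ Hk)) k) as [p [Hp Hd]].
    - exists (mkposreal _ Hk); intros z Hz; exact Hz.
    - exists p; split; auto. }
  destruct (choice_fun _ _ _ HE) as [phi HS]. exists phi.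
  split; [intros k; apply HS|].
  exists l; intros eta Heta. destruct (inv_INR_small eta Heta) as [N HN]; exists N; intros k Hk.
  unfold Rdist. eapply Rlt_trans; [apply HS | now apply HN].
Qed.

Lemma Un_cv_sub (un : nat -> R) l phi : (forall k, (k <= phi k)%nat) -> Un_cv un l -> Un_cv (fun k => un (phi k)) l.
Proof.
  intros Hp H eta He; destruct (H eta He) as [N HN]; exists N; intros k Hk; apply HN.
  specialize (Hp k); lia.
Qed.

Lemma vcv_sub n (xs : nat -> vec n) x phi : (forall k, (k <= phi k)%nat) -> vcv xs x -> vcv (fun k => xs (phi k)) x.
Proof.
  intros Hp H eta He; destruct (H eta He) as [N HN]; exists N; intros k Hk; apply HN.
  specialize (Hp k); lia.
Qed.

Lemma vnorm_S_le n (v : vec (S n)) : vnorm v <= Rabs (v Fin.F1) + vnorm (vtl v).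
Proof.
  pose proof (Rabs_pos (v Fin.F1)); pose proof (vnorm_ge0 _ (vtl v)).
  apply vnorm_le; [lra|]. rewrite dot_S, <- vnorm_sq.
  assert (v Fin.F1 * v Fin.F1 = Rabs (v Fin.F1) * Rabs (v Fin.F1)).
  { rewrite <- Rabs_mult. rewrite Rabs_right; nra. }
  nra.
Qed.

Lemma vnorm_vtl_le n (v : vec (S n)) : vnorm (vtl v) <= vnorm v.
Proof.
  apply vnorm_le; [apply vnorm_ge0|]. rewrite vnorm_sq, dot_S; nra.
Qed.

Lemma bolzano_weierstrass n (xs : nat -> vec n) M : (forall k, vnorm (xs k) <= M) ->
  exists phi, (forall k, (k <= phi k)%nat) /\ exists x, vcv (fun k => xs (phi k)) x.
Proof.
  induction n as [|n IH]; intros H.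
  - exists (fun k => k); split; [auto|]. exists (fun _ => 0); intros eta He; exists 0%nat; intros k _.
    unfold vnorm, dot; simpl; now rewrite sqrt_0.
  - destruct (bolzano_weierstrass_R (fun k => xs k Fin.F1) M) as [p1 [Hp1 [l Hl]]].
    { intros k; eapply Rle_trans; [apply vnorm_comp | apply H]. }
    destruct (IH (fun k => vtl (xs (p1 k)))) as [p2 [Hp2 [x Hx]]].
    { intros k; eapply Rle_trans; [apply vnorm_vtl_le | apply H]. }
    exists (fun k => p1 (p2 k)); split.
    { intros k; specialize (Hp2 k); specialize (Hp1 (p2 k)); lia. }
    exists (vcons l x); intros eta He.
    apply (Un_cv_sub _ _ p2 Hp2) in Hl.
    destruct (Hl (eta/2) ltac:(lra)) as [N1 HN1]; destruct (Hx (eta/2) ltac:(lra)) as [N2 HN2].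
    exists (N1 + N2)%nat; intros k Hk.
    eapply Rle_lt_trans; [apply vnorm_S_le|].
    assert (A1 := HN1 k ltac:(lia)); assert (A2 := HN2 k ltac:(lia)).
    unfold Rdist in A1.
    change (Rabs (xs (p1 (p2 k)) Fin.F1 - l) + vnorm (vsub (vtl (xs (p1 (p2 k)))) x) < eta).
    lra.
Qed.

Lemma vcv_norm_le n (xs : nat -> vec n) x M : vcv xs x -> (forall k, vnorm (xs k) <= M) -> vnorm x <= M.
Proof.
  intros H HM. apply le_epsilon; intros eta He.
  destruct (H eta He) as [N HN]. specialize (HN N (Nat.le_refl _)). specialize (HM N).
  pose proof (vnorm_le_sub _ x (xs N)). rewrite vnorm_sub_sym in HN; lra.
Qed.

Lemma Un_cv_bounds (ts : nat -> R) t lo hi : Un_cv ts t -> (forall k, lo <= ts k <= hi) -> lo <= t <= hi.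
Proof.
  intros H HM. split; apply le_epsilon; intros eta He;
  destruct (H eta He) as [N HN]; specialize (HN N (Nat.le_refl _)); specialize (HM N);
  apply Rabs_def2 in HN; lra.
Qed.

(** One compactness statement serves all maximum arguments: two points and a time, an arbitrary
    sequentially closed bounded domain, and only upper semicontinuity of [f] relative to that
    domain. *)
Lemma extreme_value n (D : vec n -> vec n -> R -> Prop) (f : vec n -> vec n -> R -> R) Rb :
  (exists x y t, D x y t) ->
  (forall x y t, D x y t -> vnorm x <= Rb /\ vnorm y <= Rb /\ Rabs t <= Rb) ->
  (forall xs ys ts x y t, vcv xs x -> vcv ys y -> Un_cv ts t ->
     (forall k, D (xs k) (ys k) (ts k)) -> D x y t) ->
  (forall x y t, D x y t -> forall eta, 0 < eta -> exists del, 0 < del /\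
     forall x' y' t', D x' y' t' -> vnorm (vsub x' x) < del -> vnorm (vsub y' y) < del ->
       Rabs (t' - t) < del -> f x' y' t' < f x y t + eta) ->
  exists x y t, D x y t /\ forall x' y' t', D x' y' t' -> f x' y' t' <= f x y t.
Proof.
  intros [x0 [y0 [t0 H0]]] Hb Hc Hf.
  set (E := fun v => exists x y t, D x y t /\ v = f x y t).
  (* Boundedness of [f] from above is not known yet. The alternative [INR k < f x y t] covers the
     unbounded case, so that a single maximising sequence handles both; the limit point then
     excludes unboundedness by itself. *)
  assert (HK : forall k : nat, exists p : vec n * vec n * R, let '(x, y, t) := p in
    D x y t /\ forall x' y' t', D x' y' t' -> f x' y' t' - / (INR k + 1) < f x y t \/ INR k < f x y t).
  { intros k. destruct (classic (bound E)) as [HB|HB].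
    - destruct (completeness E HB) as [L HL].
      { exists (f x0 y0 t0), x0, y0, t0; auto. }
      apply NNPP; intros HN.
      assert (L <= L - / (INR k + 1)).
      { apply HL. intros v [x [y [t [HD ->]]]]. apply Rnot_lt_le; intros Hlt.
        apply HN; exists (x, y, t); split; auto. intros x' y' t' HD'. left.
        assert (f x' y' t' <= L) by (apply HL; exists x', y', t'; auto). lra. }
      assert (0 < / (INR k + 1)) by (apply Rinv_0_lt_compat; pose proof (pos_INR k); lra). lra.
    - apply NNPP; intros HN. apply HB. exists (INR k).
      intros v [x [y [t [HD ->]]]]. apply Rnot_lt_le; intros Hlt. apply HN; exists (x, y, t); auto. }
  destruct (choice_fun _ _ _ HK) as [ps Hps].
  set (xs := fun k => fst (fst (ps k))). set (ys := fun k => snd (fst (ps k))). set (ts := fun k => snd (ps k)).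
  assert (HD' : forall k, D (xs k) (ys k) (ts k)).
  { intros k; specialize (Hps k). unfold xs, ys, ts. destruct (ps k) as [[x y] t]; apply Hps. }
  assert (Hm' : forall x y t, D x y t -> forall eta, 0 < eta -> exists N, forall k, (N <= k)%nat ->
      f x y t - eta < f (xs k) (ys k) (ts k)).
  { intros x y t H eta He. destruct (inv_INR_small eta He) as [N1 HN1]. destruct (INR_unbounded (f x y t)) as [N2 HN2].
    exists (N1 + N2)%nat; intros k Hk. specialize (Hps k). specialize (HN1 k ltac:(lia)).
    assert (INR N2 <= INR k) by (apply le_INR; lia).
    unfold xs, ys, ts. destruct (ps k) as [[x' y'] t']. destruct Hps as [_ Hps].
    destruct (Hps x y t H); simpl; lra. }
  clearbody xs ys ts. clear ps Hps.
  destruct (bolzano_weierstrass n xs Rb) as [p1 [Hp1 [x Hx]]]; [intros k; apply (Hb _ _ _ (HD' k))|].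
  destruct (bolzano_weierstrass n (fun k => ys (p1 k)) Rb) as [p2 [Hp2 [y Hy]]]; [intros k; apply (Hb _ _ _ (HD' _))|].
  destruct (bolzano_weierstrass_R (fun k => ts (p1 (p2 k))) Rb) as [p3 [Hp3 [t Ht]]]; [intros k; apply (Hb _ _ _ (HD' _))|].
  set (p := fun k => p1 (p2 (p3 k))).
  assert (Hp : forall k, (k <= p k)%nat).
  { intros k; unfold p; specialize (Hp3 k); specialize (Hp2 (p3 k)); specialize (Hp1 (p2 (p3 k))); lia. }
  assert (Hx' : vcv (fun k => xs (p k)) x).
  { apply (vcv_sub _ (fun k => xs (p1 k)) x (fun k => p2 (p3 k))); auto.
    intros k; specialize (Hp3 k); specialize (Hp2 (p3 k)); lia. }
  assert (Hy' : vcv (fun k => ys (p k)) y) by (apply (vcv_sub _ _ y p3 Hp3 Hy)).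
  assert (HDl : D x y t) by (apply (Hc _ _ _ _ _ _ Hx' Hy' Ht); intros k; apply HD').
  exists x, y, t; split; auto.
  intros x' y' t' H'. apply le_epsilon; intros eta He.
  destruct (Hm' x' y' t' H' (eta/2) ltac:(lra)) as [N HN].
  destruct (Hf x y t HDl (eta/2) ltac:(lra)) as [del [Hdel Hf']].
  destruct (Hx' del Hdel) as [N1 HN1]; destruct (Hy' del Hdel) as [N2 HN2]; destruct (Ht del Hdel) as [N3 HN3].
  set (k := (N + N1 + N2 + N3)%nat).
  assert (A := Hf' (xs (p k)) (ys (p k)) (ts (p k)) (HD' _) (HN1 k ltac:(unfold k; lia))
    (HN2 k ltac:(unfold k; lia)) (HN3 k ltac:(unfold k; lia))).
  assert (B := HN (p k) ltac:(specialize (Hp k); unfold k in *; lia)).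
  lra.
Qed.

(** The second point of [extreme_value] is pinned to the zero vector. *)
Lemma extreme_value_t n (f : vec n -> R -> R) c Rb lo hi : 0 <= Rb -> lo <= hi ->
  (forall x t, vnorm (vsub x c) <= Rb -> lo <= t <= hi -> forall eta, 0 < eta -> exists del, 0 < del /\
     forall x' t', lo <= t' <= hi -> vnorm (vsub x' x) < del -> Rabs (t' - t) < del -> f x' t' < f x t + eta) ->
  exists x t, vnorm (vsub x c) <= Rb /\ lo <= t <= hi /\
    forall x' t', vnorm (vsub x' c) <= Rb -> lo <= t' <= hi -> f x' t' <= f x t.
Proof.
  intros HR Hlh Hf.
  destruct (extreme_value n (fun x y t => vnorm (vsub x c) <= Rb /\ y = (fun _ => 0) /\ lo <= t <= hi)
    (fun x _ t => f x t) (Rb + vnorm c + Rabs lo + Rabs hi)) as [x [y [t [[H1 [H2 H3]] H4]]]].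
  - exists c, (fun _ => 0), lo. rewrite vsub_self, vnorm_0; auto with real.
  - intros x y t [H1 [-> H2]].
    pose proof (vnorm_ge0 _ c); pose proof (Rabs_pos lo); pose proof (Rabs_pos hi).
    pose proof (vnorm_le_sub _ x c). rewrite vnorm_0. repeat split; try lra.
    pose proof (Rle_abs (-lo)); pose proof (Rle_abs hi). rewrite Rabs_Ropp in *.
    apply Rabs_le; lra.
  - intros xs ys ts x y t Hx Hy Ht H; repeat split.
    + apply (vcv_norm_le n (fun k => vsub (xs k) c) (vsub x c)); [|intros k; apply H].
      intros eta He; destruct (Hx eta He) as [N HN]; exists N; intros k Hk.
      replace (vsub (vsub (xs k) c) (vsub x c)) with (vsub (xs k) x); auto.
      vec_ring.
    + extensionality i.
      assert (Hn : vnorm y <= 0).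
      { apply (vcv_norm_le n ys y 0 Hy); intros k. destruct (H k) as [_ [-> _]]; rewrite vnorm_0; lra. }
      pose proof (vnorm_comp _ y i). pose proof (Rabs_pos (y i)).
      destruct (Req_dec (y i) 0); auto. apply Rabs_pos_lt in H2; lra.
    + apply (Un_cv_bounds ts t lo hi Ht); intros k; apply H.
    + apply (Un_cv_bounds ts t lo hi Ht); intros k; apply H.
  - intros x y t [H1 [-> H2]] eta He. destruct (Hf x t H1 H2 eta He) as [del [Hd Hd']].
    exists del; split; auto. intros x' y' t' [_ [_ H']]; auto.
  - exists x, t; repeat split; try tauto; try lra. intros x' t' Hx' Ht'. apply (H4 x' (fun _ => 0) t'); auto.
Qed.

(** * Lattice periodicity *)

Definition fswap {n} (j i : Fin.t (S n)) : Fin.t (S n) :=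
  if Fin.eq_dec i j then Fin.F1 else if Fin.eq_dec i Fin.F1 then j else i.

Lemma fsum_fswap n (j : Fin.t (S n)) (f : Fin.t (S n) -> R) :
  fsum (S n) (fun i => f (fswap j i)) = fsum (S n) f.
Proof.
  rewrite (fsum_ext _ _ (fun i => f i + ((f j - f Fin.F1) * (unitv Fin.F1 i * 1) + (f Fin.F1 - f j) * (unitv j i * 1)))).
  - rewrite fsum_plus, fsum_plus, !fsum_scal, !(fsum_unitv (S n) _ (fun _ => 1)); ring.
  - intros i. unfold fswap, unitv.
    destruct (Fin.eq_dec i j), (Fin.eq_dec i Fin.F1), (Fin.eq_dec Fin.F1 i), (Fin.eq_dec j i);
      try congruence; subst; try ring.
Qed.

Lemma fswap_inv n (j i : Fin.t (S n)) : fswap j (fswap j i) = i.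
Proof.
  unfold fswap.
  destruct (Fin.eq_dec i j); [|destruct (Fin.eq_dec i Fin.F1)].
  - destruct (Fin.eq_dec Fin.F1 j); [congruence|].
    destruct (Fin.eq_dec Fin.F1 Fin.F1); congruence.
  - destruct (Fin.eq_dec j j); congruence.
  - destruct (Fin.eq_dec i j); [congruence|].
    destruct (Fin.eq_dec i Fin.F1); congruence.
Qed.

(** Elimination of the first coordinate: [HP] treats the case where the first vector has a nonzero
    first coordinate, and [fswap] moves such a vector to the front. If all first coordinates vanish,
    one vector and the coordinate are dropped. *)
Lemma lin_dep n (B : Fin.t (S n) -> vec n) :
  exists c, (exists i, c i <> 0) /\ forall k, fsum (S n) (fun i => c i * B i k) = 0.
Proof.
  induction n as [|n IH].
  - exists (fun _ => 1); split; [exists Fin.F1; lra | intros k; inversion k].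
  - assert (HP : forall B : Fin.t (S (S n)) -> vec (S n), B Fin.F1 Fin.F1 <> 0 ->
      exists c, (exists i, c i <> 0) /\ forall k, fsum (S (S n)) (fun i => c i * B i k) = 0).
    { clear B; intros B HB.
      set (r := fun i => B (Fin.FS i) Fin.F1 / B Fin.F1 Fin.F1).
      destruct (IH (fun i k => B (Fin.FS i) (Fin.FS k) - r i * B Fin.F1 (Fin.FS k))) as [c [[i Hi] Hc]].
      exists (vcons (- fsum (S n) (fun i => c i * r i)) c); split; [now exists (Fin.FS i)|].
      apply fin_case.
      - change (- fsum (S n) (fun i => c i * r i) * B Fin.F1 Fin.F1
          + fsum (S n) (fun i => c i * B (Fin.FS i) Fin.F1) = 0).
        rewrite (fsum_ext _ (fun i => c i * B (Fin.FS i) Fin.F1) (fun i => B Fin.F1 Fin.F1 * (c i * r i))).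
        + rewrite fsum_scal; ring.
        + intros; unfold r; field; auto.
      - intros k. specialize (Hc k).
        change (- fsum (S n) (fun i => c i * r i) * B Fin.F1 (Fin.FS k)
          + fsum (S n) (fun i => c i * B (Fin.FS i) (Fin.FS k)) = 0).
        rewrite <- Hc.
        rewrite (fsum_ext _ (fun i => c i * (B (Fin.FS i) (Fin.FS k) - r i * B Fin.F1 (Fin.FS k)))
          (fun i => c i * B (Fin.FS i) (Fin.FS k) + (- B Fin.F1 (Fin.FS k)) * (c i * r i))) by (intros; ring).
        rewrite fsum_plus, fsum_scal; ring. }
    destruct (classic (exists j, B j Fin.F1 <> 0)) as [[j Hj]|HN].
    + destruct (HP (fun i => B (fswap j i))) as [c [[i Hi] Hc]].
      { unfold fswap; destruct (Fin.eq_dec Fin.F1 j); [congruence|].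
        destruct (Fin.eq_dec Fin.F1 Fin.F1); congruence. }
      exists (fun i => c (fswap j i)); split.
      { exists (fswap j i); now rewrite fswap_inv. }
      intros k; rewrite <- (Hc k), <- (fsum_fswap _ j). apply fsum_ext; intros l; now rewrite fswap_inv.
    + destruct (IH (fun i k => B (Fin.FS i) (Fin.FS k))) as [c [[i Hi] Hc]].
      exists (vcons 0 c); split; [now exists (Fin.FS i)|].
      apply fin_case.
      * apply fsum_zero. intros l.
        destruct (Req_dec (B l Fin.F1) 0) as [->|]; [ring | exfalso; apply HN; eauto].
      * intros k; specialize (Hc k).
        change (0 * B Fin.F1 (Fin.FS k) + fsum (S n) (fun i => c i * B (Fin.FS i) (Fin.FS k)) = 0).
        rewrite Hc; ring.
Qed.

(** Prepending [x] to [B] gives [n + 1] dependent vectors, and independence of [B] makes the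
    coefficient of [x] nonzero. *)
Lemma lin_indep_span n (B : Fin.t n -> vec n) : lin_indep B ->
  forall x : vec n, exists c : vec n, forall k, x k = fsum n (fun i => c i * B i k).
Proof.
  intros HB x.
  destruct (lin_dep n (fun i => Fin.caseS' i (fun _ => vec n) x B)) as [c [[i Hi] Hc]].
  assert (Hc' : forall k, c Fin.F1 * x k + fsum n (fun i => c (Fin.FS i) * B i k) = 0) by exact Hc.
  destruct (Req_dec (c Fin.F1) 0) as [E|E].
  - exfalso; apply Hi. apply (fin_case _ (fun i => c i = 0) E).
    apply (HB (fun i => c (Fin.FS i))).
    intros k. specialize (Hc' k). rewrite E in Hc'; lra.
  - exists (fun i => - c (Fin.FS i) / c Fin.F1). intros k.
    rewrite (fsum_ext _ _ (fun i => (- / c Fin.F1) * (c (Fin.FS i) * B i k))) by (intros; field; auto).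
    rewrite fsum_scal. specialize (Hc' k).
    replace (fsum n (fun i => c (Fin.FS i) * B i k)) with (- (c Fin.F1 * x k)) by lra.
    field; auto.
Qed.

Lemma vnorm_comb_le n m (c : Fin.t m -> R) (B : Fin.t m -> vec n) :
  vnorm (fun k => fsum m (fun i => c i * B i k)) <= fsum m (fun i => Rabs (c i) * vnorm (B i)).
Proof.
  induction m; simpl.
  - rewrite vnorm_0; lra.
  - specialize (IHm (fun i => c (Fin.FS i)) (fun i => B (Fin.FS i))).
    pose proof (vnorm_triang _ (vscal (c Fin.F1) (B Fin.F1))
      (fun k => fsum m (fun i => c (Fin.FS i) * B (Fin.FS i) k))) as H.
    rewrite vnorm_scal in H. unfold vadd, vscal in H. lra.
Qed.

(** Subtracting the integer parts of the coordinates leaves a combination with coefficients in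
    [[0, 1)], hence of norm at most the sum of the norms of the generators. *)
Lemma lattice_reduce n (B : Fin.t n -> vec n) : lin_indep B ->
  exists R0, 0 <= R0 /\ forall x, exists k, vnorm (vadd x (lattice_vec B k)) <= R0.
Proof.
  intros HB. exists (fsum n (fun i => 1 * vnorm (B i))); split.
  { apply fsum_nonneg; intros; pose proof (vnorm_ge0 _ (B i)); lra. }
  intros x; destruct (lin_indep_span n B HB x) as [c Hc].
  exists (fun i => (- Int_part (c i))%Z).
  replace (vadd x (lattice_vec B (fun i => (- Int_part (c i))%Z)))
    with (fun k => fsum n (fun i => frac_part (c i) * B i k)).
  - eapply Rle_trans; [apply vnorm_comb_le|]. apply fsum_le; intros i.
    apply Rmult_le_compat_r; [apply vnorm_ge0|].
    destruct (base_fp (c i)). rewrite Rabs_right; lra.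
  - extensionality k. unfold vadd, lattice_vec. rewrite Hc, <- fsum_plus.
    apply fsum_ext; intros i. rewrite opp_IZR; unfold frac_part; ring.
Qed.

Definition periodic {n} (T : R) (u : vec n -> R -> R) : Prop :=
  exists B : Fin.t n -> vec n, lin_indep B /\
     forall k x t, 0 <= t <= T -> u (vadd x (lattice_vec B k)) t = u x t.

Definition unif_cont {n} (T : R) (u : vec n -> R -> R) : Prop :=
  forall eta, 0 < eta -> exists del, 0 < del /\ forall x t y s, 0 <= t <= T -> 0 <= s <= T ->
    vnorm (vsub y x) < del -> Rabs (s - t) < del -> Rabs (u y s - u x t) < eta.

Lemma cont_opp n T (f : vec n -> R -> R) : cont_strip T f ->
  cont_strip T (fun p t => - f p t).
Proof.
  intros Hf p t Ht eps He. destruct (Hf p t Ht eps He) as [d [Hd H]]. exists d; split; auto.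
  intros q s Hs Hq. replace (- f q s - - f p t) with (- (f q s - f p t)) by ring. rewrite Rabs_Ropp. auto.
Qed.

Lemma periodic_bounded_above n T (u : vec n -> R -> R) : 0 < T -> periodic T u ->
  cont_strip T u -> exists M, forall x t, 0 <= t <= T -> u x t <= M.
Proof.
  intros HT [B [HB Hper]] Hc. destruct (lattice_reduce n B HB) as [R0 [HR0 Hred]].
  destruct (extreme_value_t n u (fun _ => 0) R0 0 T) as [x1 [t1 [_ [_ H1]]]]; try lra.
  { intros x t _ Ht eta He. destruct (Hc x t Ht eta He) as [d [Hd H]]. exists (d / 2); split; [lra|].
    intros x' t' Ht' A1 A2. specialize (H x' t' Ht'). unfold dist_nt in H.
    specialize (H ltac:(lra)). apply Rabs_def2 in H; lra. }
  exists (u x1 t1). intros x t Ht. destruct (Hred x) as [k Hk].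
  rewrite <- (Hper k x t Ht). apply H1; auto.
  replace (vsub (vadd x (lattice_vec B k)) (fun _ => 0)) with (vadd x (lattice_vec B k)) by vec_ring. auto.
Qed.

Lemma periodic_bounded n T (u : vec n -> R -> R) : 0 < T -> periodic T u ->
  cont_strip T u ->
  exists M, 0 <= M /\ forall x t, 0 <= t <= T -> Rabs (u x t) <= M.
Proof.
  intros HT Hper Hc.
  destruct (periodic_bounded_above n T u HT Hper Hc) as [M1 H1].
  destruct (periodic_bounded_above n T (fun x t => - u x t) HT) as [M2 H2]; [|now apply cont_opp|].
  { destruct Hper as [B [HB Hper]]. exists B; split; auto. intros k x t Ht. now rewrite Hper. }
  exists (Rabs M1 + Rabs M2). pose proof (Rabs_pos M1); pose proof (Rabs_pos M2). split; [lra|].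
  intros x t Ht. specialize (H1 x t Ht). specialize (H2 x t Ht).
  pose proof (Rle_abs M1); pose proof (Rle_abs M2). apply Rabs_le; lra.
Qed.

(** The two points of a would-be counterexample are translated by the same lattice vector, chosen to
    bring [x] into a fixed ball; compactness then contradicts continuity at the limit. *)
Lemma periodic_unif_cont n T (u : vec n -> R -> R) : periodic T u ->
  cont_strip T u -> unif_cont T u.
Proof.
  intros [B [HB Hper]] Hc eta He. destruct (lattice_reduce n B HB) as [R0 [HR0 Hred]].
  apply NNPP; intros HN.
  assert (HK : forall k : nat, exists p : vec n * R * (vec n * R), let '((x, t), (y, s)) := p in
    vnorm x <= R0 /\ 0 <= t <= T /\ 0 <= s <= T /\ vnorm (vsub y x) < / (INR k + 1) /\ Rabs (s - t) < / (INR k + 1)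
    /\ eta <= Rabs (u y s - u x t)).
  { intros k. apply NNPP; intros HNk. apply HN. exists (/ (INR k + 1)).
    split; [apply Rinv_0_lt_compat; pose proof (pos_INR k); lra|].
    intros x t y s Ht Hs H1 H2. apply Rnot_le_lt; intros H3. apply HNk.
    destruct (Hred x) as [m Hm].
    exists ((vadd x (lattice_vec B m), t), (vadd y (lattice_vec B m), s)).
    rewrite !Hper by auto. repeat split; try tauto.
    replace (vsub (vadd y (lattice_vec B m)) (vadd x (lattice_vec B m))) with (vsub y x); auto.
    vec_ring. }
  destruct (choice_fun _ _ _ HK) as [ps Hps].
  destruct (bolzano_weierstrass n (fun k => fst (fst (ps k))) R0) as [p1 [Hp1 [x Hx]]].
  { intros k; specialize (Hps k); destruct (ps k) as [[? ?] [? ?]]; apply Hps. }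
  destruct (bolzano_weierstrass_R (fun k => snd (fst (ps (p1 k)))) T) as [p2 [Hp2 [t Ht]]].
  { intros k; specialize (Hps (p1 k)); destruct (ps (p1 k)) as [[? ?] [? ?]]. simpl.
    rewrite Rabs_right; try apply Rle_ge; apply Hps. }
  apply (vcv_sub _ _ _ p2 Hp2) in Hx.
  assert (HtT : 0 <= t <= T).
  { apply (Un_cv_bounds _ _ 0 T Ht). intros k; specialize (Hps (p1 (p2 k))).
    destruct (ps (p1 (p2 k))) as [[? ?] [? ?]]; apply Hps. }
  destruct (Hc x t HtT (eta/2) ltac:(lra)) as [d [Hd Hcd]].
  destruct (Hx (d/4) ltac:(lra)) as [N1 HN1]; destruct (Ht (d/4) ltac:(lra)) as [N2 HN2].
  destruct (inv_INR_small (d/4) ltac:(lra)) as [N3 HN3].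
  set (k := (N1 + N2 + N3)%nat).
  specialize (HN1 k ltac:(unfold k; lia)). specialize (HN2 k ltac:(unfold k; lia)).
  specialize (HN3 (p1 (p2 k)) ltac:(specialize (Hp2 k); specialize (Hp1 (p2 k)); unfold k in *; lia)).
  specialize (Hps (p1 (p2 k))). simpl in HN1, HN2. unfold Rdist in HN2.
  destruct (ps (p1 (p2 k))) as [[x' t'] [y' s']]. simpl in *.
  destruct Hps as [_ [Ht' [Hs' [H1 [H2 H3]]]]].
  assert (Rabs (u x' t' - u x t) < eta / 2) by (apply Hcd; auto; unfold dist_nt; lra).
  assert (Rabs (u y' s' - u x t) < eta / 2).
  { apply Hcd; auto; unfold dist_nt.
    pose proof (vnorm_sub_triang _ y' x' x).
    pose proof (Rabs_triang (s' - t') (t' - t)). replace (s' - t' + (t' - t)) with (s' - t) in * by ring. lra. }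
  pose proof (Rabs_triang (u y' s' - u x t) (u x t - u x' t')) as Q.
  replace (u y' s' - u x t + (u x t - u x' t')) with (u y' s' - u x' t') in Q by ring.
  rewrite (Rabs_minus_sym (u x t)) in Q. lra.
Qed.

(** * Second-order expansions and caloric functions *)

(** Peano expansions stand in for derivative functions: [T2] is second order with remainder
    [o(s^2)], as needed in space, and [O2] is first order with remainder [O(s^2)], as needed in
    time. *)
Definition T2 (f : R -> R) (b a m : R) : Prop :=
  forall del, 0 < del -> exists r, 0 < r /\ forall s, Rabs s < r ->
    Rabs (f (b + s) - f b - a * s - m / 2 * (s * s)) <= del * (s * s).

Definition O2 (f : R -> R) (b a : R) : Prop :=
  exists C r, 0 < r /\ 0 <= C /\ forall s, Rabs s < r -> Rabs (f (b + s) - f b - a * s) <= C * (s * s).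

Lemma mvt_bound f f' b s K :
  (forall z, Rabs (z - b) <= Rabs s -> derivable_pt_lim f z (f' z)) ->
  (forall z, Rabs (z - b) <= Rabs s -> Rabs (f' z) <= K) ->
  Rabs (f (b + s) - f b) <= K * Rabs s.
Proof.
  intros Hd HK.
  assert (Hz : forall z, Rmin b (b + s) <= z <= Rmax b (b + s) -> Rabs (z - b) <= Rabs s).
  { intros z. unfold Rmin, Rmax. destruct (Rle_dec b (b + s)); intros Hz.
    - rewrite !Rabs_right; lra.
    - rewrite !Rabs_left1; lra. }
  destruct (MVT_abs f f' b (b + s)) as [c [-> Hc]].
  { intros c Hc; apply Hd; auto. }
  replace (b + s - b) with s by ring. apply Rmult_le_compat_r; [apply Rabs_pos | auto].
Qed.

Lemma mvt_quad_bound f f' b m s K :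
  (forall z, Rabs (z - b) <= Rabs s -> derivable_pt_lim f z (f' z)) ->
  (forall z, Rabs (z - b) <= Rabs s -> Rabs (f' z - f' b - m * (z - b)) <= K) ->
  Rabs (f (b + s) - f b - f' b * s - m / 2 * (s * s)) <= K * Rabs s.
Proof.
  intros Hd HK.
  pose proof (mvt_bound (fun z => f z - f' b * (z - b) - m / 2 * ((z - b) * (z - b)))
    (fun z => f' z - f' b - m * (z - b)) b s K) as M.
  replace (f (b + s) - f b - f' b * s - m / 2 * (s * s)) with
   (f (b + s) - f' b * (b + s - b) - m / 2 * ((b + s - b) * (b + s - b)) - (f b - f' b * (b - b) - m / 2 * ((b - b) * (b - b)))) by ring.
  apply M; auto. intros z Hz.
  replace (f' z - f' b - m * (z - b)) with (f' z - f' b * (1 - 0) - (m / 2 * ((1 - 0) * (z - b) + (z - b) * (1 - 0)))) by field.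
  assert (Hid : derivable_pt_lim (fun z => z - b) z (1 - 0)).
  { apply (derivable_pt_lim_minus (fun z => z) (fun _ => b)); [apply derivable_pt_lim_id | apply derivable_pt_lim_const]. }
  apply (derivable_pt_lim_minus (fun z => f z - f' b * (z - b)) (fun z => m / 2 * ((z - b) * (z - b)))).
  - apply (derivable_pt_lim_minus f (fun z => f' b * (z - b))); auto.
    apply (derivable_pt_lim_scal (fun z => z - b)); auto.
  - apply (derivable_pt_lim_scal (fun z => (z - b) * (z - b))).
    apply (derivable_pt_lim_mult (fun z => z - b) (fun z => z - b)); auto.
Qed.

Lemma T2_of_deriv f f' b m r0 : 0 < r0 ->
  (forall z, Rabs (z - b) < r0 -> derivable_pt_lim f z (f' z)) ->
  derivable_pt_lim f' b m -> T2 f b (f' b) m.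
Proof.
  intros Hr0 H1 H2 del Hdel. destruct (H2 del Hdel) as [d Hd].
  exists (Rmin r0 d); split; [apply Rmin_pos; auto; apply cond_pos|].
  intros s Hs. assert (Rabs s < r0) by (eapply Rlt_le_trans; [exact Hs | apply Rmin_l]).
  assert (Rabs s < d) by (eapply Rlt_le_trans; [exact Hs | apply Rmin_r]).
  replace (del * (s * s)) with (del * Rabs s * Rabs s).
  2: { rewrite Rmult_assoc, <- Rabs_mult, (Rabs_right (s * s)); nra. }
  apply mvt_quad_bound.
  - intros z Hz. apply H1; lra.
  - intros z Hz. destruct (Req_dec z b) as [->|Hn].
    + replace (f' b - f' b - m * (b - b)) with 0 by ring. rewrite Rabs_R0.
      pose proof (Rabs_pos s); nra.
    + specialize (Hd (z - b) ltac:(lra) ltac:(lra)).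
      replace (b + (z - b)) with z in Hd by ring.
      replace (f' z - f' b - m * (z - b)) with (((f' z - f' b) / (z - b) - m) * (z - b)) by (field; lra).
      rewrite Rabs_mult. apply Rmult_le_compat; auto using Rabs_pos; lra.
Qed.

Lemma T2_O2 f b a m : T2 f b a m -> O2 f b a.
Proof.
  intros H. destruct (H 1 ltac:(lra)) as [r [Hr H1]]. exists (1 + Rabs (m / 2)), r.
  split; [auto|]; split; [pose proof (Rabs_pos (m / 2)); lra|]. intros s Hs. specialize (H1 s Hs).
  replace (f (b + s) - f b - a * s) with ((f (b + s) - f b - a * s - m / 2 * (s * s)) + m / 2 * (s * s)) by ring.
  eapply Rle_trans; [apply Rabs_triang|]. rewrite (Rabs_mult (m / 2)), (Rabs_right (s * s)) by nra. lra.
Qed.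

Lemma T2_cont f b a m : T2 f b a m -> forall eta, 0 < eta ->
  exists d, 0 < d /\ forall s, Rabs s < d -> Rabs (f (b + s) - f b) < eta.
Proof.
  intros H eta He. destruct (T2_O2 _ _ _ _ H) as [C [r [Hr [HC K]]]]. pose proof (Rabs_pos a).
  assert (He' : 0 < eta / (Rabs a + C + 1)) by (apply Rdiv_lt_0_compat; lra).
  assert (E : eta / (Rabs a + C + 1) * (Rabs a + C + 1) = eta) by (field; lra).
  set (e := eta / (Rabs a + C + 1)) in *.
  exists (Rmin r (Rmin 1 e)). split; [repeat apply Rmin_pos; lra|].
  intros s Hs. Rmin_bounds. specialize (K s ltac:(lra)). pose proof (Rabs_pos s).
  replace (f (b + s) - f b) with ((f (b + s) - f b - a * s) + a * s) by ring.
  eapply Rle_lt_trans; [apply Rabs_triang|]. rewrite (Rabs_mult a).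
  assert (s * s = Rabs s * Rabs s) as Es by apply Rsqr_abs. rewrite Es in K.
  assert (C * (Rabs s * Rabs s) <= C * Rabs s) by (apply Rmult_le_compat_l; nra).
  assert ((Rabs a + C + 1) * Rabs s < (Rabs a + C + 1) * e) by (apply Rmult_lt_compat_l; lra). lra.
Qed.

Lemma O2_const c b : O2 (fun _ => c) b 0.
Proof.
  exists 0, 1. repeat split; try lra. intros s _.
  replace (c - c - 0 * s) with 0 by ring. rewrite Rabs_R0; lra.
Qed.

Lemma T2_const c b : T2 (fun _ => c) b 0 0.
Proof.
  intros d Hd; exists 1; split; [lra|]. intros s _.
  replace (c - c - 0 * s - 0 / 2 * (s * s)) with 0 by field. rewrite Rabs_R0; nra.
Qed.

Lemma O2_id c b : O2 (fun s => c * s) b c.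
Proof.
  exists 0, 1. repeat split; try lra. intros s _.
  replace (c * (b + s) - c * b - c * s) with 0 by ring. rewrite Rabs_R0; lra.
Qed.

Lemma O2_sq c b : O2 (fun s => c * (s * s)) b (2 * c * b).
Proof.
  exists (Rabs c), 1. repeat split; try lra; [apply Rabs_pos|]. intros s _.
  replace (c * ((b + s) * (b + s)) - c * (b * b) - 2 * c * b * s) with (c * (s * s)) by ring.
  rewrite Rabs_mult, (Rabs_right (s * s)); nra.
Qed.

Lemma O2_exp q b : O2 (fun s => exp (- q * s)) b (- q * exp (- q * b)).
Proof.
  apply (T2_O2 _ _ _ (- q * (- q * exp (- q * b)))).
  assert (HL : forall z, derivable_pt_lim (fun s => exp (- q * s)) z (- q * exp (- q * z))).
  { intros z. replace (- q * exp (- q * z)) with (exp (- q * z) * (- q * 1)) by ring.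
    apply (derivable_pt_lim_comp (fun s => - q * s) exp).
    - apply (derivable_pt_lim_scal (fun s => s)), derivable_pt_lim_id.
    - apply derivable_pt_lim_exp. }
  apply (T2_of_deriv (fun s => exp (- q * s)) (fun s => - q * exp (- q * s)) b _ 1); auto; [lra|].
  apply (derivable_pt_lim_scal (fun s => exp (- q * s))), HL.
Qed.

Lemma T2_cos b : T2 cos b (- sin b) (- cos b).
Proof.
  apply (T2_of_deriv cos (fun z => - sin z) b _ 1); [lra | intros; apply derivable_pt_lim_cos|].
  apply (derivable_pt_lim_opp sin), derivable_pt_lim_sin.
Qed.

Lemma T2_sq b : T2 (fun s => s * s) b (2 * b) 2.
Proof.
  intros d Hd; exists 1; split; [lra|]. intros s _.
  replace ((b + s) * (b + s) - b * b - 2 * b * s - 2 / 2 * (s * s)) with 0 by field.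
  rewrite Rabs_R0; nra.
Qed.

Lemma T2_pow4 b : T2 (fun s => s ^ 4) b (4 * b ^ 3) (12 * b ^ 2).
Proof.
  intros d Hd. pose proof (Rabs_pos b) as Hb.
  assert (Hr : 0 < d / (4 * Rabs b + 1 + d)) by (apply Rdiv_lt_0_compat; lra).
  set (r := d / (4 * Rabs b + 1 + d)) in *.
  assert (Hrr : r * (4 * Rabs b + 1 + d) = d) by (unfold r; field; lra).
  exists r; split; auto. intros s Hs.
  replace ((b + s) ^ 4 - b ^ 4 - 4 * b ^ 3 * s - 12 * b ^ 2 / 2 * (s * s)) with ((4 * b * s + s * s) * (s * s)) by field.
  rewrite Rabs_mult, (Rabs_right (s * s)) by nra. apply Rmult_le_compat_r; [nra|].
  eapply Rle_trans; [apply Rabs_triang|]. rewrite !Rabs_mult, (Rabs_right 4) by lra.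
  pose proof (Rabs_pos s).
  assert (r <= 1) by nra.
  assert (Rabs b * Rabs s <= Rabs b * r) by nra.
  assert (Rabs s * Rabs s <= r) by nra. nra.
Qed.

(** Parabolic expansion with gradient [g], Hessian [X] and time derivative [d]. The time remainder
    is [C * k^2] rather than [o(k)], because a quadratic polynomial in space and time can then serve
    as a smooth test function; mixed terms in [h] and [k] are split between the two remainders by
    Young's inequality. *)
Definition Jet {n} (f : vec n -> R -> R) (y : vec n) (tau : R) (g : vec n)
    (X : mat n) (d : R) : Prop :=
  forall del, 0 < del -> exists C r, 0 < r /\ 0 <= C /\ forall h k, vnorm h < r -> Rabs k < r ->
    Rabs (f (vadd y h) (tau + k) - f y tau - dot g h - quadform X h / 2 - d * k) <= del * dot h h + C * (k * k).

Lemma Jet_add n (f1 f2 : vec n -> R -> R) y tau g1 g2 X1 X2 d1 d2 c :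
  Jet f1 y tau g1 X1 d1 -> Jet f2 y tau g2 X2 d2 ->
  Jet (fun y t => f1 y t + c * f2 y t) y tau (vadd g1 (vscal c g2)) (fun i j => X1 i j + c * X2 i j) (d1 + c * d2).
Proof.
  intros H1 H2 del Hdel. pose proof (Rabs_pos c) as Hc.
  destruct (H1 (del / 2) ltac:(lra)) as [C1 [r1 [Hr1 [HC1 K1]]]].
  destruct (H2 (del / (2 * (Rabs c + 1))) ltac:(apply Rdiv_lt_0_compat; lra)) as [C2 [r2 [Hr2 [HC2 K2]]]].
  exists (C1 + Rabs c * C2), (Rmin r1 r2). split; [now apply Rmin_pos|]. split; [nra|].
  intros h k Hh Hk.
  specialize (K1 h k ltac:(eapply Rlt_le_trans; [exact Hh | apply Rmin_l]) ltac:(eapply Rlt_le_trans; [exact Hk | apply Rmin_l])).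
  specialize (K2 h k ltac:(eapply Rlt_le_trans; [exact Hh | apply Rmin_r]) ltac:(eapply Rlt_le_trans; [exact Hk | apply Rmin_r])).
  rewrite dot_add_l, dot_scal_l, quadform_plus.
  set (e1 := f1 (vadd y h) (tau + k) - f1 y tau - dot g1 h - quadform X1 h / 2 - d1 * k) in *.
  set (e2 := f2 (vadd y h) (tau + k) - f2 y tau - dot g2 h - quadform X2 h / 2 - d2 * k) in *.
  match goal with |- Rabs ?a <= _ => replace a with (e1 + c * e2) by (unfold e1, e2; field) end.
  eapply Rle_trans; [apply Rabs_triang|]. rewrite Rabs_mult.
  pose proof (dot_ge0 _ h) as Hd.
  assert (Rabs c * Rabs e2 <= Rabs c * (del / (2 * (Rabs c + 1)) * dot h h + C2 * (k * k))) by (apply Rmult_le_compat_l; auto).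
  assert (Rabs c * (del / (2 * (Rabs c + 1))) <= del / 2).
  { replace (Rabs c * (del / (2 * (Rabs c + 1)))) with (del / 2 * (1 - / (Rabs c + 1))) by (field; lra).
    assert (0 < / (Rabs c + 1)) by (apply Rinv_0_lt_compat; lra). nra. }
  nra.
Qed.

Lemma lap_0 n (dirs : list (vec n)) : lap dirs (fun _ _ => 0) = 0.
Proof. induction dirs; simpl; [easy|]. rewrite IHdirs, quadform_0; ring. Qed.

Definition rk1 {n} (m : R) (l : vec n) (i j : Fin.t n) : R := 0 + m * (l i * l j).

Lemma quadform_rk1 n m (l v : vec n) : quadform (rk1 m l) v = m * (dot l v * dot l v).
Proof. unfold rk1. rewrite quadform_plus, quadform_0, quadform_rank1; ring. Qed.

(** Products of a function of time with a ridge function of space suffice: waves and heat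
    polynomials are sums of such products. *)
Lemma Jet_sep n f1 f2 (l y : vec n) th tau a1 a2 m2 :
  O2 f1 tau a1 -> T2 f2 (dot l y + th) a2 m2 ->
  Jet (fun y t => f1 t * f2 (dot l y + th)) y tau (vscal (f1 tau * a2) l)
    (rk1 (f1 tau * m2) l) (a1 * f2 (dot l y + th)).
Proof.
  intros [C1 [r1 [Hr1 [HC1 K1]]]] H2 del Hdel.
  set (A := f1 tau). set (b := dot l y + th) in *. set (B := f2 b) in *.
  set (L := dot l l + 1). assert (HL : 1 <= L) by (unfold L; pose proof (dot_ge0 _ l); lra).
  pose proof (Rabs_pos A) as HA; pose proof (Rabs_pos a2) as Ha2; pose proof (Rabs_pos m2) as Hm2;
  pose proof (Rabs_pos a1) as Ha1; pose proof (Rabs_pos B) as HB.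
  set (d' := Rmin (1/2) (del / (2 * (Rabs A + 1) * L))).
  assert (Hd' : 0 < d') by (apply Rmin_pos; [lra | apply Rdiv_lt_0_compat; nra]).
  assert (Hd1 : d' <= 1/2) by apply Rmin_l.
  assert (Hd2 : Rabs A * d' * L <= del / 2).
  { assert (d' <= del / (2 * (Rabs A + 1) * L)) by apply Rmin_r.
    assert (E : del / (2 * (Rabs A + 1) * L) * ((Rabs A + 1) * L) = del / 2) by (field; lra).
    assert (d' * ((Rabs A + 1) * L) <= del / 2) by (rewrite <- E; apply Rmult_le_compat_r; nra).
    nra. }
  destruct (H2 d' Hd') as [r2 [Hr2 K2]].
  set (c := Rabs a2 + Rabs m2 + 1). assert (Hc : 1 <= c) by (unfold c; lra).
  set (e := del / (2 * L)). assert (He : 0 < e) by (apply Rdiv_lt_0_compat; lra).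
  assert (HeL : e * L = del / 2) by (unfold e; field; lra).
  set (r := Rmin r1 (Rmin 1 r2 / L)).
  assert (Hm : 0 < Rmin 1 r2) by (apply Rmin_pos; lra).
  exists (C1 * (Rabs B + c) + (Rabs a1 * c) * (Rabs a1 * c) / (4 * e)), r.
  split; [apply Rmin_pos; [auto | apply Rdiv_lt_0_compat; lra]|].
  split.
  { assert (0 <= (Rabs a1 * c) * (Rabs a1 * c) / (4 * e)) by (apply Rle_mult_inv_pos; nra). nra. }
  intros h k Hh Hk.
  assert (Hk1 : Rabs k < r1) by (eapply Rlt_le_trans; [apply Hk | apply Rmin_l]).
  assert (Hh1 : vnorm h < Rmin 1 r2 / L) by (eapply Rlt_le_trans; [apply Hh | apply Rmin_r]).
  set (s := dot l h).
  assert (Hs2 : s * s <= L * dot h h).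
  { unfold s, L. pose proof (cauchy_sq _ l h). pose proof (dot_ge0 _ h). nra. }
  assert (Hs : Rabs s < Rmin 1 r2).
  { unfold s. eapply Rle_lt_trans; [apply cauchy|].
    assert (vnorm l <= L) by (apply vnorm_le; unfold L; pose proof (dot_ge0 _ l); nra).
    assert (E : Rmin 1 r2 = Rmin 1 r2 / L * L) by (field; lra).
    rewrite E. pose proof (vnorm_ge0 _ h); pose proof (vnorm_ge0 _ l). nra. }
  assert (Hs1 : Rabs s < 1) by (eapply Rlt_le_trans; [apply Hs | apply Rmin_l]).
  specialize (K2 s ltac:(eapply Rlt_le_trans; [apply Hs | apply Rmin_r])).
  specialize (K1 k Hk1).
  set (R1 := f1 (tau + k) - f1 tau - a1 * k) in *.
  set (R2 := f2 (b + s) - f2 b - a2 * s - m2 / 2 * (s * s)) in *.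
  assert (Hf2 : Rabs (f2 (b + s) - B) <= c * Rabs s).
  { replace (f2 (b + s) - B) with (a2 * s + m2 / 2 * (s * s) + R2) by (unfold R2, B; ring).
    eapply Rle_trans; [apply Rabs_triang|]. eapply Rle_trans; [apply Rplus_le_compat_r, Rabs_triang|].
    rewrite !Rabs_mult. unfold Rdiv; rewrite Rabs_mult, (Rabs_right (/ 2)) by lra.
    assert (s * s = Rabs s * Rabs s) by apply Rsqr_abs.
    pose proof (Rabs_pos s). rewrite H in K2. unfold c.
    assert (Rabs s * Rabs s <= Rabs s) by nra.
    assert (Rabs R2 <= Rabs s) by nra. 
    assert (Rabs m2 * / 2 * (Rabs s * Rabs s) <= Rabs m2 * Rabs s) by nra. lra. }
  assert (Hf2' : Rabs (f2 (b + s)) <= Rabs B + c).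
  { replace (f2 (b + s)) with (B + (f2 (b + s) - B)) by ring.
    eapply Rle_trans; [apply Rabs_triang|]. pose proof (Rabs_pos s). nra. }
  replace (dot l (vadd y h) + th) with (b + s) by (unfold b, s; rewrite dot_add_r; ring).
  rewrite dot_scal_l, quadform_rk1. fold s. fold A in R1. fold A.
  replace (f1 (tau + k)) with (A + a1 * k + R1) by (unfold R1; ring).
  match goal with |- Rabs ?x <= _ => replace x with (A * R2 + a1 * k * (f2 (b + s) - B) + R1 * f2 (b + s)) by (unfold R2, B; field) end.
  eapply Rle_trans; [apply Rabs_triang|]. eapply Rle_trans; [apply Rplus_le_compat_r, Rabs_triang|].
  rewrite !Rabs_mult.
  assert (Q1 : Rabs A * Rabs R2 <= del / 2 * dot h h).
  { assert (Rabs A * Rabs R2 <= Rabs A * (d' * (L * dot h h))) by (apply Rmult_le_compat_l; nra).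
    pose proof (dot_ge0 _ h). nra. }
  assert (Q3 : Rabs R1 * Rabs (f2 (b + s)) <= C1 * (Rabs B + c) * (k * k)).
  { replace (C1 * (Rabs B + c) * (k * k)) with (C1 * (k * k) * (Rabs B + c)) by ring.
    apply Rmult_le_compat; auto using Rabs_pos. }
  (* The mixed term in [k] and [s]. Young's inequality with weight [e], where [e * L = del / 2],
     gives it the second half of the allowance [del]; [Q1] took the first half. *)
  assert (Q2 : Rabs a1 * Rabs k * Rabs (f2 (b + s) - B) <= del / 2 * dot h h + (Rabs a1 * c) * (Rabs a1 * c) / (4 * e) * (k * k)).
  { assert (Rabs a1 * Rabs k * Rabs (f2 (b + s) - B) <= Rabs a1 * Rabs k * (c * Rabs s))
      by (apply Rmult_le_compat_l; auto; pose proof (Rabs_pos k); nra).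
    set (w := Rabs a1 * c) in *.
    assert (w * Rabs k * Rabs s <= e * (s * s) + w * w / (4 * e) * (k * k)).
    { assert (s * s = Rabs s * Rabs s) as -> by apply Rsqr_abs.
      assert (k * k = Rabs k * Rabs k) as -> by apply Rsqr_abs.
      assert (0 <= e * ((Rabs s - w * Rabs k / (2 * e)) * (Rabs s - w * Rabs k / (2 * e)))).
      { apply Rmult_le_pos; [lra | apply Rle_0_sqr]. }
      replace (e * ((Rabs s - w * Rabs k / (2 * e)) * (Rabs s - w * Rabs k / (2 * e))))
        with (e * (Rabs s * Rabs s) + w * w / (4 * e) * (Rabs k * Rabs k) - w * Rabs k * Rabs s) in H0 by (field; lra).
      lra. }
    assert (e * (s * s) <= del / 2 * dot h h) by (rewrite <- HeL; pose proof (dot_ge0 _ h); nra).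
    replace (Rabs a1 * Rabs k * (c * Rabs s)) with (w * Rabs k * Rabs s) in H by (unfold w; ring). lra. }
  lra.
Qed.

Lemma Jet_ext n (f1 f2 : vec n -> R -> R) y tau g X d :
  (forall y t, f1 y t = f2 y t) -> Jet f1 y tau g X d -> Jet f2 y tau g X d.
Proof.
  intros H J. replace f2 with f1; auto. extensionality z; extensionality t; apply H.
Qed.

Lemma Jet_time n f1 (y : vec n) tau a1 : O2 f1 tau a1 ->
  Jet (fun _ t => f1 t) y tau (fun _ => 0) (fun _ _ => 0) a1.
Proof.
  intros H. pose proof (Jet_sep n f1 (fun _ => 1) (fun _ => 0) y 0 tau a1 0 0 H (T2_const _ _)) as J.
  assert (vscal (f1 tau * 0) (fun _ : Fin.t n => 0) = fun _ => 0) as E1 by vec_ring.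
  assert (rk1 (f1 tau * 0) (fun _ : Fin.t n => 0) = fun _ _ => 0) as E2
    by (extensionality i; extensionality j; unfold rk1; ring).
  cbv beta in J. rewrite E1, E2, Rmult_1_r in J.
  eapply Jet_ext; [|apply J]. intros; simpl; ring.
Qed.

Lemma quadform_bound n (X : mat n) :
  exists Q, 0 <= Q /\ forall v, Rabs (quadform X v) <= Q * dot v v.
Proof.
  set (c := fsum n (fun i => fsum n (fun j => Rabs (X i j)))).
  exists (INR n * c). split.
  - apply Rmult_le_pos; [apply pos_INR|]. apply fsum_nonneg; intros; apply fsum_nonneg; intros; apply Rabs_pos.
  - intros v. apply quadform_small.
    intros i j. eapply Rle_trans; [apply (fsum_ge_term n (fun j => Rabs (X i j))); intros; apply Rabs_pos|].
    apply (fsum_ge_term n (fun i => fsum n (fun j => Rabs (X i j)))); intros; apply fsum_nonneg; intros; apply Rabs_pos.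
Qed.

Lemma Jet_cont n (f : vec n -> R -> R) y tau g X d : Jet f y tau g X d ->
  forall eta, 0 < eta -> exists del, 0 < del /\ forall y' t', vnorm (vsub y' y) < del -> Rabs (t' - tau) < del ->
    Rabs (f y' t' - f y tau) < eta.
Proof.
  intros J eta He. destruct (J 1 ltac:(lra)) as [C [r [Hr [HC K]]]].
  destruct (quadform_bound n X) as [Q [HQ HQ']].
  pose proof (vnorm_ge0 _ g) as Hg. pose proof (Rabs_pos d) as Hd.
  set (Z := vnorm g + Q + Rabs d + C + 2).
  assert (HZ : 0 < Z) by (unfold Z; lra).
  set (m := Rmin 1 (Rmin r (eta / Z))).
  assert (Hm1 : m <= 1) by apply Rmin_l.
  assert (Hm2 : m <= r) by (eapply Rle_trans; [apply Rmin_r | apply Rmin_l]).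
  assert (Hm3 : m <= eta / Z) by (eapply Rle_trans; [apply Rmin_r | apply Rmin_r]).
  assert (Hm0 : 0 < m) by (repeat apply Rmin_pos; try lra; apply Rdiv_lt_0_compat; lra).
  exists m; split; auto. intros y' t' Hy Ht.
  specialize (K (vsub y' y) (t' - tau) ltac:(lra) ltac:(lra)).
  rewrite vadd_vsub in K. replace (tau + (t' - tau)) with t' in K by ring.
  set (h := vsub y' y) in *. set (k := t' - tau) in *.
  specialize (HQ' h). pose proof (cauchy _ g h) as HC1. rewrite <- vnorm_sq in *.
  pose proof (vnorm_ge0 _ h). pose proof (Rabs_pos k).
  assert (k * k = Rabs k * Rabs k) as Ek by apply Rsqr_abs.
  rewrite Ek in K.
  replace (f y' t' - f y tau) with ((f y' t' - f y tau - dot g h - quadform X h / 2 - d * k) + dot g h + quadform X h / 2 + d * k) by ring.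
  eapply Rle_lt_trans; [apply Rabs_triang|]. rewrite (Rabs_mult d).
  eapply Rle_lt_trans; [apply Rplus_le_compat_r, Rabs_triang|].
  eapply Rle_lt_trans; [apply Rplus_le_compat_r, Rplus_le_compat_r, Rabs_triang|].
  unfold Rdiv at 2; rewrite Rabs_mult, (Rabs_right (/ 2)) by lra.
  assert (vnorm g * vnorm h <= vnorm g * m) by nra.
  assert (vnorm h * vnorm h <= m) by nra.
  assert (Rabs k * Rabs k <= m) by nra.
  assert (Rabs d * Rabs k <= Rabs d * m) by nra.
  assert (C * (Rabs k * Rabs k) <= C * m) by nra.
  assert (Q * (vnorm h * vnorm h) <= Q * m) by nra.
  assert (Q * m >= 0) by nra.
  assert (m * Z <= eta).
  { replace eta with (eta / Z * Z) by (field; lra). apply Rmult_le_compat_r; lra. }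
  unfold Z in *. nra.
Qed.

Lemma Jet_line n (f : vec n -> R -> R) y tau g X d s : Jet f y tau g X d ->
  T2 (fun c => f (vadd y (vscal c s)) tau) 0 (dot g s) (quadform X s).
Proof.
  intros J del Hdel. pose proof (dot_ge0 _ s) as Hs.
  destruct (J (del / (dot s s + 1)) ltac:(apply Rdiv_lt_0_compat; lra)) as [C [r [Hr [HC K]]]].
  pose proof (vnorm_ge0 _ s).
  exists (r / (vnorm s + 1)); split; [apply Rdiv_lt_0_compat; lra|].
  intros c Hc. rewrite Rplus_0_l.
  replace (vscal 0 s) with (fun _ : Fin.t n => 0) by vec_ring.
  rewrite vadd_0.
  assert (Hn : vnorm (vscal c s) < r).
  { rewrite vnorm_scal. replace r with (r / (vnorm s + 1) * (vnorm s + 1)) by (field; lra).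
    pose proof (Rabs_pos c). nra. }
  specialize (K (vscal c s) 0 Hn ltac:(now rewrite Rabs_R0)).
  rewrite Rplus_0_r, dot_scal_r, quadform_scal, dot_scal_l, dot_scal_r in K.
  replace (f (vadd y (vscal c s)) tau - f y tau - dot g s * c - quadform X s / 2 * (c * c))
    with (f (vadd y (vscal c s)) tau - f y tau - c * dot g s - c * c * quadform X s / 2 - d * 0) by field.
  eapply Rle_trans; [apply K|].
  replace (del / (dot s s + 1) * (c * (c * dot s s)) + C * (0 * 0)) with (del * (c * c) * (1 - / (dot s s + 1))) by (field; lra).
  assert (0 < / (dot s s + 1)) by (apply Rinv_0_lt_compat; lra).
  assert (0 <= del * (c * c)) by nra. nra.
Qed.

Lemma Jet_O2 n (f : vec n -> R -> R) y tau g X d : Jet f y tau g X d -> O2 (fun t => f y t) tau d.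
Proof.
  intros J. destruct (J 1 ltac:(lra)) as [C [r [Hr [HC K]]]]. exists C, r; repeat split; auto.
  intros k Hk. specialize (K (fun _ => 0) k ltac:(now rewrite vnorm_0) Hk).
  rewrite vadd_0, dot_sym, !dot_0_l in K.
  rewrite quadform_0_r in K.
  replace (f y (tau + k) - f y tau - d * k) with (f y (tau + k) - f y tau - 0 - 0 / 2 - d * k) by field.
  lra.
Qed.

(** The heat equation [f_t = lap dirs (D^2 f)], stated pointwise through expansions at all times,
    negative ones included. Symmetry of [X] is recorded because viscosity test functions need a
    symmetric Hessian. *)
Definition Caloric {n} (dirs : list (vec n)) (f : vec n -> R -> R) : Prop :=
  forall y tau, exists g X, symm X /\ Jet f y tau g X (lap dirs X).

(** Symbol of the operator [lap dirs] at frequency [l], hence the decay rate of a cosine wave with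
    wave vector [l]. *)
Definition qd {n} (dirs : list (vec n)) (l : vec n) : R :=
  fold_right (fun s r => dot l s * dot l s + r) 0 dirs.

Lemma lap_rk1 n dirs m (l : vec n) : lap dirs (rk1 m l) = m * qd dirs l.
Proof. induction dirs; simpl; [ring|]. rewrite IHdirs, quadform_rk1; ring. Qed.

Lemma symm_rk1 n m (l : vec n) : symm (rk1 m l).
Proof. intros i j; unfold rk1; ring. Qed.

Lemma Caloric_add n dirs (f1 f2 : vec n -> R -> R) c : Caloric dirs f1 -> Caloric dirs f2 ->
  Caloric dirs (fun y t => f1 y t + c * f2 y t).
Proof.
  intros H1 H2 y tau. destruct (H1 y tau) as [g1 [X1 [S1 J1]]]; destruct (H2 y tau) as [g2 [X2 [S2 J2]]].
  exists (vadd g1 (vscal c g2)), (fun i j => X1 i j + c * X2 i j). split.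
  - intros i j; now rewrite (S1 i), (S2 i).
  - rewrite lap_plus. now apply Jet_add.
Qed.

Lemma Caloric_const n dirs c : Caloric dirs (fun (_ : vec n) (_ : R) => c).
Proof.
  intros y tau. exists (fun _ => 0), (fun _ _ => 0). split; [easy|]. rewrite lap_0.
  apply (Jet_time n (fun _ => c)), O2_const.
Qed.

Lemma Caloric_ext n dirs (f1 f2 : vec n -> R -> R) : (forall y t, f1 y t = f2 y t) ->
  Caloric dirs f1 -> Caloric dirs f2.
Proof.
  intros H J. replace f2 with f1; auto. extensionality z; extensionality t; apply H.
Qed.

Lemma Caloric_wave n dirs (l : vec n) th :
  Caloric dirs (fun y t => exp (- qd dirs l * t) * cos (dot l y + th)).
Proof.
  intros y tau. eexists _, _; split; [|].
  2: { pose proof (Jet_sep n (fun t => exp (- qd dirs l * t)) cos l y th tau _ _ _ (O2_exp _ _) (T2_cos _)) as J.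
       replace (- qd dirs l * exp (- qd dirs l * tau) * cos (dot l y + th))
         with (lap dirs (rk1 (exp (- qd dirs l * tau) * - cos (dot l y + th)) l)) in J by (rewrite lap_rk1; ring).
       exact J. }
  apply symm_rk1.
Qed.

(** The quartic heat polynomial in [z = dot l y + th]: with [D = qd dirs l], both the time
    derivative and [lap dirs] of the Hessian equal [12 D z^2 + 24 D^2 t]. *)
Lemma Caloric_quartic n dirs (l : vec n) th :
  Caloric dirs (fun y t => (dot l y + th) ^ 4 + 12 * qd dirs l * (t * (dot l y + th) ^ 2) + 12 * (qd dirs l * t) ^ 2).
Proof.
  intros y tau. set (D := qd dirs l). set (z := dot l y + th).
  pose proof (Jet_sep n (fun _ => 1) (fun s => s ^ 4) l y th tau _ _ _ (O2_const _ _) (T2_pow4 _)) as J1.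
  pose proof (Jet_sep n (fun t => 1 * t) (fun s => s * s) l y th tau _ _ _ (O2_id _ _) (T2_sq _)) as J2.
  pose proof (Jet_time n (fun t => 1 * (t * t)) y tau _ (O2_sq _ _)) as J3.
  pose proof (Jet_add _ _ _ _ _ _ _ _ _ _ _ (12 * D * D) (Jet_add _ _ _ _ _ _ _ _ _ _ _ (12 * D) J1 J2) J3) as J.
  cbv beta in J. match type of J with Jet _ _ _ ?g ?X ?d => exists g, X; replace d with (lap dirs X) in J end.
  - split; [intros i j; unfold rk1; ring|].
    eapply Jet_ext; [|exact J]. intros y' t'; simpl; ring.
  - rewrite (lap_plus n dirs (fun i j => rk1 _ l i j + 12 * D * rk1 _ l i j) (fun _ _ => 0)).
    rewrite lap_plus, !lap_rk1, lap_0. fold D z. ring.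
Qed.

Lemma Caloric_fsum n m dirs (f : Fin.t m -> vec n -> R -> R) : (forall i, Caloric dirs (f i)) ->
  Caloric dirs (fun y t => fsum m (fun i => f i y t)).
Proof.
  induction m; intros H; simpl.
  - apply Caloric_const.
  - apply (Caloric_ext _ _ (fun y t => f Fin.F1 y t + 1 * fsum m (fun i => f (Fin.FS i) y t))); [intros; ring|].
    apply Caloric_add; auto.
Qed.

(** An exact heat polynomial, so it may be added to a heat flow; it dominates any
    constant away from [y0] but is only [O(t^2)], hence negligible against [t], at [y0]. *)
Definition bar {n} (dirs : list (vec n)) (y0 y : vec n) (t : R) : R :=
  fsum n (fun i => (y i - y0 i) ^ 4 + 12 * qd dirs (unitv i) * (t * (y i - y0 i) ^ 2) + 12 * (qd dirs (unitv i) * t) ^ 2).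

Lemma qd_nonneg n dirs (l : vec n) : 0 <= qd dirs l.
Proof. induction dirs; simpl; [lra | nra]. Qed.

Lemma Caloric_bar n dirs (y0 : vec n) : Caloric dirs (bar dirs y0).
Proof.
  unfold bar. apply (Caloric_fsum n n dirs (fun i y t => (y i - y0 i) ^ 4 + 12 * qd dirs (unitv i) * (t * (y i - y0 i) ^ 2) + 12 * (qd dirs (unitv i) * t) ^ 2)).
  intros i. eapply Caloric_ext; [|apply (Caloric_quartic n dirs (unitv i) (- y0 i))].
  intros y t; simpl. rewrite dot_unitv_l. ring.
Qed.

Lemma bar_center n dirs (y0 : vec n) : exists C, 0 <= C /\ forall t, bar dirs y0 y0 t = C * (t * t).
Proof.
  exists (fsum n (fun i => 12 * qd dirs (unitv i) ^ 2)). split.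
  - apply fsum_nonneg; intros i. pose proof (pow2_ge_0 (qd dirs (unitv i))); lra.
  - intros t. unfold bar. rewrite Rmult_comm, <- fsum_scal. apply fsum_ext; intros i; ring.
Qed.

(** Cauchy-Schwarz for the squares of the coordinates against the all-ones vector. *)
Lemma quartic_ge n (v : vec n) : dot v v * dot v v <= INR n * fsum n (fun i => v i ^ 4).
Proof.
  pose proof (cauchy_sq n (fun _ => 1) (fun i => v i * v i)) as H.
  unfold dot in *.
  rewrite (fsum_ext _ (fun i => 1 * (v i * v i)) (fun i => v i * v i)) in H by (intros; ring).
  rewrite (fsum_ext _ (fun i => v i * v i * (v i * v i)) (fun i => v i ^ 4)) in H by (intros; ring).
  rewrite (fsum_ext _ (fun _ => 1 * 1) (fun _ => 1)) in H by (intros; ring).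
  rewrite fsum_const in H. lra.
Qed.

Lemma bar_ge n dirs (y0 y : vec n) t : 0 <= t ->
  dot (vsub y y0) (vsub y y0) * dot (vsub y y0) (vsub y y0) <= INR n * bar dirs y0 y t.
Proof.
  intros Ht. eapply Rle_trans; [apply quartic_ge|]. apply Rmult_le_compat_l; [apply pos_INR|].
  apply fsum_le; intros i. unfold vsub. pose proof (qd_nonneg _ dirs (unitv i)).
  pose proof (pow2_ge_0 (y i - y0 i)). pose proof (pow2_ge_0 (qd dirs (unitv i) * t)).
  assert (0 <= 12 * qd dirs (unitv i) * (t * (y i - y0 i) ^ 2)) by (apply Rmult_le_pos; [lra | now apply Rmult_le_pos]). lra.
Qed.

Lemma bar_nonneg n dirs (y0 y : vec n) t : 0 <= t -> 0 <= bar dirs y0 y t.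
Proof.
  intros Ht. apply fsum_nonneg; intros i. pose proof (qd_nonneg _ dirs (unitv i)).
  pose proof (pow2_ge_0 (y i - y0 i)). pose proof (pow2_ge_0 (qd dirs (unitv i) * t)).
  assert (0 <= 12 * qd dirs (unitv i) * (t * (y i - y0 i) ^ 2)) by (apply Rmult_le_pos; [lra | now apply Rmult_le_pos]).
  assert (0 <= (y i - y0 i) ^ 4) by (replace ((y i - y0 i) ^ 4) with (((y i - y0 i) ^ 2) ^ 2) by ring; apply pow2_ge_0).
  lra.
Qed.

(** * Trigonometric approximation *)

(** The expectation of [F] under the binomial law with [m] trials of probability [x], conditioned on
    one trial. Monotonicity and moments follow by induction without binomial coefficients. *)
Fixpoint bern (x : R) (m : nat) (F : nat -> R) : R :=
  match m with
  | O => F O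
  | S m => x * bern x m (fun k => F (S k)) + (1 - x) * bern x m F
  end.

Lemma bern_le x m F G : 0 <= x <= 1 -> (forall k, F k <= G k) -> bern x m F <= bern x m G.
Proof.
  intros Hx; revert F G; induction m; intros F G H; simpl; auto.
  apply Rplus_le_compat; apply Rmult_le_compat_l; try lra; apply IHm; auto.
Qed.

Lemma bern_opp x m F : bern x m (fun k => - F k) = - bern x m F.
Proof. revert F; induction m; intros F; simpl; auto. rewrite !IHm; ring. Qed.

(** Second moment: mean [m x], variance [m x (1 - x)]. The free shift [b] carries the induction,
    since a success replaces [b] by [b + 1]. *)
Lemma bern_quad x m c L b :
  bern x m (fun k => c + L * ((INR k + b) * (INR k + b))) =
  c + L * ((INR m * x + b) * (INR m * x + b) + INR m * (x * (1 - x))).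
Proof.
  revert b; induction m; intros b; [simpl; ring|].
  change (bern x (S m) (fun k => c + L * ((INR k + b) * (INR k + b)))) with
   (x * bern x m (fun k => c + L * ((INR (S k) + b) * (INR (S k) + b)))
    + (1 - x) * bern x m (fun k => c + L * ((INR k + b) * (INR k + b)))).
  assert ((fun k => c + L * ((INR (S k) + b) * (INR (S k) + b))) =
    (fun k => c + L * ((INR k + (b + 1)) * (INR k + (b + 1))))) as ->.
  { extensionality k; rewrite S_INR; ring. }
  rewrite !IHm, S_INR; ring.
Qed.

Definition node (m k : nat) : R := 2 * (INR k / INR m) - 1.

(** Tensor-product Bernstein operator: [f] is sampled at nodes in the cube [[-1, 1]^n], while the
    argument lives in [[0, 1]^n]. *)
Fixpoint mbern (m n : nat) : (vec n -> R) -> vec n -> R :=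
  match n return (vec n -> R) -> vec n -> R with
  | O => fun f _ => f (fun _ => 0)
  | S n => fun f x => bern (x Fin.F1) m (fun k => mbern m n (fun v => f (vcons (node m k) v)) (vtl x))
  end.

Lemma mbern_opp m n f x : mbern m n (fun v => - f v) x = - mbern m n f x.
Proof.
  induction n; simpl; auto. rewrite <- bern_opp. f_equal. extensionality k.
  apply (IHn (fun v => f (vcons (node m k) v))).
Qed.

(** In each coordinate the rescaled binomial variable has mean [X i] and variance [4 x (1 - x) / m],
    at most [1 / m], so a quadratic upper bound centred at [X] costs at most [L / m] per
    coordinate. *)
Lemma mbern_le m n f (X : vec n) c L : (1 <= m)%nat -> 0 <= L -> (forall i, -1 <= X i <= 1) ->
  (forall v, f v <= c + L * dot (vsub v X) (vsub v X)) ->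
  mbern m n f (fun i => (1 + X i) / 2) <= c + INR n * (L / INR m).
Proof.
  intros Hm HL; revert f X c; induction n; intros f X c HX H.
  - simpl. specialize (H (fun _ => 0)). unfold dot in H; simpl in H. lra.
  - change (bern ((1 + X Fin.F1) / 2) m (fun k => mbern m n (fun v => f (vcons (node m k) v))
      (fun i => (1 + vtl X i) / 2)) <= c + INR (S n) * (L / INR m)).
    assert (Hm' : 0 < INR m) by (apply lt_0_INR; lia).
    pose proof (HX Fin.F1) as HX1.
    set (x := (1 + X Fin.F1) / 2). assert (Hx : 0 <= x <= 1) by (unfold x; lra).
    eapply Rle_trans.
    + apply (bern_le x m _ (fun k => (c + INR n * (L / INR m)) + L * (4 / (INR m * INR m))
        * ((INR k + - (INR m * x)) * (INR k + - (INR m * x))))); auto.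
      intros k. eapply Rle_trans.
      (* The first coordinate's share of the quadratic is moved into the constant, and is averaged
         only afterwards by [bern_quad]. *)
      * apply (IHn _ _ (c + L * ((node m k - X Fin.F1) * (node m k - X Fin.F1)))).
        { intros i; apply HX. }
        intros v. eapply Rle_trans; [apply H|]. rewrite dot_S.
        change (vtl (vsub (vcons (node m k) v) X)) with (vsub v (vtl X)).
        change (vsub (vcons (node m k) v) X Fin.F1) with (node m k - X Fin.F1).
        apply Req_le; ring.
      * apply Req_le. replace (X Fin.F1) with (2 * x - 1) by (unfold x; field). unfold node. field. lra.
    + rewrite bern_quad, S_INR.
      replace (L * (4 / (INR m * INR m)) * ((INR m * x + - (INR m * x)) * (INR m * x + - (INR m * x)) + INR m * (x * (1 - x))))
        with (L / INR m * (4 * (x * (1 - x)))) by (field; lra).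
      assert (0 <= L / INR m) by (apply Rle_mult_inv_pos; lra).
      pose proof (Rle_0_sqr (2 * x - 1)); unfold Rsqr in *. nra.
Qed.

Lemma mbern_ge m n f (X : vec n) c L : (1 <= m)%nat -> 0 <= L -> (forall i, -1 <= X i <= 1) ->
  (forall v, c - L * dot (vsub v X) (vsub v X) <= f v) ->
  c - INR n * (L / INR m) <= mbern m n f (fun i => (1 + X i) / 2).
Proof.
  intros Hm HL HX H.
  pose proof (mbern_le m n (fun v => - f v) X (- c) L Hm HL HX) as K. rewrite mbern_opp in K.
  assert (forall v, - f v <= - c + L * dot (vsub v X) (vsub v X)) by (intros v; specialize (H v); lra).
  specialize (K H0). lra.
Qed.

Definition tev {n} (ts : list (R * vec n * R)) (y : vec n) : R :=
  fold_right (fun p r => let '(c, l, th) := p in c * cos (dot l y + th) + r) 0 ts.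

Definition is_trig {n} (P : vec n -> R) : Prop := exists ts, forall y, P y = tev ts y.

Lemma is_trig_const n c : is_trig (fun _ : vec n => c).
Proof.
  exists ((c, (fun _ => 0), 0) :: nil). intros y; simpl. rewrite dot_0_l, !Rplus_0_r, cos_0; ring.
Qed.

Lemma is_trig_add n (P Q : vec n -> R) : is_trig P -> is_trig Q -> is_trig (fun y => P y + Q y).
Proof.
  intros [p Hp] [q Hq]. exists (p ++ q). intros y; rewrite Hp, Hq. clear.
  induction p as [|[[c l] th] p IH]; simpl; [ring | rewrite <- IH; ring].
Qed.

Lemma is_trig_scal n c (P : vec n -> R) : is_trig P -> is_trig (fun y => c * P y).
Proof.
  intros [p Hp]. exists (map (fun t => let '(d, l, th) := t in (c * d, l, th)) p).
  intros y; rewrite Hp. clear.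
  induction p as [|[[d l] th] p IH]; simpl; [ring | rewrite <- IH; ring].
Qed.

Lemma is_trig_mul_cos n l th (P : vec n -> R) : is_trig P -> is_trig (fun y => cos (dot l y + th) * P y).
Proof.
  intros [p Hp]. exists (flat_map (fun t => let '(d, k, ph) := t in
    (d / 2, vadd k l, ph + th) :: (d / 2, vsub k l, ph - th) :: nil) p).
  intros y; rewrite Hp. clear.
  induction p as [|[[d k] ph] p IH]; simpl; [ring | rewrite <- IH].
  rewrite dot_add_l, dot_sub_l.
  replace (dot k y + dot l y + (ph + th)) with ((dot k y + ph) + (dot l y + th)) by ring.
  replace (dot k y - dot l y + (ph - th)) with ((dot k y + ph) - (dot l y + th)) by ring.
  set (A := dot k y + ph); set (B := dot l y + th).
  rewrite cos_plus, cos_minus. field.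
Qed.

(** Products of general trigonometric sums are avoided: the recursion of [bern] only multiplies by
    [x], which will be an affine function of a single cosine. *)
Lemma is_trig_bern N x m (F : nat -> vec N -> R) :
  (forall P, is_trig P -> is_trig (fun y => x y * P y)) -> (forall k, is_trig (F k)) ->
  is_trig (fun y => bern (x y) m (fun k => F k y)).
Proof.
  intros Hx; revert F; induction m; intros F HF; simpl; auto.
  apply is_trig_add.
  - apply Hx, (IHm (fun k => F (S k))); auto.
  - replace (fun y => (1 - x y) * bern (x y) m (fun k => F k y))
     with (fun y => bern (x y) m (fun k => F k y) + (-1) * (x y * bern (x y) m (fun k => F k y)))
     by (extensionality y; ring).
    apply is_trig_add; [apply IHm; auto|]. apply is_trig_scal, Hx, IHm; auto.
Qed.

Lemma is_trig_mbern N m n (f : vec n -> R) (xs : vec N -> vec n) :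
  (forall i P, is_trig P -> is_trig (fun y => xs y i * P y)) ->
  is_trig (fun y => mbern m n f (xs y)).
Proof.
  revert f xs; induction n; intros f xs Hx; simpl; [apply is_trig_const|].
  apply (is_trig_bern N (fun y => xs y Fin.F1) m
    (fun k y => mbern m n (fun v => f (vcons (node m k) v)) (vtl (xs y)))); [apply Hx|].
  intros k. apply (IHn _ (fun y => vtl (xs y))). intros i; apply Hx.
Qed.

(** Two uses of the mean value theorem: the derivative [cos z - 1] is bounded by [|z|], hence by
    [|a|]. *)
Lemma sin_sub_id a : Rabs (sin a - a) <= a * a.
Proof.
  pose proof (mvt_bound (fun z => sin z - z) (fun z => cos z - 1) 0 a (Rabs a)) as H.
  rewrite Rplus_0_l, sin_0 in H. replace (sin a - a - (0 - 0)) with (sin a - a) in H by ring.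
  replace (a * a) with (Rabs a * Rabs a) by (symmetry; apply Rsqr_abs).
  apply H.
  - intros z _. apply (derivable_pt_lim_minus sin (fun z => z)); [apply derivable_pt_lim_sin | apply derivable_pt_lim_id].
  - intros z Hz. rewrite Rminus_0_r in Hz.
    pose proof (mvt_bound cos (fun z => - sin z) 0 z 1) as K.
    rewrite Rplus_0_l, cos_0, Rmult_1_l in K. eapply Rle_trans; [apply K | exact Hz].
    + intros; apply derivable_pt_lim_cos.
    + intros w _. rewrite Rabs_Ropp. apply Rabs_le, SIN_bound.
Qed.

Lemma vnorm_le_coord n (v : vec n) K : 0 <= K -> (forall i, Rabs (v i) <= K) -> vnorm v <= (INR n + 1) * K.
Proof.
  intros HK H. pose proof (pos_INR n). apply vnorm_le; [nra|].
  apply Rle_trans with (fsum n (fun _ => K * K)).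
  - apply fsum_le; intros i. specialize (H i). pose proof (Rabs_pos (v i)).
    assert (v i * v i = Rabs (v i) * Rabs (v i)) as -> by apply Rsqr_abs. nra.
  - rewrite fsum_const. assert (0 <= K * K) by nra. nra.
Qed.

(** The substitution [x_i = (1 + sin (c (y_i - y0_i))) / 2] turns Bernstein polynomials
    into trigonometric sums, whose heat flow is explicit; [sin (c z) / c] is close to [z]
    on the ball once [c] is small. *)
Lemma trig_approx n (f : vec n -> R) M (y0 : vec n) rho eta : 0 <= M -> 0 < rho -> 0 < eta ->
  (forall v, Rabs (f v) <= M) ->
  (forall eps, 0 < eps -> exists del, 0 < del /\ forall v w, vnorm (vsub v w) < del -> Rabs (f v - f w) < eps) ->
  exists ts, (forall y, Rabs (tev ts y) <= M) /\
    forall y, vnorm (vsub y y0) <= rho -> Rabs (tev ts y - f y) <= eta.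
Proof.
  intros HM Hrho Heta Hf Hc.
  destruct (Hc (eta / 3) ltac:(lra)) as [del [Hdel Hd]].
  pose proof (pos_INR n) as Hn.
  (* With this frequency, [sin (c z) / c] differs from [z] by at most [c rho^2] in each coordinate
     on the ball, and the resulting vector has norm below [del]. *)
  set (c := del / ((INR n + 1) * (rho * rho + 1) * 2)).
  assert (Hq : 0 < (INR n + 1) * (rho * rho + 1) * 2) by (repeat apply Rmult_lt_0_compat; nra).
  assert (Hc0 : 0 < c) by (apply Rdiv_lt_0_compat; auto).
  assert (Hc1 : (INR n + 1) * (c * (rho * rho)) < del).
  { assert (E : c * ((INR n + 1) * (rho * rho + 1) * 2) = del) by (unfold c; field; split; nra).
    assert (0 <= c * (INR n + 1)) by nra. nra. }
  clearbody c.
  set (g := fun X : vec n => f (vadd y0 (vscal (/ c) X))).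
  (* Uniform continuity as a quadratic bound: arguments of [g] at distance at least [del * c]
     satisfy [L * |v - X|^2 >= 2 M], which exceeds any oscillation; closer arguments are covered by
     [eta / 3]. *)
  set (L := 2 * M / (del * del * (c * c))).
  assert (HL : 0 <= L) by (apply Rle_mult_inv_pos; [lra | repeat apply Rmult_lt_0_compat; auto]).
  assert (Hg : forall X v, Rabs (g v - g X) <= eta / 3 + L * dot (vsub v X) (vsub v X)).
  { intros X v. pose proof (dot_ge0 _ (vsub v X)) as H0.
    destruct (Rlt_dec (vnorm (vsub (vadd y0 (vscal (/ c) v)) (vadd y0 (vscal (/ c) X)))) del) as [H|H].
    - specialize (Hd _ _ H). unfold g. assert (0 <= L * dot (vsub v X) (vsub v X)) by nra. lra.
    - assert (E : vsub (vadd y0 (vscal (/ c) v)) (vadd y0 (vscal (/ c) X)) = vscal (/ c) (vsub v X)) by vec_ring.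
      rewrite E, vnorm_scal, Rabs_right in H by (apply Rle_ge, Rlt_le, Rinv_0_lt_compat; auto).
      assert (H1 : del * c <= vnorm (vsub v X)).
      { apply Rnot_lt_le in H. replace (vnorm (vsub v X)) with (/ c * vnorm (vsub v X) * c) by (field; lra).
        apply Rmult_le_compat_r; lra. }
      assert (H2 : del * c * (del * c) <= dot (vsub v X) (vsub v X)).
      { rewrite <- vnorm_sq. assert (0 < del * c) by nra. nra. }
      assert (H3 : 2 * M <= L * dot (vsub v X) (vsub v X)).
      { replace (2 * M) with (L * (del * c * (del * c))) by (unfold L; field; lra). now apply Rmult_le_compat_l. }
      unfold g. eapply Rle_trans; [apply Rabs_triang|]. rewrite Rabs_Ropp.
      pose proof (Hf (vadd y0 (vscal (/ c) v))); pose proof (Hf (vadd y0 (vscal (/ c) X))). lra. }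
  destruct (INR_unbounded (INR n * L * 3 / eta)) as [m0 Hm0].
  set (m := S m0).
  assert (Hm' : 0 < INR m) by (apply lt_0_INR; unfold m; lia).
  assert (Hm : INR n * (L / INR m) <= eta / 3).
  { assert (INR n * L * 3 / eta < INR m) by (unfold m; rewrite S_INR; lra).
    apply Rmult_le_reg_r with (INR m * 3 / eta); [apply Rdiv_lt_0_compat; lra|].
    replace (INR n * (L / INR m) * (INR m * 3 / eta)) with (INR n * L * 3 / eta) by (field; lra).
    replace (eta / 3 * (INR m * 3 / eta)) with (INR m) by (field; lra). lra. }
  set (Xs := fun (y : vec n) (i : Fin.t n) => sin (c * (y i - y0 i))).
  assert (HXs : forall y i, -1 <= Xs y i <= 1) by (intros; apply SIN_bound).
  destruct (is_trig_mbern n m n g (fun y i => (1 + Xs y i) / 2)) as [ts Hts].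
  { intros i P HP.
    (* A sine is a cosine with phase [- PI / 2], so multiplication by [(1 + sin) / 2] preserves
       trigonometric sums. *)
    replace (fun y => (1 + Xs y i) / 2 * P y) with
      (fun y => (1 / 2) * P y + (1 / 2) * (cos (dot (vscal c (unitv i)) y + (- c * y0 i - PI / 2)) * P y)).
    - apply is_trig_add; apply is_trig_scal; auto. now apply is_trig_mul_cos.
    - extensionality y. rewrite dot_scal_l, dot_unitv_l.
      replace (c * y i + (- c * y0 i - PI / 2)) with (c * (y i - y0 i) - PI / 2) by ring.
      rewrite cos_minus, cos_PI2, sin_PI2. unfold Xs. field. }
  exists ts; split.
  - intros y. rewrite <- Hts.
    (* Taking [L = 0] shows that averaging preserves the bound [M], and does so on the whole space,
       not only on the ball. *)
    pose proof (mbern_le m n g (Xs y) M 0 ltac:(unfold m; lia) ltac:(lra) (HXs y)) as A.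
    pose proof (mbern_ge m n g (Xs y) (-M) 0 ltac:(unfold m; lia) ltac:(lra) (HXs y)) as B.
    assert (HH : forall v, - M <= g v <= M).
    { intros v. specialize (Hf (vadd y0 (vscal (/ c) v))). pose proof (Rle_abs (g v)); pose proof (Rle_abs (- g v)).
      rewrite Rabs_Ropp in *. unfold g in *; lra. }
    assert (Z : 0 / INR m = 0) by (unfold Rdiv; ring).
    rewrite Z in A, B.
    assert (A' := A ltac:(intros v; specialize (HH v); lra)).
    assert (B' := B ltac:(intros v; specialize (HH v); lra)).
    apply Rabs_le; lra.
  - intros y Hy. rewrite <- Hts.
    pose proof (mbern_le m n g (Xs y) (g (Xs y) + eta / 3) L ltac:(unfold m; lia) HL (HXs y)) as A.
    pose proof (mbern_ge m n g (Xs y) (g (Xs y) - eta / 3) L ltac:(unfold m; lia) HL (HXs y)) as B.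
    assert (HA : forall v, g v <= g (Xs y) + eta / 3 + L * dot (vsub v (Xs y)) (vsub v (Xs y))).
    { intros v. specialize (Hg (Xs y) v). pose proof (Rle_abs (g v - g (Xs y))). lra. }
    assert (HB : forall v, g (Xs y) - eta / 3 - L * dot (vsub v (Xs y)) (vsub v (Xs y)) <= g v).
    { intros v. specialize (Hg (Xs y) v). pose proof (Rle_abs (- (g v - g (Xs y)))). rewrite Rabs_Ropp in *. lra. }
    specialize (A HA). specialize (B HB).
    assert (HD : Rabs (g (Xs y) - f y) < eta / 3).
    { unfold g. apply Hd. eapply Rle_lt_trans; [|exact Hc1]. apply vnorm_le_coord; [nra|].
      intros i. unfold vsub, vadd, vscal, Xs.
      replace (y0 i + / c * sin (c * (y i - y0 i)) - y i) with (/ c * (sin (c * (y i - y0 i)) - c * (y i - y0 i))) by (field; lra).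
      rewrite Rabs_mult, (Rabs_right (/ c)) by (apply Rle_ge, Rlt_le, Rinv_0_lt_compat; auto).
      apply Rle_trans with (/ c * (c * (y i - y0 i) * (c * (y i - y0 i)))).
      { apply Rmult_le_compat_l; [apply Rlt_le, Rinv_0_lt_compat; auto | apply sin_sub_id]. }
      replace (/ c * (c * (y i - y0 i) * (c * (y i - y0 i)))) with (c * ((y i - y0 i) * (y i - y0 i))) by (field; lra).
      apply Rmult_le_compat_l; [lra|].
      pose proof (vnorm_comp _ (vsub y y0) i) as Hi. unfold vsub in Hi at 1.
      assert ((y i - y0 i) * (y i - y0 i) = Rabs (y i - y0 i) * Rabs (y i - y0 i)) as -> by apply Rsqr_abs.
      pose proof (Rabs_pos (y i - y0 i)). apply Rmult_le_compat; lra. }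
    apply Rabs_def2 in HD. apply Rabs_le; lra.
Qed.

(** * Explicit heat flow of trigonometric sums *)

Definition flow {n} (dirs : list (vec n)) (ts : list (R * vec n * R)) (y : vec n) (t : R) : R :=
  fold_right (fun p r => let '(c, l, th) := p in c * (exp (- qd dirs l * t) * cos (dot l y + th)) + r) 0 ts.

Lemma Caloric_flow n dirs (ts : list (R * vec n * R)) : Caloric dirs (flow dirs ts).
Proof.
  induction ts as [|[[c l] th] ts IH].
  - apply Caloric_const.
  - apply (Caloric_ext _ _ (fun y t => flow dirs ts y t + c * (exp (- qd dirs l * t) * cos (dot l y + th)))).
    + intros; simpl; ring.
    + apply Caloric_add; auto. apply Caloric_wave.
Qed.

Lemma flow_0 n dirs (ts : list (R * vec n * R)) y : flow dirs ts y 0 = tev ts y.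
Proof.
  induction ts as [|[[c l] th] ts IH]; simpl; auto.
  rewrite IH, Rmult_0_r, exp_0; ring.
Qed.

(** A crude bound by the sum of the coefficients. It provides the a priori boundedness needed by
    [caloric_max_principle], which in [flow_le] improves it to the bound at time zero. *)
Lemma flow_bounded n dirs (ts : list (R * vec n * R)) :
  exists K, 0 <= K /\ forall y t, 0 <= t -> Rabs (flow dirs ts y t) <= K.
Proof.
  induction ts as [|[[c l] th] ts [K [HK H]]]; simpl.
  - exists 0; split; [lra|]. intros; rewrite Rabs_R0; lra.
  - exists (Rabs c + K); split; [pose proof (Rabs_pos c); lra|]. intros y t Ht.
    eapply Rle_trans; [apply Rabs_triang|]. apply Rplus_le_compat; auto.
    rewrite !Rabs_mult. rewrite <- (Rmult_1_r (Rabs c)) at 2. apply Rmult_le_compat_l; [apply Rabs_pos|].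
    assert (exp (- qd dirs l * t) <= 1).
    { rewrite <- exp_0. pose proof (qd_nonneg _ dirs l).
      destruct (Req_dec (- qd dirs l * t) 0) as [->|]; [lra|]. apply Rlt_le, exp_increasing. nra. }
    pose proof (exp_pos (- qd dirs l * t)). rewrite (Rabs_right (exp _)) by lra.
    assert (Rabs (cos (dot l y + th)) <= 1) by (apply Rabs_le, COS_bound).
    pose proof (Rabs_pos (cos (dot l y + th))). nra.
Qed.

(** * The coupled maximum principle *)

(** This replaces every passage to the limit in a small parameter [k]; [C] may have either sign. *)
Lemma le_0_of_small Z C r : 0 < r -> (forall k, 0 < k < r -> Z <= C * k) -> Z <= 0.
Proof.
  intros Hr H. destruct (Rle_dec Z 0) as [|HZ]; auto. exfalso. apply Rnot_le_lt in HZ.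
  pose proof (Rabs_pos C) as HC.
  set (k := Rmin (r / 2) (Z / (2 * (Rabs C + 1)))).
  assert (0 < Z / (2 * (Rabs C + 1))) by (apply Rdiv_lt_0_compat; lra).
  assert (Hk0 : 0 < k) by (apply Rmin_pos; lra).
  assert (Hk1 : k <= r / 2) by apply Rmin_l.
  assert (Hk2 : k <= Z / (2 * (Rabs C + 1))) by apply Rmin_r.
  specialize (H k ltac:(lra)).
  assert (C * k <= Rabs C * k) by (apply Rmult_le_compat_r; [lra | apply Rle_abs]).
  assert (Rabs C * k <= Rabs C * (Z / (2 * (Rabs C + 1)))) by (apply Rmult_le_compat_l; auto).
  assert (E : Z / (2 * (Rabs C + 1)) * (Rabs C + 1) = Z / 2) by (field; lra).
  nra.
Qed.

(** Adding the inequalities at [c] and [- c] removes all linear terms, [b] included. *)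
Lemma T2_max f g a1 m1 a2 m2 b w : T2 f 0 a1 m1 -> T2 g 0 a2 m2 ->
  (forall c, f c - g c - b * c - w * (c * c) <= f 0 - g 0) -> m1 - m2 <= 2 * w.
Proof.
  intros Hf Hg H. apply le_epsilon; intros eta He.
  destruct (Hf (eta / 4) ltac:(lra)) as [r1 [Hr1 K1]].
  destruct (Hg (eta / 4) ltac:(lra)) as [r2 [Hr2 K2]].
  set (c := Rmin r1 r2 / 2).
  assert (Hm : 0 < Rmin r1 r2) by (now apply Rmin_pos).
  assert (Rmin r1 r2 <= r1) by apply Rmin_l. assert (Rmin r1 r2 <= r2) by apply Rmin_r.
  assert (Hc : 0 < c) by (unfold c; lra).
  assert (A1 := K1 c ltac:(rewrite Rabs_right; unfold c; lra)).
  assert (A2 := K1 (- c) ltac:(rewrite Rabs_left; unfold c in *; lra)).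
  assert (A3 := K2 c ltac:(rewrite Rabs_right; unfold c; lra)).
  assert (A4 := K2 (- c) ltac:(rewrite Rabs_left; unfold c in *; lra)).
  rewrite !Rplus_0_l in *.
  apply Rabs_le_both in A1, A2, A3, A4.
  pose proof (H c) as B1; pose proof (H (- c)) as B2.
  assert (Hcc : 0 < c * c) by nra.
  apply Rmult_le_reg_r with (c * c); auto. nra.
Qed.

(** Only earlier times are compared, so the lemma also applies when the maximum sits at the final
    time. *)
Lemma O2_max f g tau d1 d2 beta r : 0 < r -> O2 f tau d1 -> O2 g tau d2 ->
  (forall k, 0 < k < r -> f (tau + - k) - g (tau + - k) + beta * k <= f tau - g tau) -> beta <= d1 - d2.
Proof.
  intros Hr [C1 [r1 [Hr1 [_ K1]]]] [C2 [r2 [Hr2 [_ K2]]]] H.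
  assert (Hm : 0 < Rmin r (Rmin r1 r2)) by (repeat apply Rmin_pos; auto).
  assert (beta - (d1 - d2) <= 0); [|lra].
  apply (le_0_of_small _ (C1 + C2) (Rmin r (Rmin r1 r2))); auto.
  intros k [Hk Hk'].
  assert (Rmin r (Rmin r1 r2) <= r) by apply Rmin_l.
  assert (Rmin r (Rmin r1 r2) <= r1) by (eapply Rle_trans; [apply Rmin_r | apply Rmin_l]).
  assert (Rmin r (Rmin r1 r2) <= r2) by (eapply Rle_trans; [apply Rmin_r | apply Rmin_r]).
  specialize (H k ltac:(lra)).
  specialize (K1 (- k) ltac:(rewrite Rabs_left; lra)). specialize (K2 (- k) ltac:(rewrite Rabs_left; lra)).
  apply Rabs_le_both in K1, K2. apply Rmult_le_reg_r with k; auto. nra.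
Qed.

(** Model of [2 phi(|y - x| / 2)] near a pair whose difference points along [e]: slope [B] and
    quadratic coefficient [A] along [e], and [Cq] times the squared transverse part. [Cq] absorbs
    the curvature of the norm and may be large: transverse moves are translations, which fix
    [y - x], so [Cq] does not enter the condition on [beta]. *)
Definition quad {n} (e : vec n) (B A Cq : R) (z : vec n) : R :=
  B * dot e z + A * (dot e z * dot e z) + Cq * (dot z z - dot e z * dot e z).

Lemma quad_cont n e B A Cq (z : vec n) : forall eta, 0 < eta -> exists del, 0 < del /\
  forall z', vnorm (vsub z' z) < del -> Rabs (quad e B A Cq z' - quad e B A Cq z) < eta.
Proof.
  intros eta He.
  assert (J : Jet (fun z _ => quad e B A Cq z) z 0
    (vadd (vscal (B + 2 * (A - Cq) * dot e z) e) (vscal (2 * Cq) z))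
    (fun i j => rk1 (2 * (A - Cq)) e i j + 2 * Cq * idm i j) 0).
  { intros del Hdel. exists 0, 1. repeat split; try lra. intros h k _ _.
    rewrite quadform_plus, quadform_rk1, quadform_idm. unfold quad.
    cbv beta. rewrite !dot_add_l, !dot_add_r, !dot_scal_l, (dot_sym _ h z).
    match goal with |- Rabs ?x <= _ => replace x with 0 by field end.
    rewrite Rabs_R0. pose proof (dot_ge0 _ h). nra. }
  destruct (Jet_cont _ _ _ _ _ _ _ J eta He) as [del [Hdel K]]. exists del; split; auto.
  intros z' Hz'. apply (K z' 0 Hz'). rewrite Rminus_diag, Rabs_R0. auto.
Qed.

(** Coupling by reflection in the direction [e] and by translation in the other
    directions: only the first moves [y - x]. *)
Lemma coupled_max_principle n (e : vec n) sg ds F1 F2 c0 B A Cq beta z0 Rb h :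
  dot e e = 1 -> Caloric (vscal sg e :: ds) F1 -> Caloric (vscal sg e :: ds) F2 ->
  8 * A * (sg * sg) < beta ->
  (forall x y, F1 y 0 - F2 x 0 <= c0 + quad e B A Cq (vsub (vsub y x) z0)) ->
  (forall x y tau, 0 <= tau <= h -> Rb < vnorm x \/ Rb < vnorm y ->
     F1 y tau - F2 x tau <= c0 + quad e B A Cq (vsub (vsub y x) z0) + beta * tau) ->
  forall x y tau, 0 <= tau <= h ->
     F1 y tau - F2 x tau <= c0 + quad e B A Cq (vsub (vsub y x) z0) + beta * tau.
Proof.
  intros He HF1 HF2 Hb H0 Hout x1 y1 tau1 Ht1.
  set (q := fun x y => quad e B A Cq (vsub (vsub y x) z0)) in *.
  set (G := fun x y tau => F1 y tau - F2 x tau - (c0 + q x y + beta * tau)).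
  apply Rnot_lt_le; intros Hlt.
  assert (HG1 : 0 < G x1 y1 tau1) by (unfold G, q; lra).
  set (D := fun (x y : vec n) tau => vnorm x <= Rb /\ vnorm y <= Rb /\ 0 <= tau <= h).
  assert (HD : forall x y tau, 0 <= tau <= h -> 0 < G x y tau -> D x y tau).
  { intros x y tau Ht HG. repeat split; try tauto; apply Rnot_lt_le; intros HR.
    - specialize (Hout x y tau Ht (or_introl HR)). unfold G, q in HG; lra.
    - specialize (Hout x y tau Ht (or_intror HR)). unfold G, q in HG; lra. }
  destruct (extreme_value n D G (Rb + h)) as [x [y [tau [[Hx [Hy Ht]] Hmax]]]].
  { exists x1, y1, tau1; auto. }
  { intros x y tau [Hx [Hy Ht]]. pose proof (vnorm_ge0 _ x). rewrite Rabs_right; lra. }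
  { intros xs ys ts x y t Hx Hy Ht HDs. repeat split.
    - apply (vcv_norm_le n xs x Rb Hx); intros k; apply HDs.
    - apply (vcv_norm_le n ys y Rb Hy); intros k; apply HDs.
    - apply (Un_cv_bounds ts t 0 h Ht); intros k; apply HDs.
    - apply (Un_cv_bounds ts t 0 h Ht); intros k; apply HDs. }
  { intros x y t _ eta Heta.
    destruct (HF1 y t) as [g1 [X1 [_ J1]]]. destruct (HF2 x t) as [g2 [X2 [_ J2]]].
    destruct (Jet_cont _ _ _ _ _ _ _ J1 (eta / 4) ltac:(lra)) as [d1 [Hd1 K1]].
    destruct (Jet_cont _ _ _ _ _ _ _ J2 (eta / 4) ltac:(lra)) as [d2 [Hd2 K2]].
    destruct (quad_cont n e B A Cq (vsub (vsub y x) z0) (eta / 4) ltac:(lra)) as [d3 [Hd3 K3]].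
    pose proof (Rabs_pos beta).
    exists (Rmin (Rmin d1 d2) (Rmin (d3 / 2) (eta / (4 * (Rabs beta + 1))))).
    split; [repeat apply Rmin_pos; try lra; apply Rdiv_lt_0_compat; lra|].
    intros x' y' t' _ Hx Hy Ht.
    assert (M1 := Rmin_l (Rmin d1 d2) (Rmin (d3 / 2) (eta / (4 * (Rabs beta + 1))))).
    assert (M2 := Rmin_r (Rmin d1 d2) (Rmin (d3 / 2) (eta / (4 * (Rabs beta + 1))))).
    assert (M3 := Rmin_l d1 d2). assert (M4 := Rmin_r d1 d2).
    assert (M5 := Rmin_l (d3 / 2) (eta / (4 * (Rabs beta + 1)))).
    assert (M6 := Rmin_r (d3 / 2) (eta / (4 * (Rabs beta + 1)))).
    specialize (K1 y' t' ltac:(lra) ltac:(lra)). specialize (K2 x' t' ltac:(lra) ltac:(lra)).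
    assert (Hw : vnorm (vsub (vsub (vsub y' x') z0) (vsub (vsub y x) z0)) < d3).
    { replace (vsub (vsub (vsub y' x') z0) (vsub (vsub y x) z0)) with (vsub (vsub y' y) (vsub x' x)) by vec_ring.
      eapply Rle_lt_trans; [apply vnorm_sub_le|]. lra. }
    specialize (K3 _ Hw).
    assert (K4 : Rabs (beta * (t' - t)) < eta / 4).
    { rewrite Rabs_mult. assert (E : eta / (4 * (Rabs beta + 1)) * (Rabs beta + 1) = eta / 4) by (field; lra).
      pose proof (Rabs_pos (t' - t)). nra. }
    apply Rabs_def2 in K1, K2, K3, K4. unfold G, q. nra. }
  assert (HGp : 0 < G x y tau).
  { eapply Rlt_le_trans; [exact HG1|]. apply Hmax, HD; auto. }
  (* Points of the slab outside [D] have [G <= 0], so the positive maximum over [D] is global there;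
     no boundary case remains in space. *)
  assert (Hglob : forall x' y' tau', 0 <= tau' <= h -> G x' y' tau' <= G x y tau).
  { intros x' y' tau' Ht'. destruct (Rlt_dec 0 (G x' y' tau')) as [Hp|Hp]; [|lra]. apply Hmax, HD; auto. }
  assert (Htp : 0 < tau).
  { destruct (Req_dec tau 0) as [E|E]; [|lra]. exfalso. specialize (H0 x y). unfold G in HGp. rewrite E in HGp. unfold q in *. lra. }
  destruct (HF1 y tau) as [g1 [X1 [_ J1]]]. destruct (HF2 x tau) as [g2 [X2 [_ J2]]].
  assert (Htime : beta <= lap (vscal sg e :: ds) X1 - lap (vscal sg e :: ds) X2).
  { apply (O2_max (fun t => F1 y t) (fun t => F2 x t) tau _ _ beta tau Htp (Jet_O2 _ _ _ _ _ _ _ J1) (Jet_O2 _ _ _ _ _ _ _ J2)).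
    intros k Hk. specialize (Hglob x y (tau + - k) ltac:(lra)). unfold G in Hglob. lra. }
  (* A common translation of both points leaves [quad] unchanged, hence [X1 <= X2] as quadratic
     forms. *)
  assert (Hpar : forall s, quadform X1 s - quadform X2 s <= 0).
  { intros s.
    replace 0 with (2 * 0) by ring.
    apply (T2_max _ _ _ _ _ _ 0 0 (Jet_line _ _ _ _ _ _ _ s J1) (Jet_line _ _ _ _ _ _ _ s J2)).
    intros c. specialize (Hglob (vadd x (vscal c s)) (vadd y (vscal c s)) tau ltac:(lra)).
    replace (vscal 0 s) with (fun _ : Fin.t n => 0) by vec_ring.
    rewrite !vadd_0. unfold G, q in Hglob.
    replace (vsub (vadd y (vscal c s)) (vadd x (vscal c s))) with (vsub y x) in Hglob by vec_ring. lra. }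
  (* Opposite displacements change [y - x] by [2 c sg e], so [A] contributes [4 A sg^2 c^2] and
     second differences double this. The sign on the [x] side is invisible to the even form
     [quadform X2]. *)
  assert (Href : quadform X1 (vscal sg e) - quadform X2 (vscal sg e) <= 2 * (4 * A * (sg * sg))).
  { replace (quadform X2 (vscal sg e)) with (quadform X2 (vscal (- sg) e)) by (rewrite !quadform_scal; ring).
    set (r := dot e (vsub (vsub y x) z0)).
    apply (T2_max _ _ _ _ _ _ (B * (2 * sg) + A * (4 * sg * r)) (4 * A * (sg * sg))
      (Jet_line _ _ _ _ _ _ _ (vscal sg e) J1) (Jet_line _ _ _ _ _ _ _ (vscal (- sg) e) J2)).
    intros c. specialize (Hglob (vadd x (vscal c (vscal (- sg) e))) (vadd y (vscal c (vscal sg e))) tau ltac:(lra)).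
    replace (vscal 0 (vscal sg e)) with (fun _ : Fin.t n => 0) by vec_ring.
    replace (vscal 0 (vscal (- sg) e)) with (fun _ : Fin.t n => 0) by vec_ring.
    rewrite !vadd_0. unfold G, q in Hglob.
    replace (vsub (vsub (vadd y (vscal c (vscal sg e))) (vadd x (vscal c (vscal (- sg) e)))) z0)
      with (vadd (vsub (vsub y x) z0) (vscal (2 * c * sg) e)) in Hglob by vec_ring.
    assert (EQ : quad e B A Cq (vadd (vsub (vsub y x) z0) (vscal (2 * c * sg) e)) =
      quad e B A Cq (vsub (vsub y x) z0) + (B * (2 * sg) + A * (4 * sg * r)) * c + 4 * A * (sg * sg) * (c * c)).
    { unfold quad, r. rewrite !dot_add_r, !dot_add_l, !dot_scal_l, !dot_scal_r, He, (dot_sym _ (vsub _ _) e). ring. }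
    rewrite EQ in Hglob. lra. }
  assert (Hds : lap ds X1 - lap ds X2 <= 0).
  { clear - Hpar. induction ds; simpl; [lra|]. specialize (Hpar a). lra. }
  simpl in Htime. lra.
Qed.

Lemma bar_ge_radius n dirs (y0 y : vec n) t rho : 0 <= t -> 0 <= rho -> rho <= vnorm (vsub y y0) ->
  rho * rho * (rho * rho) <= (INR n + 1) * bar dirs y0 y t.
Proof.
  intros Ht Hr H. pose proof (bar_ge n dirs y0 y t Ht) as HB. pose proof (bar_nonneg n dirs y0 y t Ht).
  rewrite <- vnorm_sq in HB. assert (rho * rho <= vnorm (vsub y y0) * vnorm (vsub y y0)) by nra.
  assert (0 <= rho * rho) by nra. nra.
Qed.

(** The coupled principle with [quad] zero and the second function reduced to a barrier; [gam] is
    both the weight of the barriers and the slope [beta], and is finally sent to zero. *)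
Lemma caloric_max_principle n (e : vec n) sg ds H M K : dot e e = 1 -> Caloric (vscal sg e :: ds) H ->
  (forall y t, 0 <= t -> H y t <= K) -> (forall y, H y 0 <= M) -> forall y t, 0 <= t -> H y t <= M.
Proof.
  set (dirs := vscal sg e :: ds). intros He HC HK HM y0 t Ht.
  destruct (bar_center n dirs y0) as [Cb [HCb HCb']].
  assert (H0 : forall gam, 0 < gam -> H y0 t - M <= (2 * Cb * (t * t) + t) * gam).
  { intros gam Hg. pose proof (pos_INR n) as Hn.
    (* Since [rho >= 1], also [rho^4 >= rho], and the second summand makes [gam * bar] at least
       [K - M] outside this radius. *)
    set (rho := 1 + (INR n + 1) * Rabs (K - M) / gam).
    pose proof (Rabs_pos (K - M)) as HKM.
    assert (Hr0 : 0 <= (INR n + 1) * Rabs (K - M) / gam) by (apply Rle_mult_inv_pos; nra).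
    assert (Hr1 : 1 <= rho) by (unfold rho; lra).
    assert (Hbar : forall y tau, 0 <= tau -> rho <= vnorm (vsub y y0) -> K - M <= gam * bar dirs y0 y tau).
    { intros y tau Htau Hy. pose proof (bar_ge_radius n dirs y0 y tau rho Htau ltac:(lra) Hy) as HB.
      assert (rho <= rho * rho * (rho * rho)) by (assert (1 <= rho * rho) by nra; nra).
      assert (E : (INR n + 1) * Rabs (K - M) = gam * ((INR n + 1) * Rabs (K - M) / gam)) by (field; lra).
      assert ((INR n + 1) * Rabs (K - M) <= (INR n + 1) * (gam * bar dirs y0 y tau)).
      { rewrite E.
        replace ((INR n + 1) * (gam * bar dirs y0 y tau)) with (gam * ((INR n + 1) * bar dirs y0 y tau)) by ring.
        apply Rmult_le_compat_l; [lra|]. unfold rho in *; lra. }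
      assert (Rabs (K - M) <= gam * bar dirs y0 y tau) by (apply Rmult_le_reg_l with (INR n + 1); lra).
      pose proof (Rle_abs (K - M)); lra. }
    assert (Q : forall y, quad e 0 0 0 y = 0) by (intros; unfold quad; ring).
    pose proof (coupled_max_principle n e sg ds
      (fun y t => H y t + (- gam) * bar dirs y0 y t)
      (fun y t => 0 + gam * bar dirs y0 y t)
      M 0 0 0 gam (fun _ => 0) (vnorm y0 + rho) t He) as MP.
    specialize (MP (Caloric_add _ _ _ _ _ HC (Caloric_bar _ _ _)) (Caloric_add _ _ _ _ _ (Caloric_const _ _ _) (Caloric_bar _ _ _)) ltac:(lra)).
    assert (MP' := fun A1 A2 => MP A1 A2 y0 y0 t ltac:(lra)). cbv beta in MP'. rewrite Q, !HCb' in MP'.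
    assert (H y0 t + - gam * (Cb * (t * t)) - (0 + gam * (Cb * (t * t))) <= M + 0 + gam * t); [|lra].
    apply MP'.
    - intros x y. rewrite Q. specialize (HM y). 
      pose proof (bar_nonneg n dirs y0 y 0 ltac:(lra)).
      pose proof (bar_nonneg n dirs y0 x 0 ltac:(lra)). nra.
    - intros x y tau Htau Hout. rewrite Q. specialize (HK y tau ltac:(lra)).
      pose proof (bar_nonneg n dirs y0 y tau ltac:(lra)).
      pose proof (bar_nonneg n dirs y0 x tau ltac:(lra)).
      pose proof (Hbar y tau ltac:(lra)) as B1. pose proof (Hbar x tau ltac:(lra)) as B2.
      assert (0 <= gam * tau) by nra.
      assert (0 <= gam * bar dirs y0 y tau) by nra.
      assert (0 <= gam * bar dirs y0 x tau) by nra.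
      destruct Hout as [Hout|Hout].
      + pose proof (vnorm_le_sub _ x y0). specialize (B2 ltac:(lra)). lra.
      + pose proof (vnorm_le_sub _ y y0). specialize (B1 ltac:(lra)). lra. }
  assert (H y0 t - M <= 0); [|lra].
  apply (le_0_of_small _ (2 * Cb * (t * t) + t) 1); [lra|]. intros k Hk; apply H0; lra.
Qed.

Lemma flow_le n (e : vec n) sg ds ts M : dot e e = 1 -> (forall y, Rabs (tev ts y) <= M) ->
  forall y t, 0 <= t -> Rabs (flow (vscal sg e :: ds) ts y t) <= M.
Proof.
  set (dirs := vscal sg e :: ds).
  intros He HM y t Ht. destruct (flow_bounded n dirs ts) as [K [HK HK']].
  apply Rabs_le; split.
  - enough (0 + (-1) * flow dirs ts y t <= M) by lra.
    apply (caloric_max_principle n e sg ds (fun y t => 0 + (-1) * flow dirs ts y t) M K); auto.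
    + apply Caloric_add; [apply Caloric_const | apply Caloric_flow].
    + intros y' t' Ht'. specialize (HK' y' t' Ht'). pose proof (Rle_abs (- flow dirs ts y' t')). rewrite Rabs_Ropp in *. lra.
    + intros y'. rewrite flow_0. specialize (HM y'). pose proof (Rle_abs (- tev ts y')). rewrite Rabs_Ropp in *. lra.
  - apply (caloric_max_principle n e sg ds (fun y t => flow dirs ts y t) M K); auto.
    + apply Caloric_flow.
    + intros y' t' Ht'. specialize (HK' y' t' Ht'). pose proof (Rle_abs (flow dirs ts y' t')). lra.
    + intros y'. rewrite flow_0. specialize (HM y'). pose proof (Rle_abs (tev ts y')). lra.
Qed.

(** * Viscosity test functions and sup-convolution *)

Lemma quadform_add n (X : mat n) v w : symm X ->
  quadform X (vadd v w) = quadform X v + 2 * dot v (fun i => dot (X i) w) + quadform X w.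
Proof.
  intros HX. unfold quadform, dot, vadd.
  assert (E : fsum n (fun i => fsum n (fun j => X i j * w i * v j)) =
              fsum n (fun i => v i * fsum n (fun j => X i j * w j))).
  { rewrite fsum_swap. apply fsum_ext; intros i. rewrite <- fsum_scal. apply fsum_ext; intros j.
    rewrite (HX j i); ring. }
  assert (E' : fsum n (fun i => fsum n (fun j => X i j * v i * w j)) =
              fsum n (fun i => v i * fsum n (fun j => X i j * w j))).
  { apply fsum_ext; intros i. rewrite <- fsum_scal. apply fsum_ext; intros j. ring. }
  replace (2 * fsum n (fun i => v i * fsum n (fun j => X i j * w j))) with
    (fsum n (fun i => fsum n (fun j => X i j * v i * w j)) + fsum n (fun i => fsum n (fun j => X i j * w i * v j)))
    by (rewrite E, E'; ring).
  rewrite <- !fsum_plus. apply fsum_ext; intros i. rewrite <- !fsum_plus. apply fsum_ext; intros j. ring.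
Qed.

Lemma derivable_pt_lim_quad (f : R -> R) c0 c1 c2 :
  (forall h, f h = c0 + c1 * h + c2 * (h * h)) -> derivable_pt_lim f 0 c1.
Proof.
  intros H eps He. pose proof (Rabs_pos c2).
  assert (Hd : 0 < eps / (Rabs c2 + 1)) by (apply Rdiv_lt_0_compat; lra).
  exists (mkposreal _ Hd). intros h Hh Hlt; simpl in Hlt.
  rewrite !H. replace ((c0 + c1 * (0 + h) + c2 * ((0 + h) * (0 + h)) - (c0 + c1 * 0 + c2 * (0 * 0))) / h - c1)
    with (c2 * h) by (field; auto).
  rewrite Rabs_mult. replace eps with (eps / (Rabs c2 + 1) * (Rabs c2 + 1)) by (field; lra).
  pose proof (Rabs_pos h). nra.
Qed.

(** The viscosity definitions ask for a whole family of iterated derivatives, smooth on the entire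
    strip. A polynomial without mixed space-time terms has this finite table, with zero for all
    other index lists; the coefficient [C] matches the time remainder of [Jet]. *)
Definition quad_test {n} (g : vec n) (X : mat n) (d C : R) (x0 : vec n) (t0 : R)
    (l : list (option (Fin.t n))) (x : vec n) (t : R) : R :=
  match l with
  | nil => dot g (vsub x x0) + quadform X (vsub x x0) / 2 + d * (t - t0) + C * ((t - t0) * (t - t0))
  | Some i :: nil => g i + dot (X i) (vsub x x0)
  | None :: nil => d + 2 * C * (t - t0)
  | Some i :: Some j :: nil => X i j
  | None :: None :: nil => 2 * C
  | _ => 0
  end.

Lemma quad_test_smooth n T g (X : mat n) d C x0 t0 : symm X ->
  smooth_family_nt (par_domain T) (quad_test g X d C x0 t0).
Proof.
  intros HX l.
  assert (Hconst : forall c, cont_on_nt (par_domain T) (fun (_ : vec n) (_ : R) => c)).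
  { intros c x t _ eps He. exists 1; split; [lra|]. intros. now rewrite Rminus_diag, Rabs_R0. }
  assert (Hder : forall c, derivable_pt_lim (fun _ => c) 0 0).
  { intros c. apply (derivable_pt_lim_quad _ c 0 0). intros; ring. }
  destruct l as [|[i|] [|[j|] [|? ?]]]; (split; [|intros x t Ht; split; [intros k|]]);
    try (apply Hconst); try (simpl; apply Hder).
  - intros x t _ eps He.
    assert (J : Jet (quad_test g X d C x0 t0 nil) x t (fun i => g i + dot (X i) (vsub x x0)) X (d + 2 * C * (t - t0))).
    { intros del Hdel. exists (Rabs C), 1. repeat split; [lra | apply Rabs_pos |]. intros h k _ _. simpl.
      replace (vsub (vadd x h) x0) with (vadd (vsub x x0) h) by vec_ring.
      rewrite quadform_add, dot_add_r by auto.
      assert (dot (fun i => g i + dot (X i) (vsub x x0)) h = dot g h + dot (vsub x x0) (fun i => dot (X i) h)) as ->.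
      { change (dot (vadd g (fun i => dot (X i) (vsub x x0))) h = dot g h + dot (vsub x x0) (fun i => dot (X i) h)).
        rewrite dot_add_l. f_equal. unfold dot.
        rewrite (fsum_ext _ _ (fun i => fsum n (fun j => h i * (X i j * vsub x x0 j))))
          by (intros; now rewrite fsum_scal, Rmult_comm).
        rewrite fsum_swap. apply fsum_ext; intros i. rewrite <- fsum_scal. apply fsum_ext; intros j.
        rewrite (HX j i). ring. }
      match goal with |- Rabs ?z <= _ => replace z with (C * (k * k)) by field end.
      rewrite Rabs_mult, (Rabs_right (k * k)) by nra. pose proof (dot_ge0 _ h). nra. }
    destruct (Jet_cont _ _ _ _ _ _ _ J eps He) as [del [Hdel K]]. exists del; split; auto.
    intros y s _ Hd. unfold dist_nt in Hd. pose proof (vnorm_ge0 _ (vsub y x)). pose proof (Rabs_pos (s - t)).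
    apply K; lra.
  - simpl. apply (derivable_pt_lim_quad _
      (dot g (vsub x x0) + quadform X (vsub x x0) / 2 + d * (t - t0) + C * ((t - t0) * (t - t0)))
      _ (quadform X (unitv k) / 2)).
    intros h. replace (vsub (vadd x (vscal h (unitv k))) x0) with (vadd (vsub x x0) (vscal h (unitv k))) by vec_ring.
    rewrite quadform_add, quadform_scal, dot_add_r, dot_scal_r by auto.
    assert (dot (vsub x x0) (fun i => dot (X i) (vscal h (unitv k))) = h * dot (X k) (vsub x x0)) as ->.
    { rewrite (dot_sym _ (X k)), <- dot_scal_r. apply fsum_ext; intros i.
      rewrite dot_scal_r, dot_sym, dot_unitv_l. unfold vscal. now rewrite HX. }
    rewrite (dot_sym _ g (unitv k)), dot_unitv_l. field.
  - simpl. apply (derivable_pt_lim_quad _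
      (dot g (vsub x x0) + quadform X (vsub x x0) / 2 + d * (t - t0) + C * ((t - t0) * (t - t0))) _ C).
    intros h. ring.
  - intros x t _ eps He. pose proof (vnorm_ge0 _ (X i)).
    exists (eps / (vnorm (X i) + 1)); split; [apply Rdiv_lt_0_compat; lra|].
    intros y s _ Hd. unfold dist_nt in Hd. pose proof (Rabs_pos (s - t)). simpl.
    replace (g i + dot (X i) (vsub y x0) - (g i + dot (X i) (vsub x x0))) with (dot (X i) (vsub y x))
      by (rewrite !dot_sub_r; ring).
    eapply Rle_lt_trans; [apply cauchy|]. pose proof (vnorm_ge0 _ (vsub y x)).
    replace eps with (eps / (vnorm (X i) + 1) * (vnorm (X i) + 1)) by (field; lra). nra.
  - simpl. apply (derivable_pt_lim_quad _ (g i + dot (X i) (vsub x x0)) _ 0).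
    intros h. replace (vsub (vadd x (vscal h (unitv k))) x0) with (vadd (vsub x x0) (vscal h (unitv k))) by vec_ring.
    rewrite dot_add_r, dot_scal_r, (dot_sym _ (X i) (unitv k)), dot_unitv_l, HX. ring.
  - intros x t _ eps He. pose proof (Rabs_pos (2 * C)).
    exists (eps / (Rabs (2 * C) + 1)); split; [apply Rdiv_lt_0_compat; lra|].
    intros y s _ Hd. unfold dist_nt in Hd. pose proof (vnorm_ge0 _ (vsub y x)). simpl.
    replace (d + 2 * C * (s - t0) - (d + 2 * C * (t - t0))) with (2 * C * (s - t)) by ring.
    rewrite Rabs_mult. pose proof (Rabs_pos (s - t)).
    replace eps with (eps / (Rabs (2 * C) + 1) * (Rabs (2 * C) + 1)) by (field; lra). nra.
  - simpl. apply (derivable_pt_lim_quad _ (d + 2 * C * (t - t0)) _ 0). intros; ring.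
Qed.

Lemma visc_sub_quad n T a b (u : vec n -> R -> R) x0 t0 g X d C r :
  visc_sub T a b u -> 0 < t0 < T -> symm X -> 0 < r ->
  (forall h k, vnorm h < r -> Rabs k < r ->
     u (vadd x0 h) (t0 + k) <= u x0 t0 + dot g h + quadform X h / 2 + d * k + C * (k * k)) ->
  d <= frob (fun i j => a i j g t0) X + b g t0.
Proof.
  intros Hu Ht HX Hr H.
  pose proof (Hu _ (quad_test_smooth n T g X d C x0 t0 HX) x0 t0 Ht) as K.
  simpl in K. unfold F_op in K.
  assert ((fun i => g i + dot (X i) (vsub x0 x0)) = g) as E.
  { extensionality i. rewrite vsub_self, dot_0_r; ring. }
  rewrite E in K. unfold frob. rewrite Rminus_diag in K.
  enough (d + 2 * C * 0 + (- fsum n (fun i => fsum n (fun j => a i j g t0 * X i j)) - b g t0) <= 0) by lra.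
  apply K. exists r; split; auto. intros y s Hd. unfold dist_nt in Hd.
  pose proof (vnorm_ge0 _ (vsub y x0)). pose proof (Rabs_pos (s - t0)).
  specialize (H (vsub y x0) (s - t0) ltac:(lra) ltac:(lra)).
  rewrite vadd_vsub in H. replace (t0 + (s - t0)) with s in H by ring.
  rewrite vsub_self, dot_0_r, quadform_0_r. lra.
Qed.

(** Regularisation in space only. As the coefficients depend on the gradient and time but not on
    position, the sup-convolution of a subsolution satisfies the same inequality with no error
    term. *)
Definition supconv {n} (kap : R) (u : vec n -> R -> R) (y : vec n) (t : R) : R :=
  supR (fun v => exists z, v = u (vadd y z) t - kap * dot z z).

Definition bounded_on {n} (T M : R) (u : vec n -> R -> R) : Prop :=
  forall x t, 0 <= t <= T -> Rabs (u x t) <= M.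

Lemma supR_lub E : bound E -> (exists v, E v) -> is_lub E (supR E).
Proof.
  intros HB HE. apply (epsilon_spec (inhabits 0) (fun l => is_lub E l)).
  destruct (completeness E HB HE) as [l Hl]; now exists l.
Qed.

Lemma bounded_opp n T M (u : vec n -> R -> R) : bounded_on T M u -> bounded_on T M (fun x t => - u x t).
Proof. intros H x t Ht. rewrite Rabs_Ropp. auto. Qed.

Lemma unif_cont_opp n T (u : vec n -> R -> R) : unif_cont T u -> unif_cont T (fun x t => - u x t).
Proof.
  intros H eta Heta. destruct (H eta Heta) as [d [Hd K]]. exists d; split; auto.
  intros x t y s Ht Hs H1 H2. replace (- u y s - - u x t) with (- (u y s - u x t)) by ring.
  rewrite Rabs_Ropp. auto.
Qed.

(** * Properties of the sup-convolution *)

Section SupConv.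
Variables (n : nat) (T M kap : R) (u : vec n -> R -> R).
Hypotheses (Hk : 0 < kap) (HM : 0 <= M) (Hb : bounded_on T M u).

Lemma supconv_lub y t : 0 <= t <= T ->
  is_lub (fun v => exists z, v = u (vadd y z) t - kap * dot z z) (supconv kap u y t).
Proof.
  intros Ht. apply supR_lub.
  - exists M. intros v [z ->]. pose proof (Rabs_le_both _ _ (Hb (vadd y z) t Ht)). pose proof (dot_ge0 _ z). nra.
  - exists (u (vadd y (fun _ => 0)) t - kap * dot (fun _ : Fin.t n => 0) (fun _ => 0)), (fun _ => 0). reflexivity.
Qed.

Lemma supconv_ge y t z : 0 <= t <= T -> u (vadd y z) t - kap * dot z z <= supconv kap u y t.
Proof. intros Ht. apply (supconv_lub y t Ht). now exists z. Qed.

Lemma supconv_ge_u y t : 0 <= t <= T -> u y t <= supconv kap u y t.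
Proof. intros Ht. pose proof (supconv_ge y t (fun _ => 0) Ht) as H. rewrite vadd_0, dot_0_l in H. lra. Qed.

Lemma supconv_bounded : bounded_on T M (supconv kap u).
Proof.
  intros y t Ht. apply Rabs_le; split.
  - pose proof (supconv_ge_u y t Ht). pose proof (Rabs_le_both _ _ (Hb y t Ht)). lra.
  - apply (supconv_lub y t Ht). intros v [z ->].
    pose proof (Rabs_le_both _ _ (Hb (vadd y z) t Ht)). pose proof (dot_ge0 _ z). nra.
Qed.

Lemma supconv_unif_cont : unif_cont T u -> unif_cont T (supconv kap u).
Proof.
  intros Hc eta He. destruct (Hc (eta / 2) ltac:(lra)) as [del [Hdel K]]. exists del; split; auto.
  assert (HH : forall x t y s, 0 <= t <= T -> 0 <= s <= T -> vnorm (vsub y x) < del -> Rabs (s - t) < del ->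
    supconv kap u y s <= supconv kap u x t + eta / 2).
  { intros x t y s Ht Hs H1 H2. apply (supconv_lub y s Hs). intros v [z ->].
    pose proof (supconv_ge x t z Ht).
    assert (Hz : vnorm (vsub (vadd y z) (vadd x z)) < del).
    { replace (vsub (vadd y z) (vadd x z)) with (vsub y x) by vec_ring. auto. }
    specialize (K (vadd x z) t (vadd y z) s Ht Hs Hz H2). apply Rabs_def2 in K. lra. }
  intros x t y s Ht Hs H1 H2.
  pose proof (HH x t y s Ht Hs H1 H2).
  pose proof (HH y s x t Hs Ht ltac:(rewrite vnorm_sub_sym; auto) ltac:(rewrite Rabs_minus_sym; auto)).
  apply Rabs_def1; lra.
Qed.

Lemma supconv_objective_cont y z s eta : unif_cont T u -> 0 <= s <= T -> 0 < eta ->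
  exists del, 0 < del /\ forall z' s', 0 <= s' <= T -> vnorm (vsub z' z) < del -> Rabs (s' - s) < del ->
    u (vadd y z') s' - kap * dot z' z' < u (vadd y z) s - kap * dot z z + eta.
Proof.
  intros Hc Hs He. destruct (Hc (eta / 2) ltac:(lra)) as [del [Hdel K]].
  destruct (quad_cont n (fun _ => 0) 0 0 kap z (eta / 2) ltac:(lra)) as [del2 [Hdel2 K2]].
  exists (Rmin del del2); split; [now apply Rmin_pos|].
  intros z' s' Hs' H1 H2. Rmin_bounds. specialize (K2 z' ltac:(lra)).
  assert (Hz : vnorm (vsub (vadd y z') (vadd y z)) < del).
  { replace (vsub (vadd y z') (vadd y z)) with (vsub z' z) by vec_ring. lra. }
  specialize (K (vadd y z) s (vadd y z') s' Hs Hs' Hz ltac:(lra)).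
  unfold quad in K2. rewrite !dot_0_l in K2. apply Rabs_def2 in K, K2. lra.
Qed.

(** Beyond this radius [kap |z|^2 >= kap |z| > 2 M], more than [u] can gain; hence all maximisers
    lie in one fixed ball. *)
Lemma supconv_objective_far y t z : 0 <= t <= T -> 1 + 2 * M / kap < vnorm z ->
  u (vadd y z) t - kap * dot z z < u y t.
Proof.
  intros Ht Hw.
  pose proof (Rabs_le_both _ _ (Hb (vadd y z) t Ht)). pose proof (Rabs_le_both _ _ (Hb y t Ht)).
  assert (0 <= 2 * M / kap) by (apply Rle_mult_inv_pos; lra).
  assert (kap * (1 + 2 * M / kap) = kap + 2 * M) by (field; lra).
  rewrite <- (vnorm_sq _ z). assert (vnorm z <= vnorm z * vnorm z) by nra.
  assert (kap * (1 + 2 * M / kap) < kap * vnorm z) by (apply Rmult_lt_compat_l; auto).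
  assert (kap * vnorm z <= kap * (vnorm z * vnorm z)) by (apply Rmult_le_compat_l; lra). lra.
Qed.

Lemma supconv_attained y t : 0 <= t <= T -> unif_cont T u ->
  exists z, supconv kap u y t = u (vadd y z) t - kap * dot z z.
Proof.
  intros Ht Hc.
  set (Rb := 1 + 2 * M / kap).
  assert (HRb : 1 <= Rb) by (unfold Rb; assert (0 <= 2 * M / kap) by (apply Rle_mult_inv_pos; lra); lra).
  destruct (extreme_value_t n (fun z s => u (vadd y z) s - kap * dot z z) (fun _ => 0) Rb t t) as [z [s [Hz [Hs Hmax]]]]; try lra.
  { intros z s _ Hs eta He.
    destruct (supconv_objective_cont y z s eta Hc ltac:(lra) He) as [del [Hdel K]].
    exists del; split; auto. intros z' s' Hs'. apply K; lra. }
  assert (s = t) as -> by lra.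
  exists z. apply Rle_antisym; [|now apply supconv_ge].
  apply (supconv_lub y t Ht). intros v [w ->].
  destruct (Rle_dec (vnorm w) Rb) as [Hw|Hw].
  - apply (Hmax w t); [|lra]. replace (vsub w (fun _ => 0)) with w; auto.
    vec_ring.
  - assert (A := Hmax (fun _ => 0) t ltac:(rewrite vsub_self, vnorm_0; lra) ltac:(lra)). simpl in A.
    rewrite dot_0_l, vadd_0 in A.
    pose proof (supconv_objective_far y t w Ht ltac:(unfold Rb in *; lra)). lra.
Qed.

Lemma supconv_translate c y t : (forall x, u (vadd x c) t = u x t) ->
  supconv kap u (vadd y c) t = supconv kap u y t.
Proof.
  intros H. unfold supconv. f_equal. extensionality w. f_equal. extensionality z.
  rewrite <- (H (vadd y z)).
  replace (vadd (vadd y c) z) with (vadd (vadd y z) c); auto.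
  vec_ring.
Qed.

(** Using [z - h] as competitor at [y + h] shows that the sup-convolution lies above a paraboloid of
    gradient [2 kap z] touching it at [y]. Any smooth function touching from above must share this
    gradient, so the maximiser is determined by [g]. *)
Lemma supconv_gradient y t z g C r : 0 <= t <= T -> 0 < r ->
  supconv kap u y t = u (vadd y z) t - kap * dot z z ->
  (forall h, vnorm h < r -> supconv kap u (vadd y h) t <= supconv kap u y t + dot g h + C * dot h h) ->
  g = vscal (2 * kap) z.
Proof.
  intros Ht Hr Hz H.
  set (w := vsub (vscal (2 * kap) z) g).
  assert (Hw : dot w w <= 0).
  { pose proof (vnorm_ge0 _ w).
    apply (le_0_of_small _ ((C + kap) * dot w w) (r / (vnorm w + 1))); [apply Rdiv_lt_0_compat; lra|].
    intros s [Hs0 Hs].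
    assert (Hn : vnorm (vscal s w) < r).
    { rewrite vnorm_scal, Rabs_right by lra. replace r with (r / (vnorm w + 1) * (vnorm w + 1)) by (field; lra). nra. }
    specialize (H _ Hn).
    pose proof (supconv_ge (vadd y (vscal s w)) t (vsub z (vscal s w)) Ht) as L.
    replace (vadd (vadd y (vscal s w)) (vsub z (vscal s w))) with (vadd y z) in L by vec_ring.
    rewrite dot_sub_l, !dot_sub_r, !dot_scal_r, !dot_scal_l, (dot_sym _ w z) in *.
    assert (E : dot w w = 2 * kap * dot z w - dot g w) by (unfold w at 1; rewrite dot_sub_l, dot_scal_l; ring).
    assert (s * dot w w <= (C + kap) * dot w w * s * s) by nra.
    apply Rmult_le_reg_l with s; lra. }
  pose proof (dot_ge0 _ w).
  extensionality i. pose proof (dot_self_eq0 _ w ltac:(lra) i) as E. unfold w, vsub in E. lra.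
Qed.

(** The paraboloid from below fixes the gradient and bounds the Hessian from below. The differential
    inequality holds because the test function, shifted by [z], touches [u] from above at [vadd y z]
    with the same gradient, Hessian and time. *)
Lemma supconv_test a b y t z g X d C r : visc_sub T a b u -> 0 < t < T -> symm X -> 0 < r ->
  supconv kap u y t = u (vadd y z) t - kap * dot z z ->
  (forall h k, vnorm h < r -> Rabs k < r ->
     supconv kap u (vadd y h) (t + k) <= supconv kap u y t + dot g h + quadform X h / 2 + d * k + C * (k * k)) ->
  g = vscal (2 * kap) z /\ (forall v, - (2 * kap) * dot v v <= quadform X v) /\
  d <= frob (fun i j => a i j g t) X + b g t.
Proof.
  intros Hu Ht HX Hr Hz H.
  assert (H0 : forall h, vnorm h < r -> supconv kap u (vadd y h) t <= supconv kap u y t + dot g h + quadform X h / 2).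
  { intros h Hh. specialize (H h 0 Hh ltac:(rewrite Rabs_R0; auto)). rewrite Rplus_0_r in H. lra. }
  assert (Hg : g = vscal (2 * kap) z).
  { destruct (quadform_bound n X) as [Q [HQ HQ']].
    apply (supconv_gradient y t z g (Q / 2) r); auto; try lra.
    intros h Hh. specialize (H0 h Hh). specialize (HQ' h). apply Rabs_le_both in HQ'. lra. }
  split; auto; split.
  - intros v. pose proof (vnorm_ge0 _ v).
    set (s := r / (2 * (vnorm v + 1))). assert (Hs : 0 < s) by (apply Rdiv_lt_0_compat; lra).
    assert (Hn : vnorm (vscal s v) < r).
    { rewrite vnorm_scal, Rabs_right by lra. assert (s * (vnorm v + 1) = r / 2) by (unfold s; field; lra). nra. }
    specialize (H0 _ Hn).
    pose proof (supconv_ge (vadd y (vscal s v)) t (vsub z (vscal s v)) ltac:(lra)) as L.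
    replace (vadd (vadd y (vscal s v)) (vsub z (vscal s v))) with (vadd y z) in L by vec_ring.
    rewrite Hg, quadform_scal, dot_scal_l in H0.
    rewrite dot_sub_l, !dot_sub_r, !dot_scal_r, !dot_scal_l, (dot_sym _ v z) in *.
    assert (0 < s * s) by nra. nra.
  (* The smaller radius keeps [t + k] inside [[0, T]], where [supconv_ge] is available. *)
  - set (r' := Rmin r (Rmin t (T - t))).
    assert (Hr' : 0 < r') by (repeat apply Rmin_pos; lra).
    assert (r' <= r) by apply Rmin_l.
    assert (r' <= t) by (eapply Rle_trans; [apply Rmin_r | apply Rmin_l]).
    assert (r' <= T - t) by (eapply Rle_trans; [apply Rmin_r | apply Rmin_r]).
    apply (visc_sub_quad n T a b u (vadd y z) t g X d C r'); auto.
    intros h k Hh Hkr; specialize (H h k ltac:(lra) ltac:(lra)).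
    apply Rabs_def2 in Hkr.
    pose proof (supconv_ge (vadd y h) (t + k) z ltac:(lra)) as L.
    replace (vadd (vadd y h) z) with (vadd (vadd y z) h) in L by vec_ring.
    lra.
Qed.

(** A unique maximiser depends continuously on the base point. Through [supconv_gradient] this
    becomes continuity of the gradients of test functions, which is what freezing the coefficients
    requires. *)
Lemma supconv_argmax_cont y0 t0 z0 : 0 <= t0 <= T -> unif_cont T u ->
  (forall z, supconv kap u y0 t0 = u (vadd y0 z) t0 - kap * dot z z -> z = z0) ->
  forall eta, 0 < eta -> exists del, 0 < del /\ forall y t z, 0 <= t <= T ->
    vnorm (vsub y y0) < del -> Rabs (t - t0) < del ->
    supconv kap u y t = u (vadd y z) t - kap * dot z z -> vnorm (vsub z z0) < eta.
Proof.
  intros Ht0 Hc Huniq eta He.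
  set (Rb := 1 + 2 * M / kap).
  assert (Hopt : forall y t z, 0 <= t <= T -> supconv kap u y t = u (vadd y z) t - kap * dot z z -> vnorm z <= Rb).
  { intros y t z Ht Hz. apply Rnot_lt_le; intros Hlt.
    pose proof (supconv_ge_u y t Ht). pose proof (supconv_objective_far y t z Ht Hlt). lra. }
  set (D := fun (z w : vec n) (s : R) => vnorm z <= Rb /\ w = (fun _ => 0) /\ s = 0 /\ eta <= vnorm (vsub z z0)).
  destruct (classic (exists z w s, D z w s)) as [HD|HD].
  2: { exists 1; split; [lra|]. intros y t z Ht _ _ Hz. apply Rnot_le_lt; intros Hle. apply HD.
       exists z, (fun _ => 0), 0. repeat split; auto. eapply Hopt; eauto. }
  destruct (extreme_value n D (fun z _ _ => u (vadd y0 z) t0 - kap * dot z z) Rb HD) as [zm [wm [sm [Hm Hmax]]]].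
  - intros z w s [H1 [-> [-> H2]]]. rewrite vnorm_0, Rabs_R0. pose proof (vnorm_ge0 _ z). lra.
  - intros zs ws ss z w s Hz Hw Hs HDs. repeat split.
    + apply (vcv_norm_le n zs z Rb Hz); intros k; apply HDs.
    + extensionality i.
      assert (Hn : vnorm w <= 0).
      { apply (vcv_norm_le n ws w 0 Hw); intros k. destruct (HDs k) as [_ [-> _]]; rewrite vnorm_0; lra. }
      pose proof (vnorm_comp _ w i). destruct (Req_dec (w i) 0) as [|N]; auto. apply Rabs_pos_lt in N; lra.
    + destruct (Un_cv_bounds ss s 0 0 Hs); [|lra]. intros k. destruct (HDs k) as [_ [_ [-> _]]]; lra.
    + apply le_epsilon; intros eps Heps. destruct (Hz eps Heps) as [N HN]. specialize (HN N (Nat.le_refl _)).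
      destruct (HDs N) as [_ [_ [_ H2]]]. pose proof (vnorm_sub_triang _ (zs N) z z0). lra.
  - intros z w s _ eps Heps.
    destruct (supconv_objective_cont y0 z t0 eps Hc Ht0 Heps) as [del [Hdel K]].
    exists del; split; auto. intros z' w' s' _ H1 _ _. apply K; auto. now rewrite Rminus_diag, Rabs_R0.
  - destruct Hm as [Hm1 [_ [_ Hm2]]].
    (* The loss suffered by the best competitor at distance at least [eta] from [z0]. It is positive
       by uniqueness, and perturbing [u] and its sup-convolution by [gap / 3] each cannot close
       it. *)
    set (gap := supconv kap u y0 t0 - (u (vadd y0 zm) t0 - kap * dot zm zm)).
    assert (Hgap : 0 < gap).
    { pose proof (supconv_ge y0 t0 zm Ht0). destruct (Req_dec gap 0) as [E|E]; [|unfold gap in *; lra].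
      exfalso. assert (zm = z0) as Ez by (apply Huniq; unfold gap in E; lra).
      rewrite Ez, vsub_self, vnorm_0 in Hm2. lra. }
    destruct (Hc (gap / 3) ltac:(lra)) as [d1 [Hd1 K1]].
    destruct (supconv_unif_cont Hc (gap / 3) ltac:(lra)) as [d2 [Hd2 K2]].
    exists (Rmin d1 d2); split; [now apply Rmin_pos|].
    intros y t z Ht Hy Htt Hz. apply Rnot_le_lt; intros Hle.
    Rmin_bounds.
    assert (HDz : D z (fun _ => 0) 0) by (repeat split; auto; eapply Hopt; eauto).
    specialize (Hmax _ _ _ HDz). simpl in Hmax.
    assert (Hzz : vnorm (vsub (vadd y z) (vadd y0 z)) < d1).
    { replace (vsub (vadd y z) (vadd y0 z)) with (vsub y y0) by vec_ring. lra. }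
    specialize (K1 (vadd y0 z) t0 (vadd y z) t Ht0 Ht Hzz ltac:(lra)).
    specialize (K2 y0 t0 y t Ht0 Ht ltac:(lra) ltac:(lra)).
    apply Rabs_def2 in K1, K2. unfold gap in *. lra.
Qed.

End SupConv.

(** For [kap >= (2 M + 1) / del^2] a displacement of length at least [del] costs more than the
    oscillation of [u]; shorter ones gain at most [eta] by uniform continuity. *)
Lemma supconv_close n T M (u : vec n -> R -> R) : 0 <= M -> bounded_on T M u -> unif_cont T u ->
  forall eta, 0 < eta -> exists k0, 0 < k0 /\ forall kap, k0 <= kap -> forall y t, 0 <= t <= T ->
    supconv kap u y t <= u y t + eta.
Proof.
  intros HM Hb Hc eta He. destruct (Hc eta He) as [del [Hdel K]].
  assert (Hk0 : 0 < (2 * M + 1) / (del * del)) by (apply Rdiv_lt_0_compat; nra).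
  exists ((2 * M + 1) / (del * del)); split; auto.
  intros kap Hkap y t Ht.
  apply (supconv_lub n T M kap u ltac:(lra) Hb y t Ht). intros v [z ->].
  pose proof (dot_ge0 _ z) as Hz.
  destruct (Rlt_dec (vnorm z) del) as [Hd|Hd].
  - specialize (K y t (vadd y z) t Ht Ht). rewrite vsub_vadd, Rminus_diag, Rabs_R0 in K.
    specialize (K Hd Hdel). apply Rabs_def2 in K. nra.
  - pose proof (Rabs_le_both _ _ (Hb (vadd y z) t Ht)). pose proof (Rabs_le_both _ _ (Hb y t Ht)).
    rewrite <- vnorm_sq in *. assert (del * del <= vnorm z * vnorm z) by nra.
    assert (E : (2 * M + 1) / (del * del) * (del * del) = 2 * M + 1) by (field; lra).
    assert (2 * M + 1 <= kap * (vnorm z * vnorm z)).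
    { rewrite <- E. apply Rmult_le_compat; nra. }
    lra.
Qed.

(** * Freezing the coefficients *)

Lemma fin_common_radius n (P : Fin.t n -> R -> Prop) :
  (forall i, exists d, 0 < d /\ forall r, r <= d -> P i r) -> exists d, 0 < d /\ forall i r, r <= d -> P i r.
Proof.
  induction n; intros H.
  - exists 1; split; [lra | intros i; inversion i].
  - destruct (H Fin.F1) as [d1 [Hd1 H1]].
    destruct (IHn (fun i => P (Fin.FS i)) (fun i => H (Fin.FS i))) as [d2 [Hd2 H2]].
    exists (Rmin d1 d2); split; [now apply Rmin_pos|].
    Rmin_bounds.
    apply (fin_case n (fun i => forall r, r <= Rmin d1 d2 -> P i r)).
    + intros r Hr; apply H1; lra.
    + intros i r Hr; apply H2; lra.
Qed.

Lemma cont_near n T (f : vec n -> R -> R) p t0 eta : cont_strip T f -> 0 <= t0 <= T -> 0 < eta ->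
  exists d, 0 < d /\ forall r, r <= d -> forall g t, 0 <= t <= T -> vnorm (vsub g p) < r -> Rabs (t - t0) < r ->
    Rabs (f g t - f p t0) <= eta.
Proof.
  intros Hf Ht He. destruct (Hf p t0 Ht eta He) as [d [Hd H]].
  exists (d / 2); split; [lra|]. intros r Hr g t Htt H1 H2. apply Rlt_le, H; auto. unfold dist_nt; lra.
Qed.

Lemma coef_near n T (a : Fin.t n -> Fin.t n -> vec n -> R -> R) (b : vec n -> R -> R) p t0 eta :
  (forall i j, cont_strip T (a i j)) -> cont_strip T b ->
  0 <= t0 <= T -> 0 < eta ->
  exists r, 0 < r /\ forall g t, 0 <= t <= T -> vnorm (vsub g p) < r -> Rabs (t - t0) < r ->
    (forall i j, Rabs (a i j g t - a i j p t0) <= eta) /\ Rabs (b g t - b p t0) <= eta.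
Proof.
  intros Ha Hb Ht He.
  destruct (cont_near n T b p t0 eta Hb Ht He) as [d1 [Hd1 H1]].
  destruct (fin_common_radius n (fun i r => forall j g t, 0 <= t <= T -> vnorm (vsub g p) < r -> Rabs (t - t0) < r ->
    Rabs (a i j g t - a i j p t0) <= eta)) as [d2 [Hd2 H2]].
  { intros i. destruct (fin_common_radius n (fun j r => forall g t, 0 <= t <= T -> vnorm (vsub g p) < r -> Rabs (t - t0) < r ->
      Rabs (a i j g t - a i j p t0) <= eta)) as [d [Hd H]].
    - intros j. apply cont_near; auto.
    - exists d; split; auto. intros r Hr j; now apply H. }
  exists (Rmin d1 d2); split; [now apply Rmin_pos|].
  Rmin_bounds.
  intros g t Htt Hg Htr. split.
  - intros i j. apply (H2 i (Rmin d1 d2)); auto.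
  - apply (H1 (Rmin d1 d2)); auto.
Qed.

(** Since [X + 2 kap I] is nonnegative, [tr (a X)] grows at most by [O(nu)] when
    [a] is replaced by the larger frozen matrix [a0 + nu I]. *)
Lemma frob_freeze n (a a0 : mat n) X nu kap : symm a -> symm a0 -> 0 < nu -> 0 <= kap ->
  (forall i j, Rabs (a i j - a0 i j) <= nu / (INR n + 1)) ->
  (forall v, - (2 * kap) * dot v v <= quadform X v) ->
  frob a X <= frob (fun i j => a0 i j + nu * idm i j) X + 4 * kap * INR n * nu.
Proof.
  intros Sa Sa0 Hnu Hkap Hclose HX.
  pose proof (pos_INR n) as Hn.
  set (P := fun i j => (a0 i j + nu * idm i j) + (-1) * a i j).
  assert (SP : symm P) by (intros i j; unfold P; rewrite (Sa i j), (Sa0 i j), (idm_sym _ i j); auto).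
  assert (Hle : nu / (INR n + 1) <= nu).
  { assert (E : nu / (INR n + 1) * (INR n + 1) = nu) by (field; lra).
    assert (0 < nu / (INR n + 1)) by (apply Rdiv_lt_0_compat; lra). nra. }
  assert (HP : forall v, 0 <= quadform P v).
  { intros v. unfold P. rewrite !quadform_plus, quadform_idm.
    pose proof (quadform_small n (fun i j => a i j + (-1) * a0 i j) (nu / (INR n + 1)) v) as Q.
    assert (Q0 : forall i j, Rabs (a i j + (-1) * a0 i j) <= nu / (INR n + 1)).
    { intros i j. replace (a i j + -1 * a0 i j) with (a i j - a0 i j) by ring; auto. }
    assert (Q' := Q Q0).
    rewrite quadform_plus in Q'. apply Rabs_le_both in Q'.
    assert (INR n * (nu / (INR n + 1)) <= nu).
    { replace (INR n * (nu / (INR n + 1))) with (nu * (1 - / (INR n + 1))) by (field; lra).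
      assert (0 < / (INR n + 1)) by (apply Rinv_0_lt_compat; lra). nra. }
    pose proof (dot_ge0 _ v). nra. }
  pose proof (frob_psd_nonneg n P (fun i j => X i j + (2 * kap) * idm i j) SP HP) as K.
  assert (K0 : forall v, 0 <= quadform (fun i j => X i j + (2 * kap) * idm i j) v)
    by (intros v; rewrite quadform_plus, quadform_idm; specialize (HX v); lra).
  assert (K' := K K0).
  rewrite frob_plus_r, (frob_sym _ P idm), frob_idm in K'.
  (* Each diagonal entry of [P] is at most [2 * nu]; pairing [P] with [2 kap I] produces the error
     [4 * kap * INR n * nu]. *)
  assert (Htr : fsum n (fun i => P i i) <= INR n * (2 * nu)).
  { rewrite <- fsum_const. apply fsum_le; intros i. unfold P.
    specialize (Hclose i i). apply Rabs_le_both in Hclose.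
    assert (idm i i = 1) as -> by (unfold idm, unitv; destruct (Fin.eq_dec i i); congruence). lra. }
  unfold P in K' at 1. rewrite frob_plus_l in K'. nra.
Qed.

Lemma Rmax_sq_O2 L h tau : 0 <= L ->
  O2 (fun t => L * (Rmax 0 (t - h) * Rmax 0 (t - h))) tau (2 * L * Rmax 0 (tau - h)).
Proof.
  intros HL. exists L, 1. repeat split; try lra. intros s _.
  assert (Rabs (Rmax 0 (tau + s - h) * Rmax 0 (tau + s - h) - Rmax 0 (tau - h) * Rmax 0 (tau - h) - 2 * Rmax 0 (tau - h) * s) <= s * s).
  { unfold Rmax. destruct (Rle_dec 0 (tau + s - h)), (Rle_dec 0 (tau - h)); apply Rabs_le; split; nra. }
  replace (L * (Rmax 0 (tau + s - h) * Rmax 0 (tau + s - h)) - L * (Rmax 0 (tau - h) * Rmax 0 (tau - h)) - 2 * L * Rmax 0 (tau - h) * s)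
   with (L * (Rmax 0 (tau + s - h) * Rmax 0 (tau + s - h) - Rmax 0 (tau - h) * Rmax 0 (tau - h) - 2 * Rmax 0 (tau - h) * s)) by ring.
  rewrite Rabs_mult, (Rabs_right L) by lra. now apply Rmult_le_compat_l.
Qed.

Lemma O2_add f g b a c : O2 f b a -> O2 g b c -> O2 (fun t => f t + g t) b (a + c).
Proof.
  intros [C1 [r1 [Hr1 [HC1 K1]]]] [C2 [r2 [Hr2 [HC2 K2]]]].
  exists (C1 + C2), (Rmin r1 r2). split; [now apply Rmin_pos|]. split; [lra|]. intros s Hs.
  Rmin_bounds.
  specialize (K1 s ltac:(lra)). specialize (K2 s ltac:(lra)).
  replace (f (b + s) + g (b + s) - (f b + g b) - (a + c) * s) with ((f (b + s) - f b - a * s) + (g (b + s) - g b - c * s)) by ring.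
  eapply Rle_trans; [apply Rabs_triang|]. lra.
Qed.

Lemma frob_lap n dirs (a0 X : mat n) :
  (forall i j, a0 i j = rank1_sum dirs i j) -> frob a0 X = lap dirs X.
Proof.
  intros H. rewrite <- frob_rank1_sum. f_equal. extensionality i; extensionality j; apply H.
Qed.

(** Short-time comparison: a caloric [H] that dominates the sup-convolution on a small ball at time
    [t0 - h] dominates it at [(y0, t0)] up to the source [b], an error of order [nu * h], and
    [C * h^2], the value of the barrier at its centre. [C] and [h0] are fixed before [H] and [eta],
    so [H] may be adapted to [h]. *)
Lemma supconv_le_caloric n T a b (u : vec n -> R -> R) kap M y0 t0 p nu dirs :
  0 < t0 < T -> 0 < kap -> 0 <= M -> bounded_on T M u -> unif_cont T u ->
  (forall i j, cont_strip T (a i j)) -> cont_strip T b ->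
  (forall p t, 0 <= t <= T -> symm (fun i j => a i j p t)) ->
  visc_sub T a b u -> 0 < nu ->
  (exists C r, 0 < r /\ forall h, vnorm h < r ->
     supconv kap u (vadd y0 h) t0 <= supconv kap u y0 t0 + dot p h + C * dot h h) ->
  (forall i j, a i j p t0 + nu * idm i j = rank1_sum dirs i j) ->
  exists rho0, 0 < rho0 /\ forall rho, 0 < rho <= rho0 -> exists C h0, 0 <= C /\ 0 < h0 /\
    forall h eta H, 0 < h < h0 -> Caloric dirs H ->
      (forall y tau, 0 <= tau -> Rabs (H y tau) <= M) ->
      (forall y, vnorm (vsub y y0) <= rho -> supconv kap u y (t0 - h) - H y 0 <= eta) -> 0 <= eta ->
      supconv kap u y0 t0 <= H y0 h + eta + (b p t0 + (4 * kap * INR n + 2) * nu) * h + C * (h * h).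
Proof.
  intros Ht0 Hkap HM Hbd Huc Ha Hb Hsym Hsub Hnu [Ct [rt [Hrt Htouch]]] Hdirs.
  pose proof (pos_INR n) as Hn.
  destruct (coef_near n T a b p t0 (nu / (INR n + 1)) Ha Hb ltac:(lra) ltac:(apply Rdiv_lt_0_compat; lra)) as [r1 [Hr1 Hnear]].
  assert (Hle : nu / (INR n + 1) <= nu).
  { assert (E : nu / (INR n + 1) * (INR n + 1) = nu) by (field; lra).
    assert (0 < nu / (INR n + 1)) by (apply Rdiv_lt_0_compat; lra). nra. }
  (* The touching hypothesis makes this the only maximiser at [(y0, t0)], by [supconv_gradient];
     continuity of maximisers then confines the gradients met below to the [r1]-neighbourhood of
     [p]. *)
  set (z0 := vscal (/ (2 * kap)) p).
  assert (Hopt0 : forall z, supconv kap u y0 t0 = u (vadd y0 z) t0 - kap * dot z z -> z = z0).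
  { intros z Hz. unfold z0.
    rewrite (supconv_gradient n T M kap u Hkap Hbd y0 t0 z p Ct rt ltac:(lra) Hrt Hz Htouch).
    extensionality i; unfold vscal; field; lra. }
  destruct (supconv_argmax_cont n T M kap u Hkap HM Hbd y0 t0 z0 ltac:(lra) Huc Hopt0 (r1 / (2 * kap))
    ltac:(apply Rdiv_lt_0_compat; lra)) as [d1 [Hd1 Hargmax]].
  exists (d1 / 2); split; [lra|]. intros rho [Hrho Hrho1].
  destruct (bar_center n dirs y0) as [Cc [HCc HCc']].
  set (c := b p t0 + (4 * kap * INR n + 2) * nu).
  pose proof (Rabs_pos c) as Hc.
  (* At distance [rho] the barrier must exceed the difference of the sup-convolution and [H], at
     most [2 * M], plus the possible negative part of [c * tau], at most [2 * |c|] since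
     [tau <= 2 * h < 2]. *)
  set (Cb := (2 * M + 2 * Rabs c) * (INR n + 1) / (rho * rho * (rho * rho))).
  assert (Hr4 : 0 < rho * rho * (rho * rho)) by (repeat apply Rmult_lt_0_compat; auto).
  assert (HCb : 0 <= Cb) by (apply Rle_mult_inv_pos; nra).
  set (h0 := Rmin 1 (Rmin (Rmin d1 r1) (Rmin t0 (T - t0)))).
  assert (Hh0 : 0 < h0) by (repeat apply Rmin_pos; lra).
  exists (Cb * Cc), h0. split; [nra|]. split; auto.
  intros h eta H [Hh Hhh0] HC HHM Hinit Heta.
  assert (Hh1 : h < 1 /\ h < d1 /\ h < r1 /\ h < t0 /\ h < T - t0).
  { unfold h0 in *. Rmin_bounds. repeat split; lra. }
  (* Chosen so that [lam (2 * h) = 2 * M + 2 * h * |c|], which excludes a positive maximum at the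
     final time. *)
  set (L := (2 * M + 2 * h * Rabs c) / (h * h)).
  assert (HL : 0 <= L) by (apply Rle_mult_inv_pos; nra).
  assert (HLh : L * (h * h) = 2 * M + 2 * h * Rabs c) by (unfold L; field; lra).
  (* Viscosity test points need a two-sided time neighbourhood: [lam] vanishes up to
     time [h] and keeps the maximum away from the end [2 h] of the time interval. *)
  set (lam := fun t => L * (Rmax 0 (t - h) * Rmax 0 (t - h))).
  set (Psi := fun y t => (H y t + Cb * bar dirs y0 y t) + 1 * ((eta + c * t) + lam t)).
  set (G := fun y tau => supconv kap u y (t0 - h + tau) - Psi y tau).
  assert (HUb := supconv_bounded n T M kap u Hkap Hbd).
  assert (HJ : forall y tau, exists g X, symm X /\ Jet Psi y tau g X (lap dirs X + c + 2 * L * Rmax 0 (tau - h))).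
  { intros y tau.
    destruct (Caloric_add n dirs H (bar dirs y0) Cb HC (Caloric_bar n dirs y0) y tau) as [g [X [SX J]]].
    exists (vadd g (vscal 1 (fun _ => 0))), (fun i j => X i j + 1 * 0). split.
    - intros i j. now rewrite (SX i j).
    - assert (O : O2 (fun t => (eta + c * t) + lam t) tau ((0 + c) + 2 * L * Rmax 0 (tau - h))).
      { apply (O2_add (fun t => eta + c * t) lam); [apply (O2_add (fun _ => eta) (fun t => c * t)); [apply O2_const | apply O2_id]|].
        now apply Rmax_sq_O2. }
      pose proof (Jet_add _ _ _ _ _ _ _ _ _ _ _ 1 J (Jet_time n _ y tau _ O)) as J'.
      rewrite (lap_plus n dirs X (fun _ _ => 0)), lap_0.
      replace (lap dirs X + 1 * 0 + c + 2 * L * Rmax 0 (tau - h)) with (lap dirs X + 1 * (0 + c + 2 * L * Rmax 0 (tau - h))) by ring.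
      exact J'. }
  assert (Hlam0 : forall tau, 0 <= lam tau) by (intros tau; unfold lam; pose proof (Rle_0_sqr (Rmax 0 (tau - h))); unfold Rsqr in *; nra).
  assert (HUH : forall y tau, 0 <= tau <= 2 * h -> supconv kap u y (t0 - h + tau) - H y tau <= 2 * M).
  { intros y tau Htau. pose proof (Rabs_le_both _ _ (HUb y (t0 - h + tau) ltac:(lra))).
    pose proof (Rabs_le_both _ _ (HHM y tau ltac:(lra))). lra. }
  assert (Hbar : forall y tau, 0 <= tau -> 0 <= Cb * bar dirs y0 y tau).
  { intros y tau Htau. pose proof (bar_nonneg n dirs y0 y tau Htau). nra. }
  assert (Hcabs : forall tau, 0 <= tau -> - (Rabs c * tau) <= c * tau).
  { intros tau Htau. pose proof (Rle_abs (- c)) as A. rewrite Rabs_Ropp in A. nra. }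
  assert (Hout : forall y tau, 0 <= tau <= 2 * h -> rho <= vnorm (vsub y y0) -> G y tau <= 0).
  { intros y tau Htau Hy. pose proof (bar_ge_radius n dirs y0 y tau rho ltac:(lra) ltac:(lra) Hy) as B.
    assert (2 * M + 2 * Rabs c <= Cb * bar dirs y0 y tau).
    { replace (2 * M + 2 * Rabs c) with (Cb * (rho * rho * (rho * rho) / (INR n + 1))) by (unfold Cb; field; lra).
      apply Rmult_le_compat_l; auto. apply Rmult_le_reg_r with (INR n + 1); [lra|].
      replace (rho * rho * (rho * rho) / (INR n + 1) * (INR n + 1)) with (rho * rho * (rho * rho)) by (field; lra). lra. }
    specialize (HUH y tau Htau). specialize (Hlam0 tau). specialize (Hcabs tau ltac:(lra)).
    unfold G, Psi. assert (Rabs c * tau <= 2 * Rabs c) by nra. lra. }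
  enough (HG : G y0 h <= 0).
  { unfold G, Psi in HG. replace (t0 - h + h) with t0 in HG by ring. rewrite HCc' in HG.
    assert (lam h = 0) as E by (unfold lam; rewrite Rminus_diag, Rmax_left by lra; ring). rewrite E in HG.
    fold c. nra. }
  apply Rnot_lt_le; intros HGp.
  destruct (extreme_value_t n G y0 rho 0 (2 * h)) as [y [tau [Hy [Htau Hmax]]]]; try lra.
  { intros y tau _ Htau eps Heps.
    destruct (HJ y tau) as [g [X [_ J]]].
    destruct (Jet_cont _ _ _ _ _ _ _ J (eps / 2) ltac:(lra)) as [e1 [He1 K1]].
    destruct (supconv_unif_cont n T M kap u Hkap Hbd Huc (eps / 2) ltac:(lra)) as [e2 [He2 K2]].
    exists (Rmin e1 e2); split; [now apply Rmin_pos|]. intros y' tau' Htau' Hy' Ht'.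
    Rmin_bounds.
    specialize (K1 y' tau' ltac:(lra) ltac:(lra)).
    specialize (K2 y (t0 - h + tau) y' (t0 - h + tau') ltac:(lra) ltac:(lra) ltac:(lra)).
    replace (t0 - h + tau' - (t0 - h + tau)) with (tau' - tau) in K2 by ring.
    specialize (K2 ltac:(lra)). apply Rabs_def2 in K1, K2. unfold G. lra. }
  assert (HGm : 0 < G y tau).
  { eapply Rlt_le_trans; [exact HGp|]. apply Hmax; [rewrite vsub_self, vnorm_0; lra | lra]. }
  assert (Hglob : forall y' tau', 0 <= tau' <= 2 * h -> G y' tau' <= G y tau).
  { intros y' tau' Ht'. destruct (Rle_dec (vnorm (vsub y' y0)) rho) as [Hl|Hl]; [now apply Hmax|].
    specialize (Hout y' tau' Ht' ltac:(lra)). lra. }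
  assert (Hyr : vnorm (vsub y y0) < rho).
  { apply Rnot_le_lt; intros Hl. specialize (Hout y tau Htau Hl). lra. }
  assert (Ht_pos : 0 < tau).
  { destruct (Req_dec tau 0) as [E|E]; [|lra]. exfalso. rewrite E in HGm. unfold G, Psi in HGm.
    rewrite Rplus_0_r in HGm. specialize (Hinit y ltac:(lra)). specialize (Hlam0 0). specialize (Hbar y 0 ltac:(lra)). lra. }
  assert (Ht_lt : tau < 2 * h).
  { destruct (Req_dec tau (2 * h)) as [E|E]; [|lra]. exfalso. unfold G, Psi in HGm.
    assert (El : lam tau = 2 * M + 2 * h * Rabs c).
    { rewrite <- HLh. unfold lam. rewrite E, Rmax_right by lra. ring. }
    rewrite El in HGm. specialize (HUH y tau Htau). specialize (Hbar y tau ltac:(lra)). specialize (Hcabs tau ltac:(lra)).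
    rewrite E in *. nra. }
  set (t := t0 - h + tau).
  destruct (supconv_attained n T M kap u Hkap HM Hbd y t ltac:(unfold t; lra) Huc) as [z Hz].
  destruct (HJ y tau) as [g [X [SX J]]].
  set (D := lap dirs idm).
  assert (HD : 0 <= D) by (apply lap_nonneg; intros v; rewrite quadform_idm; apply dot_ge0).
  set (del := nu / (4 * (D + 1))).
  assert (Hdel : 0 < del) by (apply Rdiv_lt_0_compat; lra).
  assert (HdelD : 2 * del * D < nu).
  { assert (E : del * (4 * (D + 1)) = nu) by (unfold del; field; lra). nra. }
  destruct (J del Hdel) as [Cj [rj [Hrj [HCj K]]]].
  set (d := lap dirs X + c + 2 * L * Rmax 0 (tau - h)) in *.
  set (r := Rmin rj (Rmin tau (2 * h - tau))).
  assert (Hr : 0 < r) by (repeat apply Rmin_pos; lra).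
  assert (r <= rj) by apply Rmin_l.
  assert (r <= tau) by (eapply Rle_trans; [apply Rmin_r | apply Rmin_l]).
  assert (r <= 2 * h - tau) by (eapply Rle_trans; [apply Rmin_r | apply Rmin_r]).
  destruct (supconv_test n T M kap u Hkap Hbd a b y t z g (fun i j => X i j + (2 * del) * idm i j) d Cj r) as [Hg [HX Hd]]; auto.
  { unfold t; lra. }
  { intros i j. now rewrite (SX i j), (idm_sym _ i j). }
  { intros h' k Hh' Hk. specialize (K h' k ltac:(lra) ltac:(lra)). apply Rabs_le_both in K.
    apply Rabs_def2 in Hk. specialize (Hglob (vadd y h') (tau + k) ltac:(lra)). unfold G in Hglob.
    replace (t0 - h + (tau + k)) with (t + k) in Hglob by (unfold t; ring). fold t in Hglob.
    rewrite quadform_plus, quadform_idm. lra. }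
  (* As [g = 2 kap z] and [p = 2 kap z0], the distance [r1 / (2 kap)] between maximisers becomes
     [r1] between gradients. *)
  assert (Hgp : vnorm (vsub g p) < r1).
  { rewrite Hg. replace (vsub (vscal (2 * kap) z) p) with (vscal (2 * kap) (vsub z z0))
      by (extensionality i; unfold vsub, z0, vscal; field; lra).
    rewrite vnorm_scal, Rabs_right by lra.
    assert (vnorm (vsub z z0) < r1 / (2 * kap)).
    { apply (Hargmax y t z); auto; [unfold t; lra | lra | unfold t; apply Rabs_def1; lra]. }
    replace r1 with (2 * kap * (r1 / (2 * kap))) by (field; lra). apply Rmult_lt_compat_l; lra. }
  destruct (Hnear g t ltac:(unfold t; lra) Hgp ltac:(unfold t; apply Rabs_def1; lra)) as [Hna Hnb].
  pose proof (frob_freeze n (fun i j => a i j g t) (fun i j => a i j p t0) _ nu kap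
    (Hsym g t ltac:(unfold t; lra)) (Hsym p t0 ltac:(lra)) Hnu ltac:(lra) Hna HX) as HF.
  rewrite (frob_lap n dirs (fun i j => a i j p t0 + nu * idm i j) _ Hdirs), lap_plus in HF.
  fold D in HF. apply Rabs_le_both in Hnb.
  assert (0 <= 2 * L * Rmax 0 (tau - h)) by (apply Rmult_le_pos; [lra | apply Rmax_l]).
  unfold d, c in *. lra.
Qed.

Lemma fsum_opp n (f : Fin.t n -> R) : fsum n (fun i => - f i) = - fsum n f.
Proof. rewrite (fsum_ext _ _ (fun i => (-1) * f i)) by (intros; ring). rewrite fsum_scal; ring. Qed.

(** * Doubling the variables *)

(** Changing sign turns the supersolution into a subsolution with coefficients taken at [- p]. The
    inf-convolution of [u] is then minus the sup-convolution of [- u], and every one-sided result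
    applies to both points. *)
Lemma visc_super_opp n T a b (u : vec n -> R -> R) : visc_super T a b u ->
  visc_sub T (fun i j p t => a i j (vopp p) t) (fun p t => - b (vopp p) t) (fun x t => - u x t).
Proof.
  intros Hu Dphi HD x0 t0 Ht [r [Hr Hmax]].
  assert (HD' : smooth_family_nt (par_domain T) (fun l x t => - Dphi l x t)).
  { intros l. destruct (HD l) as [Hc Hd]. split.
    - intros x t Hx eps He. destruct (Hc x t Hx eps He) as [d [Hd0 Hd1]]. exists d; split; auto.
      intros y s Hy Hds. specialize (Hd1 y s Hy Hds).
      replace (- Dphi l y s - - Dphi l x t) with (- (Dphi l y s - Dphi l x t)) by ring. now rewrite Rabs_Ropp.
    - intros x t Hx. destruct (Hd x t Hx) as [H1 H2]. split.
      + intros i. apply (derivable_pt_lim_opp (fun h => Dphi l (vadd x (vscal h (unitv i))) t)), H1.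
      + apply (derivable_pt_lim_opp (fun h => Dphi l x (t + h))), H2. }
  assert (K : - Dphi (None :: nil) x0 t0 + F_op a b t0 (fun i => - Dphi (Some i :: nil) x0 t0)
      (fun i j => - Dphi (Some i :: Some j :: nil) x0 t0) >= 0).
  { apply (Hu _ HD' x0 t0 Ht). exists r; split; auto. intros y s Hys. specialize (Hmax y s Hys). lra. }
  unfold F_op in *. unfold vopp at 1 2.
  rewrite (fsum_ext n (fun i => fsum n (fun j => a i j (fun i0 => - Dphi (Some i0 :: nil) x0 t0) t0 * - Dphi (Some i :: Some j :: nil) x0 t0))
   (fun i => - fsum n (fun j => a i j (fun i0 => - Dphi (Some i0 :: nil) x0 t0) t0 * Dphi (Some i :: Some j :: nil) x0 t0))) in K.
  - rewrite fsum_opp in K. lra.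
  - intros i. rewrite <- fsum_opp. apply fsum_ext; intros; ring.
Qed.

Lemma cont_opp_arg n T (f : vec n -> R -> R) : cont_strip T f ->
  cont_strip T (fun p t => f (vopp p) t).
Proof.
  intros Hf p t Ht eps He. destruct (Hf (vopp p) t Ht eps He) as [d [Hd H]]. exists d; split; auto.
  intros q s Hs Hq. apply H; auto. unfold dist_nt in *.
  replace (vsub (vopp q) (vopp p)) with (vsub p q) by vec_ring.
  now rewrite vnorm_sub_sym.
Qed.

Lemma quad_ub n (e : vec n) B A Cq z : dot e e = 1 -> 0 <= Cq ->
  quad e B A Cq z <= B * dot e z + (Rabs A + Cq) * dot z z.
Proof.
  intros He HCq. unfold quad. pose proof (cauchy_sq _ e z) as H. rewrite He in H.
  pose proof (Rle_abs A). assert (0 <= dot e z * dot e z) by nra.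
  assert (A * (dot e z * dot e z) <= Rabs A * (dot e z * dot e z)) by (apply Rmult_le_compat_r; auto).
  pose proof (Rabs_pos A). nra.
Qed.

Lemma quad_lb n (e : vec n) B A Cq z : dot e e = 1 -> 0 <= Cq ->
  - ((Rabs B + Rabs A) * (1 + dot z z)) <= quad e B A Cq z.
Proof.
  intros He HCq. unfold quad. pose proof (cauchy_sq _ e z) as H. rewrite He in H.
  set (r := dot e z) in *. assert (0 <= r * r) by nra.
  pose proof (Rabs_pos A); pose proof (Rabs_pos B).
  pose proof (Rle_abs (- A)) as HA; rewrite Rabs_Ropp in HA.
  assert (- (Rabs A * (r * r)) <= A * (r * r)) by nra.
  assert (- (Rabs B * (1 + r * r)) <= B * r).
  { pose proof (Rle_abs (- (B * r))) as HB. rewrite Rabs_Ropp, Rabs_mult in HB.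
    assert (Rabs r <= 1 + r * r) by (apply Rabs_le; nra).
    assert (Rabs B * Rabs r <= Rabs B * (1 + r * r)) by (apply Rmult_le_compat_l; auto). lra. }
  assert (Rabs B * (r * r) <= Rabs B * dot z z) by (apply Rmult_le_compat_l; lra).
  assert (Rabs A * (r * r) <= Rabs A * dot z z) by (apply Rmult_le_compat_l; lra).
  assert (0 <= Cq * (dot z z - r * r)) by (apply Rmult_le_pos; lra). lra.
Qed.

Lemma quad_0 n (e : vec n) B A Cq : quad e B A Cq (fun _ => 0) = 0.
Proof. unfold quad. rewrite (dot_sym _ e), !dot_0_l. ring. Qed.

Lemma dot_sub_sq_le n (y x : vec n) : dot (vsub y x) (vsub y x) <= 2 * (dot y y + dot x x).
Proof.
  pose proof (dot_ge0 _ (vadd y x)) as H.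
  rewrite dot_add_l, !dot_add_r, (dot_sym _ x y) in H.
  rewrite dot_sub_l, !dot_sub_r, (dot_sym _ x y). lra.
Qed.

(** With [S] the sum of the two squared distances, the left side grows at most linearly in [S],
    while the barriers dominate [S^2] and [S >= rho^2] outside; the constants divide by the
    appropriate powers of [m = rho^2]. *)
Lemma bars_dominate n dirs (x0 y0 : vec n) rho K0 K1 : 0 < rho -> 0 <= K0 -> 0 <= K1 ->
  exists Cb, 0 <= Cb /\ forall x y tau, 0 <= tau -> rho < vnorm (vsub x x0) \/ rho < vnorm (vsub y y0) ->
    K0 + K1 * (1 + dot (vsub (vsub y x) (vsub y0 x0)) (vsub (vsub y x) (vsub y0 x0)))
      <= Cb * (bar dirs y0 y tau + bar dirs x0 x tau).
Proof.
  intros Hr HK0 HK1. pose proof (pos_INR n) as Hn.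
  set (m := rho * rho). assert (Hm : 0 < m) by (unfold m; nra).
  set (c := (K0 + K1) / (m * m) + 2 * K1 / m).
  assert (H1 : 0 <= (K0 + K1) / (m * m)) by (apply Rle_mult_inv_pos; nra).
  assert (H2 : 0 <= 2 * K1 / m) by (apply Rle_mult_inv_pos; nra).
  exists (2 * (INR n + 1) * c). split; [unfold c; nra|].
  intros x y tau Ht Hout.
  pose proof (bar_ge n dirs y0 y tau Ht) as By. pose proof (bar_ge n dirs x0 x tau Ht) as Bx.
  pose proof (bar_nonneg n dirs y0 y tau Ht) as Ny. pose proof (bar_nonneg n dirs x0 x tau Ht) as Nx.
  pose proof (dot_sub_sq_le _ (vsub y y0) (vsub x x0)) as Hz.
  replace (vsub (vsub y y0) (vsub x x0)) with (vsub (vsub y x) (vsub y0 x0)) in Hz by vec_ring.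
  set (Z := dot (vsub (vsub y x) (vsub y0 x0)) (vsub (vsub y x) (vsub y0 x0))) in *.
  pose proof (dot_ge0 _ (vsub y y0)) as P0. pose proof (dot_ge0 _ (vsub x x0)) as Q0.
  assert (HS : m <= dot (vsub y y0) (vsub y y0) + dot (vsub x x0) (vsub x x0)).
  { destruct Hout as [Hout|Hout].
    - rewrite <- (vnorm_sq _ (vsub x x0)). unfold m. nra.
    - rewrite <- (vnorm_sq _ (vsub y y0)). unfold m. nra. }
  set (P := dot (vsub y y0) (vsub y y0)) in *. set (Q := dot (vsub x x0) (vsub x x0)) in *.
  set (S := P + Q) in *.
  set (bb := bar dirs y0 y tau + bar dirs x0 x tau).
  assert (HSS : S * S <= 2 * (INR n + 1) * bb).
  { assert (S * S <= 2 * (P * P + Q * Q)) by (unfold S; pose proof (Rle_0_sqr (P - Q)); unfold Rsqr in *; lra).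
    unfold bb. lra. }
  apply Rle_trans with (c * (S * S)).
  - assert (E1 : K0 + K1 = (K0 + K1) / (m * m) * (m * m)) by (field; lra).
    assert (E2 : 2 * K1 * S = 2 * K1 / m * (m * S)) by (field; lra).
    assert ((K0 + K1) / (m * m) * (m * m) <= (K0 + K1) / (m * m) * (S * S)) by (apply Rmult_le_compat_l; nra).
    assert (2 * K1 / m * (m * S) <= 2 * K1 / m * (S * S)) by (apply Rmult_le_compat_l; nra).
    assert (K1 * Z <= 2 * K1 * S) by nra. unfold c. lra.
  - assert (0 <= c) by (unfold c; lra). nra.
Qed.

(** This takes the place of the theorem on sums. The value at the maximum is at most that of the two
    flows after time [h]; the flows start close to [U] and [V] at time [t0 - h], where the touching
    function bounds them, and the coupled principle propagates this bound. *)
Lemma doubling_inequality n T a b (u : vec n -> R -> R) kap M x0 y0 t0 e al B A Cq Dt :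
  0 < t0 < T -> 0 < kap -> 0 <= M -> bounded_on T M u -> unif_cont T u ->
  (forall i j, cont_strip T (a i j)) -> cont_strip T b ->
  (forall p t, 0 <= t <= T -> symm (fun i j => a i j p t)) ->
  visc_sub T a b u -> visc_super T a b u ->
  dot e e = 1 -> 0 <= al -> 0 <= Cq ->
  (forall v, al * (dot e v * dot e v) <= quadform (fun i j => a i j (vscal B e) t0) v) ->
  (exists C r, 0 < r /\ forall x y t, vnorm (vsub x x0) < r -> vnorm (vsub y y0) < r -> Rabs (t - t0) < r ->
     supconv kap u y t + supconv kap (fun x t => - u x t) x t <=
     supconv kap u y0 t0 + supconv kap (fun x t => - u x t) x0 t0
       + quad e B A Cq (vsub (vsub y x) (vsub y0 x0)) + Dt * (t - t0) + C * ((t - t0) * (t - t0))) ->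
  Dt <= 8 * A * al.
Proof.
  intros Ht0 Hkap HM Hbd Huc Ha Hb Hsym Hsub Hsup He Hal HCq Hell [C0 [r [Hr Hmax]]].
  set (v := fun x t => - u x t) in *.
  set (U := supconv kap u) in *. set (V := supconv kap v) in *.
  assert (Hvbd : bounded_on T M v) by now apply bounded_opp.
  assert (Hvuc : unif_cont T v) by now apply unif_cont_opp.
  assert (HUbd := supconv_bounded n T M kap u Hkap Hbd). assert (HVbd := supconv_bounded n T M kap v Hkap Hvbd).
  assert (HUuc := supconv_unif_cont n T M kap u Hkap Hbd Huc). assert (HVuc := supconv_unif_cont n T M kap v Hkap Hvbd Hvuc).
  fold U in HUbd, HUuc. fold V in HVbd, HVuc.
  set (p := vscal B e) in *.
  pose proof (pos_INR n) as Hn.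
  set (E := 4 * kap * INR n + 2). assert (HE : 0 <= E) by (unfold E; nra).
  enough (HH : forall nu, 0 < nu < 1 -> Dt - 8 * A * al <= (1 + 2 * E) * nu).
  { assert (Dt - 8 * A * al <= 0); [|lra]. apply (le_0_of_small _ (1 + 2 * E) 1); [lra | exact HH]. }
  intros nu [Hnu Hnu1].
  (* [A + nu I = al e e^T + (positive semi-definite rest)]: the first summand is coupled by
     reflection, the rest by translation. *)
  destruct (psd_decomp n (fun i j => (a i j p t0 + nu * idm i j) + (- al) * (e i * e j))) as [ds Hds].
  { intros i j. rewrite (Hsym p t0 ltac:(lra) i j), (idm_sym _ i j). ring. }
  { intros w. rewrite !quadform_plus, quadform_idm, quadform_rank1. specialize (Hell w). pose proof (dot_ge0 _ w). nra. }
  set (sg := sqrt al). assert (Hsg : sg * sg = al) by (apply sqrt_sqrt; lra).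
  set (dirs := vscal sg e :: ds).
  assert (Hdirs : forall i j, a i j p t0 + nu * idm i j = rank1_sum dirs i j).
  { intros i j. unfold dirs, rank1_sum. simpl. fold (rank1_sum ds i j). rewrite <- Hds. unfold vscal.
    replace (sg * e i * (sg * e j)) with ((sg * sg) * (e i * e j)) by ring. rewrite Hsg. ring. }
  (* The gradient of [V] at [x0] is [- p], and the sign change of [visc_super_opp] brings it back to
     [p]: both convolutions get the same frozen matrix, and their [b] terms are opposite. *)
  assert (Hvv : vopp (vscal (- B) e) = p) by (extensionality i; unfold vopp, p, vscal; ring).
  destruct (supconv_le_caloric n T a b u kap M y0 t0 p nu dirs) as [rho1 [Hrho1 HclU]]; auto.
  { exists (Rabs A + Cq), r; split; auto. intros h Hh. fold U.
    specialize (Hmax x0 (vadd y0 h) t0). rewrite vsub_self, vnorm_0, vsub_vadd, Rminus_diag, Rabs_R0 in Hmax.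
    specialize (Hmax Hr Hh Hr).
    replace (vsub (vsub (vadd y0 h) x0) (vsub y0 x0)) with h in Hmax by vec_ring.
    pose proof (quad_ub n e B A Cq h He HCq). unfold p. rewrite dot_scal_l. lra. }
  destruct (supconv_le_caloric n T (fun i j p t => a i j (vopp p) t) (fun p t => - b (vopp p) t) v kap M x0 t0 (vscal (- B) e) nu dirs)
    as [rho2 [Hrho2 HclV]]; auto.
  { intros i j; now apply cont_opp_arg. }
  { apply (cont_opp n T (fun p t => b (vopp p) t)). now apply cont_opp_arg. }
  { now apply visc_super_opp. }
  { exists (Rabs A + Cq), r; split; auto. intros h Hh. fold V.
    specialize (Hmax (vadd x0 h) y0 t0). rewrite vsub_self, vnorm_0, vsub_vadd, Rminus_diag, Rabs_R0 in Hmax.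
    specialize (Hmax Hh Hr Hr).
    replace (vsub (vsub y0 (vadd x0 h)) (vsub y0 x0)) with (vscal (-1) h) in Hmax by vec_ring.
    pose proof (quad_ub n e B A Cq (vscal (-1) h) He HCq) as Hq. rewrite !dot_scal_r, dot_scal_l in Hq. rewrite dot_scal_l. lra. }
  { intros i j. rewrite Hvv. apply Hdirs. }
  rewrite Hvv in HclV. fold E in HclU, HclV. fold U in HclU. fold V in HclV.
  set (rho := Rmin (Rmin rho1 rho2) (r / 2)).
  assert (Hrho : 0 < rho) by (repeat apply Rmin_pos; lra).
  assert (Hrl : rho <= rho1 /\ rho <= rho2 /\ rho < r).
  { unfold rho. Rmin_bounds. repeat split; lra. }
  destruct (HclU rho ltac:(lra)) as [C1 [h1 [HC1 [Hh1 KU]]]].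
  destruct (HclV rho ltac:(lra)) as [C2 [h2 [HC2 [Hh2 KV]]]].
  (* The extra [nu] provides the strict inequality required by [coupled_max_principle]. *)
  set (beta := 8 * A * al + nu).
  pose proof (Rabs_pos B); pose proof (Rabs_pos A); pose proof (Rabs_pos Dt); pose proof (Rabs_pos beta); pose proof (Rabs_pos C0).
  (* Far away the barriers pay [2 M] for the two flows, [2 M + |Dt|] for a possibly negative [c0]
     and [|beta|] for [beta * tau]; the second constant is that of [quad_lb]. *)
  destruct (bars_dominate n dirs x0 y0 rho (4 * M + Rabs Dt + Rabs beta) (Rabs B + Rabs A) Hrho ltac:(lra) ltac:(lra))
    as [Cb [HCb Hdom]].
  destruct (bar_center n dirs y0) as [Cy [HCy HCy']]. destruct (bar_center n dirs x0) as [Cx [HCx HCx']].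
  set (h0 := Rmin (Rmin h1 h2) (Rmin (Rmin t0 r) 1)).
  assert (Hh0 : 0 < h0) by (repeat apply Rmin_pos; lra).
  assert (Dt - beta - 2 * E * nu <= 0); [|unfold beta in *; lra].
  apply (le_0_of_small _ (Rabs C0 + C1 + C2 + Cb * Cx + Cb * Cy) h0 Hh0).
  intros h [Hh Hhh].
  assert (Hhl : h < h1 /\ h < h2 /\ h < t0 /\ h < r /\ h < 1).
  { unfold h0 in *. Rmin_bounds. repeat split; lra. }
  apply Rmult_le_reg_r with h; auto. apply le_epsilon. intros eps Heps.
  set (eta := eps / 4). assert (Heta : 0 < eta) by (unfold eta; lra).
  assert (Happ : forall (W : vec n -> R -> R) c, bounded_on T M W -> unif_cont T W ->
    exists ts, (forall y, Rabs (tev ts y) <= M) /\ forall y, vnorm (vsub y c) <= rho -> Rabs (tev ts y - W y (t0 - h)) <= eta).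
  { intros W c HWb HWu. apply trig_approx; auto.
    - intros y. apply HWb; lra.
    - intros eps' Heps'. destruct (HWu eps' Heps') as [d [Hd K]]. exists d; split; auto.
      intros w w' Hw. apply K; auto; try lra. rewrite Rminus_diag, Rabs_R0; lra. }
  destruct (Happ U y0 HUbd HUuc) as [ts1 [Hts1 Hts1']].
  destruct (Happ V x0 HVbd HVuc) as [ts2 [Hts2 Hts2']].
  set (Fl1 := flow dirs ts1). set (Fl2 := flow dirs ts2).
  assert (HB1 : forall y tau, 0 <= tau -> Rabs (Fl1 y tau) <= M) by (apply flow_le; auto).
  assert (HB2 : forall y tau, 0 <= tau -> Rabs (Fl2 y tau) <= M) by (apply flow_le; auto).
  assert (HI1 : forall y, vnorm (vsub y y0) <= rho -> - eta <= Fl1 y 0 - U y (t0 - h) <= eta).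
  { intros y Hy. unfold Fl1. rewrite flow_0. apply Rabs_le_both; auto. }
  assert (HI2 : forall x, vnorm (vsub x x0) <= rho -> - eta <= Fl2 x 0 - V x (t0 - h) <= eta).
  { intros x Hx. unfold Fl2. rewrite flow_0. apply Rabs_le_both; auto. }
  specialize (KU h eta Fl1 ltac:(lra) (Caloric_flow _ _ _) HB1).
  assert (KU' := KU ltac:(intros y Hy; specialize (HI1 y Hy); lra) ltac:(lra)). clear KU.
  specialize (KV h eta Fl2 ltac:(lra) (Caloric_flow _ _ _) HB2).
  assert (KV' := KV ltac:(intros y Hy; specialize (HI2 y Hy); lra) ltac:(lra)). clear KV.
  set (W0 := U y0 t0 + V x0 t0) in *.
  (* The touching inequality at time [t0 - h], plus [eta] for the approximation of each initial
     datum. *)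
  set (c0 := W0 + 2 * eta - Dt * h + Rabs C0 * (h * h)).
  assert (HW0 : - (2 * M) <= W0).
  { unfold W0. pose proof (Rabs_le_both _ _ (HUbd y0 t0 ltac:(lra))). pose proof (Rabs_le_both _ _ (HVbd x0 t0 ltac:(lra))). lra. }
  assert (Hc0 : - (2 * M + Rabs Dt) <= c0).
  { unfold c0. pose proof (Rle_abs Dt). assert (Dt * h <= Rabs Dt) by nra. assert (0 <= Rabs C0 * (h * h)) by nra. lra. }
  set (F1 := fun y t => Fl1 y t + (- Cb) * bar dirs y0 y t).
  set (F2 := fun x t => (0 + (-1) * Fl2 x t) + Cb * bar dirs x0 x t).
  assert (Hfar : forall x y tau, 0 <= tau <= h -> rho < vnorm (vsub x x0) \/ rho < vnorm (vsub y y0) ->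
    F1 y tau - F2 x tau <= c0 + quad e B A Cq (vsub (vsub y x) (vsub y0 x0)) + beta * tau).
  { intros x y tau Htau Hout. specialize (Hdom x y tau ltac:(lra) Hout).
    pose proof (Rabs_le_both _ _ (HB1 y tau ltac:(lra))). pose proof (Rabs_le_both _ _ (HB2 x tau ltac:(lra))).
    pose proof (quad_lb n e B A Cq (vsub (vsub y x) (vsub y0 x0)) He HCq).
    assert (- Rabs beta <= beta * tau).
    { pose proof (Rle_abs (- beta)) as Hb'. rewrite Rabs_Ropp in Hb'. assert (- Rabs beta * tau <= beta * tau) by nra. nra. }
    unfold F1, F2. lra. }
  assert (MP : F1 y0 h - F2 x0 h <= c0 + quad e B A Cq (vsub (vsub y0 x0) (vsub y0 x0)) + beta * h).
  { apply (coupled_max_principle n e sg ds F1 F2 c0 B A Cq beta (vsub y0 x0) (vnorm x0 + vnorm y0 + rho) h); auto; try lra.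
    - apply Caloric_add; [apply Caloric_flow | apply Caloric_bar].
    - apply (Caloric_add n dirs (fun x t => 0 + (-1) * Fl2 x t) (bar dirs x0)); [|apply Caloric_bar].
      apply (Caloric_add n dirs (fun _ _ => 0) Fl2); [apply Caloric_const | apply Caloric_flow].
    - rewrite Hsg. unfold beta. lra.
    - intros x y.
      destruct (Rlt_dec rho (vnorm (vsub x x0))) as [Hx|Hx]; [|destruct (Rlt_dec rho (vnorm (vsub y y0))) as [Hy|Hy]].
      + specialize (Hfar x y 0 ltac:(lra) (or_introl Hx)). lra.
      + specialize (Hfar x y 0 ltac:(lra) (or_intror Hy)). lra.
      + apply Rnot_lt_le in Hx, Hy. specialize (HI1 y Hy). specialize (HI2 x Hx).
        specialize (Hmax x y (t0 - h) ltac:(lra) ltac:(lra)).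
        replace (t0 - h - t0) with (- h) in Hmax by ring. rewrite Rabs_Ropp, Rabs_right in Hmax by lra.
        specialize (Hmax ltac:(lra)). fold W0 in Hmax.
        pose proof (bar_nonneg n dirs y0 y 0 ltac:(lra)). pose proof (bar_nonneg n dirs x0 x 0 ltac:(lra)).
        pose proof (Rle_abs C0). assert (C0 * (- h * - h) <= Rabs C0 * (h * h)) by nra.
        unfold F1, F2, c0. nra.
    - intros x y tau Htau Hout. apply Hfar; auto.
      pose proof (vnorm_ge0 _ x0). pose proof (vnorm_ge0 _ y0).
      destruct Hout as [Hout|Hout]; [left; pose proof (vnorm_le_sub _ x x0) | right; pose proof (vnorm_le_sub _ y y0)]; lra. }
  rewrite vsub_self, quad_0 in MP. unfold F1, F2 in MP. rewrite HCy', HCx' in MP.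
  (* Adding [KU'], [KV'] and [MP] cancels [W0], both flows and the values of [b]. What is left is
     [Dt * h] against [(beta + 2 E nu) h], four times [eta], that is [eps], and a multiple of
     [h^2]. *)
  unfold c0, W0, eta in *. lra.
Qed.

(** * The modulus of continuity *)

Lemma deriv_shift g t L : derivable_pt_lim (fun h => g (t + h)) 0 L -> derivable_pt_lim g t L.
Proof.
  intros H eps He. destruct (H eps He) as [d Hd]. exists d. intros h Hh Hhd. specialize (Hd h Hh Hhd).
  now rewrite Rplus_0_l, Rplus_0_r in Hd.
Qed.

(** * Expansion of the test function and its strict perturbation *)

Section TestFunction.
Variables (s0 t0 r : R) (Dphi : list bool -> R -> R -> R).
Hypotheses (HD : smooth_family_2 (fun s t => dist2 s0 t0 s t < r) Dphi).

Lemma dist2_ball s t s' t' : dist2 s0 t0 s t < r -> Rabs (s' - s) < (r - dist2 s0 t0 s t) / 2 ->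
  Rabs (t' - t) < (r - dist2 s0 t0 s t) / 2 -> dist2 s0 t0 s' t' < r.
Proof.
  unfold dist2. intros H H1 H2.
  pose proof (Rabs_triang (s' - s) (s - s0)). pose proof (Rabs_triang (t' - t) (t - t0)).
  replace (s' - s + (s - s0)) with (s' - s0) in * by ring. replace (t' - t + (t - t0)) with (t' - t0) in * by ring. lra.
Qed.

Lemma deriv_s l s t : dist2 s0 t0 s t < r -> derivable_pt_lim (fun z => Dphi l z t) s (Dphi (true :: l) s t).
Proof. intros H. apply (deriv_shift (fun z => Dphi l z t)). now apply HD. Qed.

Lemma deriv_t l s t : dist2 s0 t0 s t < r -> derivable_pt_lim (fun z => Dphi l s z) t (Dphi (false :: l) s t).
Proof. intros H. apply (deriv_shift (fun z => Dphi l s z)). now apply HD. Qed.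

Lemma Dphi_cont l s t eps : dist2 s0 t0 s t < r -> 0 < eps ->
  exists d, 0 < d /\ forall s' t', Rabs (s' - s) < d -> Rabs (t' - t) < d -> Rabs (Dphi l s' t' - Dphi l s t) < eps.
Proof.
  intros H He. destruct (HD l) as [Hc _]. destruct (Hc s t H eps He) as [d [Hd K]].
  exists (Rmin (d / 2) ((r - dist2 s0 t0 s t) / 2)). split; [apply Rmin_pos; lra|].
  intros s' t' H1 H2. Rmin_bounds.
  apply K.
  - apply (dist2_ball s t); auto; lra.
  - unfold dist2. lra.
Qed.

Local Notation f0 := (Dphi nil).
Local Notation fs := (Dphi (true :: nil)).
Local Notation ft := (Dphi (false :: nil)).
Local Notation fss := (Dphi (true :: true :: nil)).
Local Notation fts := (Dphi (false :: true :: nil)).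

(** Space is expanded to second order by continuity of the second derivative; the mixed derivative
    controls the drift of the slope in time, and its product with [h] is split by Young's
    inequality. *)
Lemma Dphi_expand s t del : dist2 s0 t0 s t < r -> 0 < del -> exists C d, 0 < d /\ 0 <= C /\
  forall h k, Rabs h < d -> Rabs k < d ->
    Rabs (f0 (s + h) (t + k) - f0 s t - fs s t * h
      - fss s t / 2 * (h * h) - ft s t * k) <= del * (h * h) + C * (k * k).
Proof.
  intros H Hdel. set (r1 := (r - dist2 s0 t0 s t) / 2). assert (Hr1 : 0 < r1) by (unfold r1; lra).
  assert (Hin : forall s' t', Rabs (s' - s) < r1 -> Rabs (t' - t) < r1 -> dist2 s0 t0 s' t' < r)
    by (intros; apply (dist2_ball s t); auto).
  destruct (Dphi_cont (true :: true :: nil) s t (del / 2) H ltac:(lra)) as [d1 [Hd1 K1]].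
  assert (O2t : O2 (fun z => f0 s z) t (ft s t)).
  { apply (T2_O2 _ _ _ (Dphi (false :: false :: nil) s t)).
    apply (T2_of_deriv (fun z => f0 s z) (fun z => ft s z) t _ r1 Hr1).
    - intros z Hz. apply deriv_t, Hin; auto. now rewrite Rminus_diag, Rabs_R0.
    - apply deriv_t; auto. }
  destruct O2t as [C2 [d2 [Hd2 [HC2 K2]]]].
  destruct (deriv_t (true :: nil) s t H 1 ltac:(lra)) as [d3 K3].
  set (L := Rabs (fts s t) + 1).
  assert (HL : 1 <= L) by (unfold L; pose proof (Rabs_pos (fts s t)); lra).
  pose proof (cond_pos d3) as Hd3.
  set (d := Rmin (Rmin r1 d1) (Rmin d2 d3)).
  exists (C2 + L * L / (2 * del)), d. split; [repeat apply Rmin_pos; auto|].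
  split; [assert (0 <= L * L / (2 * del)) by (apply Rle_mult_inv_pos; nra); lra|].
  assert (Hdl : d <= r1 /\ d <= d1 /\ d <= d2 /\ d <= d3).
  { unfold d. Rmin_bounds. repeat split; lra. }
  intros h k Hh Hk.
  assert (Ekt : t + k - t = k) by ring.
  (* The expansion in [s] is made at the shifted time [t + k], with the second derivative frozen at
     [(s, t)]; the other two brackets of the splitting then involve increments in time alone. *)
  assert (Hsec : Rabs (f0 (s + h) (t + k) - f0 s (t + k) - fs s (t + k) * h
      - fss s t / 2 * (h * h)) <= del / 2 * (h * h)).
  { set (m := fss s t).
    replace (del / 2 * (h * h)) with (del / 2 * Rabs h * Rabs h)
      by (rewrite Rmult_assoc, <- Rabs_mult, (Rabs_right (h * h)); nra).
    apply (mvt_quad_bound (fun z => f0 z (t + k)) (fun z => fs z (t + k))).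
    - intros z Hz. apply deriv_s, Hin; rewrite ?Ekt; lra.
    - intros z Hz.
      apply Rle_trans with (del / 2 * Rabs (z - s)); [|apply Rmult_le_compat_l; lra].
      pose proof (mvt_bound (fun w => fs w (t + k) - m * (w - s)) (fun w => fss w (t + k) - m * (1 - 0)) s (z - s) (del / 2)) as Mv.
      replace (s + (z - s)) with z in Mv by ring.
      replace (fs z (t + k) - fs s (t + k) - m * (z - s)) with
        (fs z (t + k) - m * (z - s) - (fs s (t + k) - m * (s - s))) by ring.
      apply Mv; intros w Hw.
      + apply (derivable_pt_lim_minus (fun z => fs z (t + k)) (fun z => m * (z - s))).
        * apply deriv_s, Hin; rewrite ?Ekt; lra.
        * apply (derivable_pt_lim_scal (fun z => z - s)), (derivable_pt_lim_minus (fun z => z) (fun _ => s));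
            [apply derivable_pt_lim_id | apply derivable_pt_lim_const].
      + rewrite Rminus_0_r, Rmult_1_r. apply Rlt_le, K1; rewrite ?Ekt; lra. }
  assert (Hmix : Rabs (fs s (t + k) - fs s t) <= L * Rabs k).
  { destruct (Req_dec k 0) as [->|Hk0].
    - rewrite Rplus_0_r, Rminus_diag, Rabs_R0. lra.
    - specialize (K3 k Hk0 ltac:(lra)).
      replace (fs s (t + k) - fs s t) with
        (((fs s (t + k) - fs s t) / k) * k) by (field; auto).
      rewrite Rabs_mult. apply Rmult_le_compat_r; [apply Rabs_pos|].
      set (q := (fs s (t + k) - fs s t) / k) in *.
      replace q with ((q - fts s t) + fts s t) by ring.
      eapply Rle_trans; [apply Rabs_triang|]. unfold L. lra. }
  specialize (K2 k ltac:(lra)).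
  match goal with |- Rabs ?z <= _ => replace z with
    ((f0 (s + h) (t + k) - f0 s (t + k) - fs s (t + k) * h - fss s t / 2 * (h * h))
     + (fs s (t + k) - fs s t) * h + (f0 s (t + k) - f0 s t - ft s t * k)) by ring end.
  eapply Rle_trans; [apply Rabs_triang|]. eapply Rle_trans; [apply Rplus_le_compat_r, Rabs_triang|].
  rewrite (Rabs_mult _ h).
  assert (Rabs (fs s (t + k) - fs s t) * Rabs h <= del / 2 * (h * h) + L * L / (2 * del) * (k * k)).
  { apply Rle_trans with (L * Rabs k * Rabs h); [apply Rmult_le_compat_r; auto using Rabs_pos|].
    assert (h * h = Rabs h * Rabs h) as -> by apply Rsqr_abs.
    assert (k * k = Rabs k * Rabs k) as -> by apply Rsqr_abs.
    assert (Q : 0 <= del / 2 * ((Rabs h - L * Rabs k / del) * (Rabs h - L * Rabs k / del))).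
    { apply Rmult_le_pos; [lra | apply Rle_0_sqr]. }
    replace (del / 2 * ((Rabs h - L * Rabs k / del) * (Rabs h - L * Rabs k / del))) with
      (del / 2 * (Rabs h * Rabs h) + L * L / (2 * del) * (Rabs k * Rabs k) - L * Rabs k * Rabs h) in Q by (field; lra).
    lra. }
  lra.
Qed.

(* The quartic terms make the maximum strict without changing the derivatives in
   the inequality at [(s0, t0)]. *)
Definition phi_strict (s t : R) : R := f0 s t + (s - s0) ^ 4 + (t - t0) ^ 4.

Lemma phi_strict_expand s t del : dist2 s0 t0 s t < r -> 0 < del -> exists C d, 0 < d /\ 0 <= C /\
  forall h k, Rabs h < d -> Rabs k < d ->
    Rabs (phi_strict (s + h) (t + k) - phi_strict s t - (fs s t + 4 * (s - s0) ^ 3) * h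
      - (fss s t + 12 * (s - s0) ^ 2) / 2 * (h * h)
      - (ft s t + 4 * (t - t0) ^ 3) * k) <= del * (h * h) + C * (k * k).
Proof.
  intros H Hdel.
  destruct (Dphi_expand s t (del / 2) H ltac:(lra)) as [C1 [d1 [Hd1 [HC1 K1]]]].
  destruct (T2_pow4 (s - s0) (del / 2) ltac:(lra)) as [d2 [Hd2 K2]].
  destruct (T2_O2 _ _ _ _ (T2_pow4 (t - t0))) as [C3 [d3 [Hd3 [HC3 K3]]]].
  exists (C1 + C3), (Rmin d1 (Rmin d2 d3)). split; [repeat apply Rmin_pos; auto|]. split; [lra|].
  intros h k Hh Hk.
  Rmin_bounds.
  specialize (K1 h k ltac:(lra) ltac:(lra)). specialize (K2 h ltac:(lra)). specialize (K3 k ltac:(lra)).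
  apply Rabs_le_both in K1, K2, K3. unfold phi_strict.
  replace (s + h - s0) with (s - s0 + h) by ring. replace (t + k - t0) with (t - t0 + k) by ring.
  apply Rabs_le; lra.
Qed.

Lemma phi_strict_cont s t eps : dist2 s0 t0 s t < r -> 0 < eps ->
  exists d, 0 < d /\ forall s' t', Rabs (s' - s) < d -> Rabs (t' - t) < d -> Rabs (phi_strict s' t' - phi_strict s t) < eps.
Proof.
  intros H He.
  destruct (Dphi_cont nil s t (eps / 3) H ltac:(lra)) as [d1 [Hd1 K1]].
  destruct (T2_cont _ _ _ _ (T2_pow4 (s - s0)) (eps / 3) ltac:(lra)) as [d2 [Hd2 K2]].
  destruct (T2_cont _ _ _ _ (T2_pow4 (t - t0)) (eps / 3) ltac:(lra)) as [d3 [Hd3 K3]].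
  exists (Rmin d1 (Rmin d2 d3)). split; [repeat apply Rmin_pos; auto|].
  intros s' t' Hs Ht. Rmin_bounds.
  specialize (K1 s' t' ltac:(lra) ltac:(lra)). specialize (K2 (s' - s) ltac:(lra)). specialize (K3 (t' - t) ltac:(lra)).
  replace (s - s0 + (s' - s)) with (s' - s0) in K2 by ring. replace (t - t0 + (t' - t)) with (t' - t0) in K3 by ring.
  apply Rabs_def2 in K1, K2, K3. unfold phi_strict. apply Rabs_def1; lra.
Qed.

End TestFunction.

(** With [r = dot e ze], the norm [N] of [xi + ze] satisfies [N^2 = (2 s + r)^2 + (|ze|^2 - r^2)].
    Hence the excess of [N / 2] over its linear part is nonnegative and controlled by the transverse
    part alone. *)
Lemma half_norm_expand n (xi ze e : vec n) s : 0 < s -> vnorm xi = 2 * s -> e = vscal (/ (2 * s)) xi -> vnorm ze < s ->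
  exists th, 0 <= th /\ 4 * s * th <= dot ze ze - dot e ze * dot e ze /\
    vnorm (vadd xi ze) / 2 = s + (dot e ze / 2 + th) /\ Rabs (dot e ze / 2 + th) <= vnorm ze.
Proof.
  intros Hs Hxi He Hze.
  assert (Exi : dot xi xi = 4 * s * s) by (rewrite <- vnorm_sq, Hxi; ring).
  assert (Eee : dot e e = 1) by (rewrite He, dot_scal_l, dot_scal_r, Exi; field; lra).
  assert (Exz : dot xi ze = 2 * s * dot e ze) by (rewrite He, dot_scal_l; field; lra).
  set (rr := dot e ze) in *. set (N := vnorm (vadd xi ze)).
  pose proof (vnorm_ge0 _ (vadd xi ze)) as HN0. fold N in HN0. pose proof (vnorm_ge0 _ ze).
  assert (Hrr : Rabs rr <= vnorm ze).
  { unfold rr. eapply Rle_trans; [apply cauchy|].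
    assert (vnorm e = 1) as ->; [|lra]. unfold vnorm. rewrite Eee. apply sqrt_1. }
  apply Rabs_le_both in Hrr.
  assert (HN : N * N = (2 * s + rr) * (2 * s + rr) + (dot ze ze - rr * rr)).
  { unfold N. rewrite vnorm_sq, dot_add_l, !dot_add_r, Exi, (dot_sym _ ze xi), Exz. ring. }
  assert (Hw : 0 <= dot ze ze - rr * rr) by (rewrite <- vnorm_sq; nra).
  assert (Hge : 2 * s + rr <= N) by nra.
  exists ((N - 2 * s - rr) / 2). split; [lra|]. split; [nra|]. split; [unfold N; field|].
  replace (rr / 2 + (N - 2 * s - rr) / 2) with ((N - 2 * s) / 2) by field.
  assert (N <= 2 * s + vnorm ze).
  { unfold N. rewrite <- Hxi. apply vnorm_triang. }
  apply Rabs_le; lra.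
Qed.

(** Inserting the radial increment [r / 2 + th] into the expansion of [phi] gives slope [phi'] and
    quadratic coefficient [phi'' / 4] along [e]; all terms with [th] are transverse and go into
    [Cq]. *)
Lemma radial_expand n s0 t0 r Dphi (xi e : vec n) s t del : smooth_family_2 (fun s t => dist2 s0 t0 s t < r) Dphi ->
  dist2 s0 t0 s t < r -> 0 < s -> vnorm xi = 2 * s -> e = vscal (/ (2 * s)) xi -> 0 < del ->
  exists Cq C d, 0 <= Cq /\ 0 < d /\ forall ze k, vnorm ze < d -> Rabs k < d ->
    2 * phi_strict s0 t0 Dphi (vnorm (vadd xi ze) / 2) (t + k) <= 2 * phi_strict s0 t0 Dphi s t
     + quad e (Dphi (true :: nil) s t + 4 * (s - s0) ^ 3)
         ((Dphi (true :: true :: nil) s t + 12 * (s - s0) ^ 2 + 2 * del) / 4) Cq ze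
     + 2 * (Dphi (false :: nil) s t + 4 * (t - t0) ^ 3) * k + C * (k * k).
Proof.
  intros HD H Hs Hxi He Hdel.
  destruct (phi_strict_expand s0 t0 r Dphi HD s t del H Hdel) as [C [d [Hd [HC K]]]].
  set (p1 := Dphi (true :: nil) s t + 4 * (s - s0) ^ 3) in *.
  set (p2 := Dphi (true :: true :: nil) s t + 12 * (s - s0) ^ 2) in *.
  set (p3 := Dphi (false :: nil) s t + 4 * (t - t0) ^ 3) in *.
  set (q := p2 + 2 * del).
  pose proof (Rabs_pos p1); pose proof (Rabs_pos q).
  (* [2 |p1| th] comes from the slope and [3 |q| th] from the second-order term, using [|r| <= 1]
     and [th <= 3 / 2]; dividing by [4 s] converts [th] into the transverse square. *)
  set (Cq := (2 * Rabs p1 + 3 * Rabs q) / (4 * s)).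
  assert (HCq : 0 <= Cq) by (apply Rle_mult_inv_pos; lra).
  exists Cq, (2 * C), (Rmin (Rmin d s) 1). split; auto. split; [repeat apply Rmin_pos; lra|].
  intros ze k Hze Hk.
  Rmin_bounds.
  destruct (half_norm_expand n xi ze e s Hs Hxi He ltac:(lra)) as [th [Hth [Hth2 [EN HN]]]].
  rewrite EN. set (rr := dot e ze) in *.
  assert (Eee : dot e e = 1).
  { rewrite He, dot_scal_l, dot_scal_r, <- vnorm_sq, Hxi. field; lra. }
  assert (Hrr : Rabs rr <= vnorm ze).
  { unfold rr. eapply Rle_trans; [apply cauchy|].
    assert (vnorm e = 1) as ->; [|lra]. unfold vnorm. rewrite Eee. apply sqrt_1. }
  specialize (K (rr / 2 + th) k ltac:(lra) ltac:(lra)).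
  apply Rabs_le_both in K. apply Rabs_le_both in Hrr. apply Rabs_le_both in HN.
  assert (Hth1 : th <= 3 / 2) by lra.
  assert (Q1 : p1 * th <= Rabs p1 * th) by (apply Rmult_le_compat_r; auto using Rle_abs).
  assert (Q2 : q * (rr * th + th * th) <= Rabs q * (3 * th)).
  { assert (Hab : Rabs (rr * th + th * th) <= 3 * th) by (apply Rabs_le; split; nra).
    eapply Rle_trans; [apply Rle_abs|]. rewrite Rabs_mult. apply Rmult_le_compat_l; auto. }
  assert (Q3 : (2 * Rabs p1 + 3 * Rabs q) * th <= Cq * (dot ze ze - rr * rr)).
  { replace ((2 * Rabs p1 + 3 * Rabs q) * th) with (Cq * (4 * s * th)) by (unfold Cq; field; lra).
    apply Rmult_le_compat_l; auto. }
  unfold quad. fold rr. fold q. unfold q in *. nra.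
Qed.

(** * The supremum defining [omega] *)

Section Omega.
Variables (n : nat) (T M : R) (u : vec (S n) -> R -> R).
Hypotheses (Hb : bounded_on T M u).

(** A dimension of the form [S n] supplies pairs at every distance [2 s], so the supremum runs over
    a nonempty set and [supR] is not an arbitrary default. *)
Lemma omega_lub s t : 0 <= s -> 0 <= t <= T ->
  is_lub (fun z => exists x y : vec (S n), vnorm (vsub y x) / 2 = s /\ z = (u y t - u x t) / 2) (omega u s t).
Proof.
  intros Hs Ht. apply supR_lub.
  - exists M. intros z [x [y [_ ->]]]. pose proof (Rabs_le_both _ _ (Hb x t Ht)). pose proof (Rabs_le_both _ _ (Hb y t Ht)). lra.
  - eexists. exists (fun _ => 0), (vscal (2 * s) (unitv Fin.F1)). split; [|reflexivity].
    replace (vsub (vscal (2 * s) (unitv Fin.F1)) (fun _ => 0)) with (vscal (2 * s) (unitv (n:=S n) Fin.F1)) by vec_ring.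
    rewrite vnorm_scal, Rabs_right by lra.
    assert (vnorm (unitv (n:=S n) Fin.F1) = 1) as ->; [|field].
    unfold vnorm. rewrite dot_unitv_l. unfold unitv. destruct (Fin.eq_dec _ _); [apply sqrt_1 | congruence].
Qed.

Lemma omega_ge x y t : 0 <= t <= T -> (u y t - u x t) / 2 <= omega u (vnorm (vsub y x) / 2) t.
Proof.
  intros Ht. pose proof (vnorm_ge0 _ (vsub y x)). apply (omega_lub (vnorm (vsub y x) / 2) t ltac:(lra) Ht).
  now exists x, y.
Qed.

Lemma omega_approx s t eta : 0 <= s -> 0 <= t <= T -> 0 < eta ->
  exists x y, vnorm (vsub y x) / 2 = s /\ omega u s t - eta < (u y t - u x t) / 2.
Proof.
  intros Hs Ht He. apply NNPP; intros HN.
  assert (omega u s t <= omega u s t - eta); [|lra].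
  apply (omega_lub s t Hs Ht). intros z [x [y [Hxy ->]]]. apply Rnot_lt_le; intros Hlt. apply HN; exists x, y; auto.
Qed.

End Omega.

(** For [B <> 0] the hypothesis at [p = B e] has all factors [B] cancelled; vectors orthogonal to
    [e] are covered by positivity. The case [B = 0] is the limit of small positive slopes, by
    continuity of [a] and of [alpha] up to [R = 0]. *)
Lemma elliptic_lower_bound n T (a : Fin.t n -> Fin.t n -> vec n -> R -> R) alpha B e t :
  (forall i j, cont_strip T (a i j)) ->
  (forall p t, 0 <= t <= T -> forall v, 0 <= quadform (fun i j => a i j p t) v) ->
  cont_on_2 (fun R t => 0 <= R /\ 0 <= t <= T) alpha ->
  (forall R t, 0 < R -> 0 <= t <= T ->
     forall p v : vec n, vnorm p = R -> dot v p <> 0 ->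
       alpha R t <= R ^ 2 * (quadform (fun i j => a i j p t) v / (dot v p) ^ 2)) ->
  0 <= t <= T -> dot e e = 1 ->
  forall v, alpha (Rabs B) t * (dot e v * dot e v) <= quadform (fun i j => a i j (vscal B e) t) v.
Proof.
  intros Ha Hpsd Halc Hal Ht He v.
  assert (Ne : vnorm e = 1) by (unfold vnorm; rewrite He; apply sqrt_1).
  assert (Hnz : forall c, c <> 0 -> alpha (Rabs c) t * (dot e v * dot e v) <= quadform (fun i j => a i j (vscal c e) t) v).
  { intros c Hc. destruct (Req_dec (dot e v) 0) as [E|E].
    - rewrite E. specialize (Hpsd (vscal c e) t Ht v). lra.
    - assert (Hp := Hal (Rabs c) t (Rabs_pos_lt c Hc) Ht (vscal c e) v).
      rewrite vnorm_scal, Ne, dot_scal_r, (dot_sym _ v e) in Hp.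
      specialize (Hp ltac:(ring) ltac:(now apply Rmult_integral_contrapositive_currified)).
      rewrite pow2_abs in Hp.
      set (Q := quadform (fun i j => a i j (vscal c e) t) v) in *.
      replace (c ^ 2 * (Q / (c * dot e v) ^ 2)) with (Q / (dot e v * dot e v)) in Hp by (field; auto).
      assert (0 < dot e v * dot e v) by (apply Rsqr_pos_lt in E; exact E).
      replace Q with (Q / (dot e v * dot e v) * (dot e v * dot e v)) by (field; auto).
      apply Rmult_le_compat_r; lra. }
  destruct (Req_dec B 0) as [->|HB]; [|now apply Hnz].
  rewrite Rabs_R0. apply le_epsilon. intros eps Heps.
  set (w := dot e v * dot e v). assert (Hw : 0 <= w) by (unfold w; nra).
  pose proof (dot_ge0 _ v) as Hv. pose proof (pos_INR n) as Hn.
  (* Replacing [alpha] costs [eta * w] and replacing the matrix costs [eta * n |v|^2]; together they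
     stay below [eps]. *)
  set (eta := eps / (2 * (w + INR n * dot v v + 1))).
  assert (Hden : 0 < w + INR n * dot v v + 1) by nra.
  assert (Heta : 0 < eta) by (apply Rdiv_lt_0_compat; lra).
  destruct (Halc 0 t ltac:(split; lra) eta Heta) as [d1 [Hd1 K1]].
  destruct (coef_near n T a (fun _ _ => 0) (vscal 0 e) t eta Ha) as [d2 [Hd2 K2]]; auto.
  { intros x s _ eps' He'. exists 1; split; [lra|]. intros. now rewrite Rminus_diag, Rabs_R0. }
  set (c := Rmin d1 d2 / 2).
  assert (Hm : 0 < Rmin d1 d2) by (now apply Rmin_pos). Rmin_bounds.
  assert (Hc : 0 < c) by (unfold c; lra).
  specialize (Hnz c ltac:(lra)). rewrite (Rabs_right c) in Hnz by lra.
  assert (A1 := K1 c t ltac:(split; lra)). unfold dist2 in A1.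
  rewrite Rminus_0_r, Rminus_diag, Rabs_R0, (Rabs_right c) in A1 by lra.
  specialize (A1 ltac:(unfold c; lra)). apply Rabs_def2 in A1.
  destruct (K2 (vscal c e) t Ht) as [A2 _].
  { replace (vsub (vscal c e) (vscal 0 e)) with (vscal c e) by vec_ring.
    rewrite vnorm_scal, Ne, Rabs_right; unfold c; lra. }
  { rewrite Rminus_diag, Rabs_R0; auto. }
  pose proof (quadform_small n (fun i j => a i j (vscal c e) t + (-1) * a i j (vscal 0 e) t) eta v) as QS.
  assert (QS0 : forall i j, Rabs (a i j (vscal c e) t + (-1) * a i j (vscal 0 e) t) <= eta).
  { intros i j. replace (a i j (vscal c e) t + -1 * a i j (vscal 0 e) t) with (a i j (vscal c e) t - a i j (vscal 0 e) t) by ring. auto. }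
  specialize (QS QS0). rewrite quadform_plus in QS. apply Rabs_le_both in QS.
  assert (E : eta * (2 * (w + INR n * dot v v + 1)) = eps) by (unfold eta; field; lra).
  fold w in Hnz. assert (alpha 0 t * w <= (alpha c t + eta) * w) by (apply Rmult_le_compat_r; lra).
  nra.
Qed.

(** * Localisation of the maximum and passage to the limit *)

Lemma pow4_nonneg x : 0 <= x ^ 4.
Proof. replace (x ^ 4) with ((x ^ 2) ^ 2) by ring. apply pow2_ge_0. Qed.

Lemma pow4_lt_abs x c : 0 < c -> x ^ 4 < c ^ 4 -> Rabs x < c.
Proof.
  intros Hc H. apply Rnot_le_lt; intros Hle.
  assert (c ^ 4 <= Rabs x ^ 4) by (apply pow_incr; lra).
  rewrite RPow_abs, Rabs_right in H0 by (apply Rle_ge, pow4_nonneg). lra.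
Qed.

(** For finite [kap] the doubled maximum need not lie over [(s0, t0)], only close to it; hence the
    inequality is first obtained at nearby points, for the perturbed test function. *)
Lemma nearby_inequality m T a b alpha (u : vec (S m) -> R -> R) :
  0 < T ->
  (forall i j, cont_strip T (a i j)) ->
  cont_strip T b ->
  (forall p t, 0 <= t <= T -> forall i j, a i j p t = a j i p t) ->
  (forall p t, 0 <= t <= T -> forall v, 0 <= quadform (fun i j => a i j p t) v) ->
  cont_on_2 (fun R t => 0 <= R /\ 0 <= t <= T) alpha ->
  (forall R t, 0 <= R -> 0 <= t <= T -> 0 < alpha R t) ->
  (forall R t, 0 < R -> 0 <= t <= T ->
     forall p v : vec (S m), vnorm p = R -> dot v p <> 0 ->
       alpha R t <= R ^ 2 * (quadform (fun i j => a i j p t) v / (dot v p) ^ 2)) ->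
  visc_sol T a b u -> periodic T u ->
  forall s0 t0, 0 < s0 -> 0 < t0 < T ->
  forall r Dphi, 0 < r -> smooth_family_2 (fun s t => dist2 s0 t0 s t < r) Dphi ->
    (exists rho, 0 < rho /\ forall s t, dist2 s0 t0 s t < rho ->
        omega u s t - Dphi nil s t <= omega u s0 t0 - Dphi nil s0 t0) ->
  forall theta, 0 < theta -> exists s t, Rabs (s - s0) < theta /\ Rabs (t - t0) < theta /\ 0 <= t <= T /\
    Dphi (false :: nil) s t + 4 * (t - t0) ^ 3 <=
      alpha (Rabs (Dphi (true :: nil) s t + 4 * (s - s0) ^ 3)) t * (Dphi (true :: true :: nil) s t + 12 * (s - s0) ^ 2).
Proof.
  intros HT Ha Hb Hsym Hpsd Halc Halp Hal [Huc0 [Hsub Hsup]] Hper s0 t0 Hs0 Ht0 r Dphi Hr HD [rho0 [Hrho0 Hmax]] theta Htheta.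
  destruct (periodic_bounded (S m) T u HT Hper Huc0) as [M [HM Hbd]].
  pose proof (periodic_unif_cont (S m) T u Hper Huc0) as Huc.
  set (v := fun x t => - u x t).
  assert (Hvbd : bounded_on T M v) by now apply bounded_opp.
  assert (Hvuc : unif_cont T v) by now apply unif_cont_opp.
  (* The box of radius [rho] must keep [s] positive, [t] inside [(0, T)], and its [dist2] radius, at
     most [2 * rho], within both the maximum hypothesis and the domain of the test function. *)
  set (rho := Rmin (Rmin (theta / 2) (rho0 / 4)) (Rmin (Rmin (r / 4) (s0 / 2)) (Rmin (t0 / 2) ((T - t0) / 2)))).
  assert (Hrho : 0 < rho) by (repeat apply Rmin_pos; lra).
  assert (Hrl : rho < theta /\ 2 * rho < rho0 /\ 2 * rho < r /\ rho < s0 /\ rho < t0 /\ rho < T - t0).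
  { unfold rho. Rmin_bounds. repeat split; lra. }
  (* Lower and upper bounds for the maximum of [W] differ by [4 * eta = rho^4], while the quartic
     terms enter twice; they sum to at most [rho^4 / 2], which puts the maximum in the interior of
     the box. *)
  set (eta := rho ^ 4 / 4).
  assert (Hr4 : 0 < rho ^ 4) by (apply pow_lt; auto).
  assert (Heta : 0 < eta) by (unfold eta; lra).
  destruct (supconv_close (S m) T M u HM Hbd Huc eta Heta) as [k1 [Hk1 HcU]].
  destruct (supconv_close (S m) T M v HM Hvbd Hvuc eta Heta) as [k2 [Hk2 HcV]].
  set (kap := k1 + k2). assert (Hkap : 0 < kap) by (unfold kap; lra).
  specialize (HcU kap ltac:(unfold kap; lra)). specialize (HcV kap ltac:(unfold kap; lra)).
  set (U := supconv kap u) in *. set (V := supconv kap v) in *.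
  assert (HUuc := supconv_unif_cont (S m) T M kap u Hkap Hbd Huc). assert (HVuc := supconv_unif_cont (S m) T M kap v Hkap Hvbd Hvuc).
  fold U in HUuc. fold V in HVuc.
  assert (HUge : forall y t, 0 <= t <= T -> u y t <= U y t) by (intros; apply (supconv_ge_u (S m) T M); auto).
  assert (HVge : forall y t, 0 <= t <= T -> - u y t <= V y t) by (intros; apply (supconv_ge_u (S m) T M kap v); auto).
  set (Phi := phi_strict s0 t0 Dphi).
  set (W := fun x y t => U y t + V x t - 2 * Phi (vnorm (vsub y x) / 2) t).
  destruct Hper as [Bl [HBl HperB]].
  destruct (lattice_reduce (S m) Bl HBl) as [R0 [HR0 Hred]].
  assert (HUper : forall k y t, 0 <= t <= T -> U (vadd y (lattice_vec Bl k)) t = U y t)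
    by (intros; apply supconv_translate; auto).
  assert (HVper : forall k y t, 0 <= t <= T -> V (vadd y (lattice_vec Bl k)) t = V y t)
    by (intros; apply supconv_translate; intros; unfold v; now rewrite HperB).
  assert (Hshift : forall k (x y : vec (S m)), vsub (vadd y (lattice_vec Bl k)) (vadd x (lattice_vec Bl k)) = vsub y x)
    by (intros; vec_ring).
  (* [near] is not compact because of common translations of [x] and [y]; [D] adds a bound on [x],
     which periodicity restores for any pair. *)
  set (near := fun (x y : vec (S m)) t => s0 - rho <= vnorm (vsub y x) / 2 <= s0 + rho /\ t0 - rho <= t <= t0 + rho).
  set (D := fun x y t => vnorm x <= R0 /\ near x y t).
  assert (Hnear_dist : forall x y t, near x y t -> dist2 s0 t0 (vnorm (vsub y x) / 2) t <= 2 * rho).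
  { intros x y t [H1 H2]. unfold dist2. assert (Rabs (vnorm (vsub y x) / 2 - s0) <= rho) by (apply Rabs_le; lra).
    assert (Rabs (t - t0) <= rho) by (apply Rabs_le; lra). lra. }
  destruct (omega_approx m T M u Hbd s0 t0 eta ltac:(lra) ltac:(lra) Heta) as [xa [ya [Hxya Hom]]].
  assert (HD0 : exists k, D (vadd xa (lattice_vec Bl k)) (vadd ya (lattice_vec Bl k)) t0).
  { destruct (Hred xa) as [k Hk]. exists k. split; auto. unfold near. rewrite Hshift, Hxya. lra. }
  destruct (extreme_value (S m) D W (R0 + 2 * (s0 + rho) + t0 + rho)) as [xm [ym [tm [[Hxm Hnm] Hmx]]]].
  { destruct HD0 as [k Hk]. eauto. }
  { intros x y t [H1 [H2 H3]]. pose proof (vnorm_le_sub _ y x). pose proof (vnorm_ge0 _ x).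
    repeat split; try lra. apply Rabs_le; lra. }
  { intros xs ys ts x y t Hx Hy Ht HDs. split; [|split].
    - apply (vcv_norm_le _ xs x R0 Hx); intros k; apply HDs.
    - assert (Un_cv (fun k => vnorm (vsub (ys k) (xs k)) / 2) (vnorm (vsub y x) / 2)) as Hcv.
      { intros eps Heps. destruct (Hx eps Heps) as [N1 HN1]. destruct (Hy eps Heps) as [N2 HN2].
        exists (N1 + N2)%nat. intros k Hk. specialize (HN1 k ltac:(lia)). specialize (HN2 k ltac:(lia)).
        unfold Rdist.
        pose proof (vnorm_diff_le _ (vsub (ys k) (xs k)) (vsub y x)) as A.
        replace (vsub (vsub (ys k) (xs k)) (vsub y x)) with (vsub (vsub (ys k) y) (vsub (xs k) x)) in A by vec_ring.
        pose proof (vnorm_sub_le _ (vsub (ys k) y) (vsub (xs k) x)).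
        apply Rabs_le_both in A. apply Rabs_def1; lra. }
      apply (Un_cv_bounds _ _ _ _ Hcv). intros k; apply HDs.
    - apply (Un_cv_bounds ts t _ _ Ht). intros k; apply HDs. }
  { intros x y t [H1 Hn] eps Heps.
    assert (Hd2 := Hnear_dist x y t Hn). destruct Hn as [H2 H3].
    destruct (HUuc (eps / 4) ltac:(lra)) as [d1 [Hd1 K1]].
    destruct (HVuc (eps / 4) ltac:(lra)) as [d2 [Hd2' K2]].
    destruct (phi_strict_cont s0 t0 r Dphi HD (vnorm (vsub y x) / 2) t (eps / 4) ltac:(lra) ltac:(lra)) as [d3 [Hd3 K3]].
    exists (Rmin (Rmin d1 d2) d3). split; [repeat apply Rmin_pos; auto|].
    intros x' y' t' [H1' [H2' H3']] Hx Hy Ht.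
    Rmin_bounds.
    specialize (K1 y t y' t' ltac:(lra) ltac:(lra) ltac:(lra) ltac:(lra)).
    specialize (K2 x t x' t' ltac:(lra) ltac:(lra) ltac:(lra) ltac:(lra)).
    assert (Hs : Rabs (vnorm (vsub y' x') / 2 - vnorm (vsub y x) / 2) < d3).
    { pose proof (vnorm_diff_le _ (vsub y' x') (vsub y x)) as A.
      replace (vsub (vsub y' x') (vsub y x)) with (vsub (vsub y' y) (vsub x' x)) in A by vec_ring.
      pose proof (vnorm_sub_le _ (vsub y' y) (vsub x' x)).
      apply Rabs_le_both in A. apply Rabs_def1; lra. }
    specialize (K3 _ t' Hs ltac:(lra)). apply Rabs_def2 in K1, K2, K3. unfold W, Phi. lra. }
  set (sm := vnorm (vsub ym xm) / 2) in *.
  assert (Hnm' := Hnm). destruct Hnm' as [Hn1 Hn2]. fold sm in Hn1.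
  assert (Hglob : forall x y t, near x y t -> W x y t <= W xm ym tm).
  { intros x y t Hn. destruct (Hred x) as [k Hk].
    assert (HDk : D (vadd x (lattice_vec Bl k)) (vadd y (lattice_vec Bl k)) t) by (split; auto; unfold near; now rewrite Hshift).
    specialize (Hmx _ _ _ HDk). unfold W in Hmx at 1. destruct Hn as [_ Hn].
    rewrite Hshift, HUper, HVper in Hmx by lra. exact Hmx. }
  assert (Hdm : dist2 s0 t0 sm tm <= 2 * rho) by (apply (Hnear_dist xm ym tm); auto).
  assert (Hlow : 2 * omega u s0 t0 - 2 * eta - 2 * Dphi nil s0 t0 <= W xm ym tm).
  { eapply Rle_trans; [|apply (Hglob xa ya t0)].
    - unfold W, Phi, phi_strict. rewrite Hxya, !Rminus_diag.
      specialize (HUge ya t0 ltac:(lra)). specialize (HVge xa t0 ltac:(lra)). simpl. lra.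
    - unfold near. rewrite Hxya. lra. }
  assert (Hup : W xm ym tm <= 2 * omega u s0 t0 + 2 * eta - 2 * Dphi nil s0 t0 - 2 * ((sm - s0) ^ 4 + (tm - t0) ^ 4)).
  { unfold W, Phi, phi_strict. fold sm.
    specialize (HcU ym tm ltac:(lra)). specialize (HcV xm tm ltac:(lra)). unfold v in HcV.
    pose proof (omega_ge m T M u Hbd xm ym tm ltac:(lra)) as Ho. fold sm in Ho.
    specialize (Hmax sm tm ltac:(lra)). lra. }
  (* Strictness here yields [|sm - s0| < rho] and [|tm - t0| < rho], so that small perturbations of
     the maximum point remain in [near]. *)
  assert (Hq : (sm - s0) ^ 4 + (tm - t0) ^ 4 < rho ^ 4) by (unfold eta in *; lra).
  pose proof (pow4_nonneg (sm - s0)). pose proof (pow4_nonneg (tm - t0)).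
  assert (Hsm : Rabs (sm - s0) < rho) by (apply pow4_lt_abs; lra).
  assert (Htm : Rabs (tm - t0) < rho) by (apply pow4_lt_abs; lra).
  exists sm, tm. split; [lra|]. split; [lra|]. split; [lra|].
  set (p1 := Dphi (true :: nil) sm tm + 4 * (sm - s0) ^ 3).
  set (p2 := Dphi (true :: true :: nil) sm tm + 12 * (sm - s0) ^ 2).
  set (p3 := Dphi (false :: nil) sm tm + 4 * (tm - t0) ^ 3).
  set (al := alpha (Rabs p1) tm).
  assert (Hal0 : 0 < al) by (apply Halp; [apply Rabs_pos | lra]).
  assert (p3 - al * p2 <= 0); [|lra].
  apply (le_0_of_small _ (2 * al) 1); [lra|]. intros del [Hdel _].
  set (xi := vsub ym xm). set (e := vscal (/ (2 * sm)) xi).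
  assert (Hsm0 : 0 < sm) by lra.
  assert (Hxi : vnorm xi = 2 * sm) by (unfold sm, xi; field).
  assert (Hee : dot e e = 1) by (unfold e; rewrite dot_scal_l, dot_scal_r, <- vnorm_sq, Hxi; field; lra).
  destruct (radial_expand (S m) s0 t0 r Dphi xi e sm tm del HD ltac:(lra) Hsm0 Hxi eq_refl Hdel) as [Cq [C [d [HCq [Hd Hexp]]]]].
  fold p1 p2 p3 in Hexp. fold Phi in Hexp.
  (* The right side is [2 al p2 + 4 al del]; halving gives the bound [2 * al * del] demanded by
     [le_0_of_small]. *)
  assert (Hfin : 2 * p3 <= 8 * ((p2 + 2 * del) / 4) * al); [|lra].
  apply (doubling_inequality (S m) T a b u kap M xm ym tm e al p1 ((p2 + 2 * del) / 4) Cq (2 * p3)); auto; try lra.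
  - apply (elliptic_lower_bound (S m) T); auto. lra.
  - set (r' := Rmin (d / 2) (Rmin (rho - Rabs (sm - s0)) (rho - Rabs (tm - t0)))).
    exists C, r'. split; [repeat apply Rmin_pos; lra|].
    assert (Hr' : r' <= d / 2 /\ r' <= rho - Rabs (sm - s0) /\ r' <= rho - Rabs (tm - t0)).
    { unfold r'. Rmin_bounds. repeat split; lra. }
    clearbody r'.
    intros x y t Hx Hy Ht.
    set (ze := vsub (vsub y x) (vsub ym xm)).
    assert (Eze : ze = vsub (vsub y ym) (vsub x xm)) by (unfold ze; vec_ring).
    assert (Hze : vnorm ze < 2 * r') by (rewrite Eze; eapply Rle_lt_trans; [apply vnorm_sub_le | lra]).
    assert (Eyx : vsub y x = vadd xi ze) by (unfold ze, xi; now rewrite vadd_vsub).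
    assert (Hnr : near x y t).
    { split.
      - pose proof (vnorm_diff_le _ (vsub y x) xi) as A. fold xi in ze. fold ze in A.
        pose proof (Rabs_le_both (sm - s0) _ (Rle_refl _)). apply Rabs_le_both in A. lra.
      - apply Rabs_def2 in Ht. pose proof (Rabs_le_both (tm - t0) _ (Rle_refl _)). lra. }
    specialize (Hglob x y t Hnr). unfold W in Hglob. fold sm in Hglob. rewrite Eyx in Hglob.
    specialize (Hexp ze (t - tm) ltac:(lra) ltac:(lra)). replace (tm + (t - tm)) with t in Hexp by ring.
    fold U V. fold v. fold V. lra.
Qed.

Theorem theorem1p1 (n : nat) (T : R)
  (a : Fin.t n -> Fin.t n -> vec n -> R -> R) (b : vec n -> R -> R)
  (alpha : R -> R -> R) (u : vec n -> R -> R) :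
  (1 <= n)%nat -> 0 < T ->
  (forall i j, cont_on_nt (fun _ t => 0 <= t <= T) (a i j)) ->
  cont_on_nt (fun _ t => 0 <= t <= T) b ->
  (forall p t, 0 <= t <= T -> forall i j, a i j p t = a j i p t) ->
  (forall p t, 0 <= t <= T -> forall v, 0 <= quadform (fun i j => a i j p t) v) ->
  cont_on_2 (fun R t => 0 <= R /\ 0 <= t <= T) alpha ->
  (forall R t, 0 <= R -> 0 <= t <= T -> 0 < alpha R t) ->
  (forall R t, 0 < R -> 0 <= t <= T ->
     forall p v : vec n, vnorm p = R -> dot v p <> 0 ->
       alpha R t <= R ^ 2 * (quadform (fun i j => a i j p t) v / (dot v p) ^ 2)) ->
  visc_sol T a b u ->
  (exists B : Fin.t n -> vec n, lin_indep B /\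
     forall k x t, 0 <= t <= T -> u (vadd x (lattice_vec B k)) t = u x t) ->
  forall s0 t0, 0 < s0 -> 0 < t0 < T ->
  forall r (Dphi : list bool -> R -> R -> R), 0 < r ->
    smooth_family_2 (fun s t => dist2 s0 t0 s t < r) Dphi ->
    (exists rho, 0 < rho /\ forall s t, dist2 s0 t0 s t < rho ->
        omega u s t - Dphi nil s t <= omega u s0 t0 - Dphi nil s0 t0) ->
    Dphi (false :: nil) s0 t0
      <= alpha (Rabs (Dphi (true :: nil) s0 t0)) t0 * Dphi (true :: true :: nil) s0 t0.
Proof.
  intros Hn HT Ha Hb Hsym Hpsd Halc Halp Hal Hu Hper s0 t0 Hs0 Ht0 r Dphi Hr HD Hmax.
  destruct n as [|m]; [lia|].
  pose proof (nearby_inequality m T a b alpha u HT Ha Hb Hsym Hpsd Halc Halp Hal Hu Hper s0 t0 Hs0 Ht0 r Dphi Hr HD Hmax) as Hnear.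
  (* A strict violation at [(s0, t0)] would persist, by continuity of [alpha] and of the
     derivatives, at the nearby points where the perturbed inequality holds. *)
  apply Rnot_lt_le; intros Hlt.
  assert (Hin : dist2 s0 t0 s0 t0 < r) by (unfold dist2; rewrite !Rminus_diag, Rabs_R0; lra).
  set (f1 := Dphi (true :: nil) s0 t0) in *. set (f2 := Dphi (true :: true :: nil) s0 t0) in *.
  set (f3 := Dphi (false :: nil) s0 t0) in *. set (al := alpha (Rabs f1) t0) in *.
  assert (Hal0 : 0 < al) by (apply Halp; [apply Rabs_pos | lra]).
  set (L := f3 - al * f2). assert (HL : 0 < L) by (unfold L; lra).
  pose proof (Rabs_pos f2) as Hf2.
  (* The product [alpha * phi''] may vary by [eps * (|f2| + al + 1)], and the time derivative with
     its cubic correction by less than [2 * eps]; the sum stays below the gap [L]. *)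
  set (eps := Rmin 1 (L / (2 * (Rabs f2 + al + 3)))).
  assert (He0 : 0 < eps) by (apply Rmin_pos; [lra | apply Rdiv_lt_0_compat; lra]).
  assert (He1 : eps <= 1) by apply Rmin_l.
  assert (He2 : eps * (Rabs f2 + al + 3) < L).
  { assert (eps <= L / (2 * (Rabs f2 + al + 3))) by apply Rmin_r.
    assert (E : L / (2 * (Rabs f2 + al + 3)) * (Rabs f2 + al + 3) = L / 2) by (field; lra).
    assert (eps * (Rabs f2 + al + 3) <= L / 2) by (rewrite <- E; apply Rmult_le_compat_r; lra). lra. }
  destruct (Halc (Rabs f1) t0 ltac:(split; [apply Rabs_pos | lra]) eps He0) as [da [Hda Ka]].
  destruct (Dphi_cont s0 t0 r Dphi HD (true :: nil) s0 t0 (da / 4) Hin ltac:(lra)) as [d1 [Hd1 K1]].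
  destruct (Dphi_cont s0 t0 r Dphi HD (true :: true :: nil) s0 t0 (eps / 2) Hin ltac:(lra)) as [d2 [Hd2 K2]].
  destruct (Dphi_cont s0 t0 r Dphi HD (false :: nil) s0 t0 (eps / 2) Hin ltac:(lra)) as [d3 [Hd3 K3]].
  (* [th <= eps / 24] bounds the correction [12 (s - s0)^2] by [eps / 2]; [th <= da / 16] bounds
     [4 (s - s0)^3] by [da / 4] and leaves room for the time shift in the continuity of [alpha]. *)
  set (th := Rmin (Rmin (Rmin d1 d2) d3) (Rmin (eps / 24) (da / 16))).
  assert (Hth : 0 < th) by (repeat apply Rmin_pos; lra).
  assert (Hthl : th <= d1 /\ th <= d2 /\ th <= d3 /\ th <= eps / 24 /\ th <= da / 16).
  { unfold th. Rmin_bounds. repeat split; lra. }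
  destruct (Hnear th Hth) as [s [t [Hs [Ht [HtT Hineq]]]]].
  specialize (K1 s t ltac:(lra) ltac:(lra)). specialize (K2 s t ltac:(lra) ltac:(lra)). specialize (K3 s t ltac:(lra) ltac:(lra)).
  fold f1 in K1. fold f2 in K2. fold f3 in K3.
  assert (Hcube : forall x, Rabs x < th -> Rabs (4 * x ^ 3) <= 4 * th /\ 0 <= 12 * x ^ 2 <= 12 * th).
  { intros x Hx. assert (Hx1 : Rabs x <= 1) by lra. pose proof (Rabs_pos x).
    assert (E : x ^ 2 = Rabs x * Rabs x) by (rewrite <- pow2_abs; ring).
    assert (Rabs x * Rabs x <= Rabs x) by nra. split; [|nra].
    rewrite Rabs_mult, (Rabs_right 4), <- RPow_abs by lra.
    replace (Rabs x ^ 3) with (Rabs x * (Rabs x * Rabs x)) by ring. nra. }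
  destruct (Hcube _ Hs) as [Cs1 Cs2]. destruct (Hcube _ Ht) as [Ct1 _].
  set (p1 := Dphi (true :: nil) s t + 4 * (s - s0) ^ 3) in *.
  set (p2 := Dphi (true :: true :: nil) s t + 12 * (s - s0) ^ 2) in *.
  assert (Hp1 : Rabs (Rabs p1 - Rabs f1) < da / 2).
  { eapply Rle_lt_trans; [apply Rabs_triang_inv2|]. unfold p1.
    replace (Dphi (true :: nil) s t + 4 * (s - s0) ^ 3 - f1) with ((Dphi (true :: nil) s t - f1) + 4 * (s - s0) ^ 3) by ring.
    eapply Rle_lt_trans; [apply Rabs_triang|]. lra. }
  specialize (Ka (Rabs p1) t ltac:(split; [apply Rabs_pos | lra])). unfold dist2 in Ka.
  specialize (Ka ltac:(lra)). fold al in Ka.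
  assert (Hp2 : Rabs (p2 - f2) <= eps).
  { unfold p2. apply Rabs_def2 in K2. apply Rabs_le; lra. }
  apply Rabs_le_both in Ct1. apply Rabs_def2 in K3.
  set (q := alpha (Rabs p1) t) in *.
  assert (Hprod : q * p2 - al * f2 <= eps * (Rabs f2 + al + 1)).
  { replace (q * p2 - al * f2) with ((q - al) * f2 + (q - al) * (p2 - f2) + al * (p2 - f2)) by ring.
    assert (A1 : (q - al) * f2 <= eps * Rabs f2).
    { eapply Rle_trans; [apply Rle_abs|]. rewrite Rabs_mult. apply Rmult_le_compat_r; lra. }
    assert (A2 : (q - al) * (p2 - f2) <= eps * 1).
    { eapply Rle_trans; [apply Rle_abs|]. rewrite Rabs_mult. apply Rmult_le_compat; auto using Rabs_pos; lra. }
    assert (A3 : al * (p2 - f2) <= al * eps).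
    { apply Rmult_le_compat_l; [lra|]. eapply Rle_trans; [apply Rle_abs | exact Hp2]. }
    lra. }
  unfold L in *. lra.
Qed.
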